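(* Let $N$ be a compact oriented 3-manifold with $\partial N$ homeomorphic to a torus, let $K$ be an ideal triangulation of $N$ with $n$ ideal tetrahedra, and assume that the deformation variety $\mathcal{D}(N)=\mathcal{D}(N,K)$ is non-empty. Let $I=(i_1,\dots,i_n)\in\{1,0,\infty\}^n$ be a degeneration index with degeneration vector $d(I)=(d(I)_1,\dots,d(I)_n)\in\mathbb{Z}^n$. If $d(I)>0$ or $d(I)<0$ (i.e. all $d(I)_\nu$ are positive, or all $d(I)_\nu$ are negative), then there are ideal points of $\mathcal{D}(N)$ corresponding to $I$, and the number of ideal points of $\mathcal{D}(N)$ corresponding to $I$ is $\gcd(d(I)_1,\dots,d(I)_n)$.
   Context: **Ideal triangulation.** $K$ is a cell complex obtained by gluing tetrahedra along faces, with exactly one 0-simplex $e^0$, such that $K$ minus a small neighbourhood of $e^0$ is homeomorphic to $N$. Tetrahedra are oriented by $N$. If $n$ is the number of tetrahedra, then there are also $n$ 1-simplices $e_1,\dots,e_n$. **Complex parameters.** For an oriented ideal tetrahedron with distinct vertices $x_0,x_1,x_2,x_3\in\mathbb{C}P^1$, the parameter of the edge $(x_i,x_j)$ is $\frac{(x_k-x_j)(x_l-x_i)}{(x_k-x_i)(x_l-x_j)}$, where $k,l$ are such that $(i,j,k,l)$ gives the orientation of the tetrahedron. Opposite edges have equal parameters; if one edge has parameter $z$, the other two pairs of opposite edges have parameters $\frac1{1-z}$ and $1-\frac1z$. Choose for the $\nu$-th tetrahedron an edge with parameter $z_\nu\in\mathbb{C}\setminus\{0,1\}$, and put $w_\nu=1-z_\nu$.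 **Gluing equations.** Let $p_{i,\nu},p'_{i,\nu},p''_{i,\nu}$ be the numbers of edges of the $\nu$-th tetrahedron attached to $e_i$ with parameter $z_\nu$, $\frac{1}{1-z_\nu}$, $1-\frac1{z_\nu}$ respectively. Put $r'_{i,\nu}=p_{i,\nu}-p''_{i,\nu}$, $r''_{i,\nu}=p''_{i,\nu}-p'_{i,\nu}$ and $$R_i=\prod_{\nu=1}^n z_\nu^{p_{i,\nu}}\Big(\tfrac{1}{1-z_\nu}\Big)^{p'_{i,\nu}}\Big(1-\tfrac1{z_\nu}\Big)^{p''_{i,\nu}}=\prod_{\nu=1}^n(-1)^{p''_{i,\nu}}z_\nu^{r'_{i,\nu}}w_\nu^{r''_{i,\nu}}.$$ Since $R_1\cdots R_n=1$, only $R_1,\dots,R_{n-1}$ are used. The deformation variety is $$\mathcal{D}(N,K)=\{(z_1,\dots,z_n)\in(\mathbb{C}\setminus\{0,1\})^n : R_1=1,\dots,R_{n-1}=1\},$$ an affine algebraic set (closed in $(\mathbb{C}^* )^{2n}$ via coordinates $(z,w)$; it need not be irreducible). **Degeneration vector.** For $I=(i_1,\dots,i_n)\in\{1,0,\infty\}^n$ and $1\le j\le n-1$, let $r(I)_{j,\nu}=r''_{j,\nu}$ if $i_\nu=1$, $r(I)_{j,\nu}=r'_{j,\nu}$ if $i_\nu=0$, and $r(I)_{j,\nu}=-r'_{j,\nu}-r''_{j,\nu}$ if $i_\nu=\infty$. Let $R(I)=(r(I)_{j,\nu})$, an $(n-1)\times n$ matrix. Then $d(I)_\nu=(-1)^{\nu+1}\det(R(I)\text{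 with its }\nu\text{-th column removed})$. **Ideal points.** For an affine algebraic curve $C$, let $\bar C$ be a projective completion, $\tilde C$ the smooth projective curve birationally equivalent to $C$, and $f:\tilde C\to\bar C$ the corresponding regular birational map; the ideal points of $C$ are the points of $f^{-1}(\bar C-C)\subset\tilde C$. An ideal point of $\mathcal{D}(N)$ is an ideal point of an irreducible algebraic curve contained in $\mathcal{D}(N)$. It corresponds to $I$ if $z_\nu$ tends to $i_\nu$ at that point for every $\nu$; equivalently, the associated valuation $v$ satisfies, for each $\nu$: $v(w_\nu)>0$ if $i_\nu=1$; $v(z_\nu)>0$ if $i_\nu=0$; $v(z_\nu)<0$ if $i_\nu=\infty$. *)

(* Defs.v *)
(* The notations of mpoly clash with those of MathComp-Analysis. *)
From HB Require Import structures.
From mathcomp Require Import all_boot all_order all_fingroup all_algebra.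
From mathcomp Require Import complex.
From mathcomp Require Import -(notations) mpoly.
From mathcomp Require Import all_classical all_reals all_analysis.
Set Implicit Arguments.
Unset Strict Implicit.
Unset Printing Implicit Defensive.
Import Order.TTheory GRing.Theory Num.Theory.
Import numFieldNormedType.Exports.
Local Open Scope ring_scope.

(* The tetrahedra are indexed by 'I_n. The vertices of each one are labelled
   by 'I_4, in such a way that (0, 1, 2, 3) is its orientation. The face f of
   a tetrahedron is the one opposite to the vertex f. The face f of nu is
   glued to a face of gl_tet nu f, the vertex i != f of nu going to the vertex
   gl_perm nu f i; the value gl_perm nu f f is the index of the target face.
   The orientations of the two tetrahedra agree across the face if and only if
   this permutation is odd; so gl_odd says that the tetrahedra are coherently
   oriented, which is how an orientation of the 3-manifold is represented. *)
Record gluing (n : nat) := Gluing {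
  gl_tet : 'I_n -> 'I_4 -> 'I_n;
  gl_perm : 'I_n -> 'I_4 -> {perm 'I_4};
  gl_tetK : forall nu f, gl_tet (gl_tet nu f) (gl_perm nu f f) = nu;
  gl_permK : forall nu f,
    gl_perm (gl_tet nu f) (gl_perm nu f f) = ((gl_perm nu f)^-1)%g;
  gl_free : forall nu f, (gl_tet nu f, gl_perm nu f f) != (nu, f);
  gl_odd : forall nu f, odd_perm (gl_perm nu f) }.

Section Combinatorics.
Variables (n : nat) (K : gluing n).

Definition vertex_adj : rel ('I_n * 'I_4) := fun x y =>
  [exists f, (x.2 != f) && (y == (gl_tet K x.1 f, gl_perm K x.1 f x.2))].

Definition one_vertex : Prop :=
  exists x, forall y, connect vertex_adj x y.

(* An edge of a tetrahedron is the set of its two endpoints. *)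
Definition edge_adj : rel ('I_n * {set 'I_4}) := fun x y =>
  [exists f, (f \notin x.2) &&
             (y == (gl_tet K x.1 f, [set gl_perm K x.1 f i | i in x.2]%SET))].

(* A numbering e_1, ..., e_n of the 1-simplices of K: e (nu, A) is the index of
   the 1-simplex to which the edge A of the tetrahedron nu is attached. *)
Definition edge_numbering (e : 'I_n * {set 'I_4} -> 'I_n) : Prop :=
  (forall x y : 'I_n * {set 'I_4}, #|x.2| = 2%N -> #|y.2| = 2%N ->
     (e x == e y) = connect edge_adj x y) /\
  (forall i, exists2 x : 'I_n * {set 'I_4}, #|x.2| = 2%N & e x = i).

End Combinatorics.

Section Shapes.
Variable F : fieldType.

(* The parameter of the edge (x_(s 0), x_(s 1)), for s even. *)
Definition edge_param (x : 'I_4 -> F) (s : {perm 'I_4}) : F :=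
  let i := s 0 in let j := s 1 in let k := s 2%:R in let l := s 3%:R in
  ((x k - x j) * (x l - x i)) / ((x k - x i) * (x l - x j)).

(* Whenever the edge c has parameter z, the edge A has parameter phi z. *)
Definition param_related (c A : {set 'I_4}) (phi : F -> F) : Prop :=
  forall (x : 'I_4 -> F) (s t : {perm 'I_4}), injective x ->
    ~~ odd_perm s -> ~~ odd_perm t ->
    [set s 0; s 1]%SET = c -> [set t 0; t 1]%SET = A ->
    edge_param x t = phi (edge_param x s).

Variables (n : nat) (e : 'I_n * {set 'I_4} -> 'I_n) (c : 'I_n -> {set 'I_4}).

Definition param_count (phi : F -> F) (i nu : 'I_n) : nat :=
  #|[pred A : {set 'I_4} | [&& #|A| == 2%N, e (nu, A) == i
                             & `[< param_related (c nu) A phi >]]]|.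

(* p0, p1, p2, r1, r2 stand for p, p', p'', r', r''. *)
Definition p0 := param_count (fun z => z).
Definition p1 := param_count (fun z => 1 / (1 - z)).
Definition p2 := param_count (fun z => 1 - 1 / z).

Definition r1 (i nu : 'I_n) : int := (p0 i nu)%:Z - (p2 i nu)%:Z.
Definition r2 (i nu : 'I_n) : int := (p2 i nu)%:Z - (p1 i nu)%:Z.

Definition gluing_monomial (z : 'rV[F]_n) (i : 'I_n) : F :=
  \prod_(nu < n) (z 0 nu ^+ p0 i nu * (1 / (1 - z 0 nu)) ^+ p1 i nu
                  * (1 - 1 / z 0 nu) ^+ p2 i nu).

Definition to_ord (j : 'I_n.-1) : 'I_n := widen_ord (leq_pred n) j.

Definition shape_space : set 'rV[F]_n :=
  [set z | forall nu, z 0 nu != 0 /\ z 0 nu != 1]%classic.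

Definition deformation_variety : set 'rV[F]_n :=
  [set z | shape_space z /\
           forall j : 'I_n.-1, gluing_monomial z (to_ord j) = 1]%classic.

Inductive limit_value := To1 | To0 | ToInfinity.

Definition degeneration_coef (I : 'I_n -> limit_value) (j : 'I_n.-1)
    (nu : 'I_n) : int :=
  match I nu with
  | To1 => r2 (to_ord j) nu
  | To0 => r1 (to_ord j) nu
  | ToInfinity => - r1 (to_ord j) nu - r2 (to_ord j) nu
  end.

Definition degeneration_matrix (I : 'I_n -> limit_value) : 'M[int]_(n.-1, n) :=
  \matrix_(j, nu) degeneration_coef I j nu.

(* The columns are indexed from 0, hence the sign (-1)^nu. *)
Definition degeneration_vector (I : 'I_n -> limit_value) (nu : 'I_n) : int :=
  (-1) ^+ nu * \det (col' nu (degeneration_matrix I)).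

End Shapes.
Arguments deformation_variety F {n} e c _.

Local Open Scope classical_set_scope.

Section ZariskiSets.
Variables (T : Type) (closed_family : set (set T)).

Definition irreducible_closed (X : set T) : Prop :=
  [/\ closed_family X, X !=set0 &
    forall A B, closed_family A -> closed_family B ->
      X `<=` A `|` B -> X `<=` A \/ X `<=` B].

(* Irreducible closed of Krull dimension 1: the longest chains of irreducible
   closed subsets have the form Y < X. *)
Definition irreducible_curve (X : set T) : Prop :=
  [/\ irreducible_closed X,
      exists2 Y, irreducible_closed Y & Y `<` X &
      ~ exists Y Z, [/\ irreducible_closed Y, irreducible_closed Z,
                        Y `<` Z & Z `<` X]].

Definition zariski_closure (A : set T) : set T :=
  \bigcap_(B in [set B | closed_family B /\ A `<=` B]) B.

End ZariskiSets.

Section AlgebraicGeometry.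
Variable F : fieldType.

Definition poly_eval m (p : mpoly m F) (v : 'rV[F]_m) : F :=
  meval (fun i => v 0 i) p.

Definition affine_closed n : set (set 'rV[F]_n) :=
  [set A | exists S : set (mpoly n F),
     A = [set z | shape_space z /\ forall p, S p -> poly_eval p z = 0]].

Definition curve_in n (D : set 'rV[F]_n) : Type :=
  {C : set 'rV[F]_n | irreducible_curve (@affine_closed n) C /\ C `<=` D}.

(* The points of the projective space P^m are the lines of F^(m+1). *)
Definition ppoint (m : nat) : Type :=
  {L : {vspace 'rV[F]_m.+1} | \dim L == 1%N}.

Definition hcoords m (x : ppoint m) (v : 'rV[F]_m.+1) : Prop :=
  v != 0 /\ v \in val x.

Definition homogeneous m (d : nat) (p : mpoly m F) : Prop :=
  p \is ishomog1 d mdeg.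

Definition pzero m (p : mpoly m.+1 F) : set (ppoint m) :=
  [set x | forall v, hcoords x v -> poly_eval p v = 0].

Definition proj_closed m : set (set (ppoint m)) :=
  [set X | exists S : set (mpoly m.+1 F),
     (forall p, S p -> exists d, homogeneous d p) /\
     X = \bigcap_(p in S) pzero p].

(* Jacobian criterion: the tangent space at x of the affine cone over X has
   dimension 2. *)
Definition smooth_curve m (X : set (ppoint m)) : Prop :=
  irreducible_curve (@proj_closed m) X /\
  forall x, X x -> exists2 T : {vspace 'rV[F]_m.+1}, \dim T = 2%N &
    forall u, u \in T <->
      forall d p v, homogeneous d p -> X `<=` pzero p -> hcoords x v ->
        \sum_(i < m.+1) poly_eval (mderiv i p) v * u 0 i = 0.

Definition regular_on m k (U : set (ppoint m)) (f : ppoint m -> ppoint k) :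
    Prop :=
  forall x, U x -> exists d (G : 'I_k.+1 -> mpoly m.+1 F) (Z : set (ppoint m)),
    [/\ forall i, homogeneous d (G i), @proj_closed m Z, ~ Z x &
        forall y v, U y -> ~ Z y -> hcoords y v ->
          hcoords (f y) (\row_i poly_eval (G i) v)].

Definition birational m k (X : set (ppoint m)) (Y : set (ppoint k))
    (f : ppoint m -> ppoint k) : Prop :=
  exists (A : set (ppoint m)) (B : set (ppoint k)) (g : ppoint k -> ppoint m),
    [/\ @proj_closed m A /\ @proj_closed k B,
        ~ (X `<=` A) /\ ~ (Y `<=` B),
        regular_on (X `\` A) f /\ regular_on (Y `\` B) g,
        forall x, (X `\` A) x -> (Y `\` B) (f x) /\ g (f x) = x &
        forall y, (Y `\` B) y -> (X `\` A) (g y) /\ f (g y) = y].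

(* The image of C under z |-> [1 : z_1 : ... : z_n]. *)
Definition proj_embedding n (C : set 'rV[F]_n) : set (ppoint n) :=
  [set x | exists2 z, C z & hcoords x (row_mx (1 : 'rV[F]_1) z)].

Definition projective_completion n (C : set 'rV[F]_n) : set (ppoint n) :=
  zariski_closure (@proj_closed n) (proj_embedding C).

(* A smooth projective curve birationally equivalent to Y, with the
   corresponding regular birational map. *)
Record smooth_model k (Y : set (ppoint k)) := SmoothModel {
  sm_dim : nat;
  sm_curve : set (ppoint sm_dim);
  sm_map : ppoint sm_dim -> ppoint k;
  sm_smooth : smooth_curve sm_curve;
  sm_maps : forall x, sm_curve x -> Y (sm_map x);
  sm_regular : regular_on sm_curve sm_map;
  sm_birational : birational sm_curve Y sm_map }.
Arguments sm_curve {k Y} _ _.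
Arguments sm_map {k Y} _ _.

(* The rational function z_nu on the smooth curve has a value in P^1 at x: if
   it is A / B with A and B homogeneous of the same degree and not both zero at
   x, this value is [A(x) : B(x)]. *)
Definition tends_to n (C : set 'rV[F]_n)
    (M : smooth_model (projective_completion C)) (x : ppoint (sm_dim M))
    (nu : 'I_n) (a : limit_value) : Prop :=
  exists d (A B : mpoly (sm_dim M).+1 F),
    [/\ homogeneous d A /\ homogeneous d B,
        forall y v z, sm_curve M y -> hcoords y v -> C z ->
          hcoords (sm_map M y) (row_mx (1 : 'rV[F]_1) z) ->
          poly_eval A v = z 0 nu * poly_eval B v &
        forall v, hcoords x v ->
          match a with
          | To1 => poly_eval A v = poly_eval B v /\ poly_eval B v != 0
          | To0 => poly_eval A v = 0 /\ poly_eval B v != 0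
          | ToInfinity => poly_eval A v != 0 /\ poly_eval B v = 0
          end].

Section IdealPoints.
Variables (n : nat) (D : set 'rV[F]_n).
Variable M : forall C : curve_in D,
  smooth_model (projective_completion (proj1_sig C)).

Definition ideal_points : set {C : curve_in D & ppoint (sm_dim (M C))} :=
  [set P | sm_curve (M (projT1 P)) (projT2 P) /\
    (projective_completion (proj1_sig (projT1 P))
      `\` proj_embedding (proj1_sig (projT1 P)))
      (sm_map (M (projT1 P)) (projT2 P))].

Definition ideal_points_at (I : 'I_n -> limit_value) :
    set {C : curve_in D & ppoint (sm_dim (M C))} :=
  [set P | ideal_points P /\ forall nu, tends_to (projT2 P) nu (I nu)].

End IdealPoints.

End AlgebraicGeometry.
Arguments ideal_points {F n D} M _.
Arguments ideal_points_at {F n D} M I _.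

Definition homeomorphic_sets (S T : topologicalType) (A : set S) (B : set T) :
    Prop :=
  exists (f : S -> T) (g : T -> S),
    [/\ {within A, continuous f}, {within B, continuous g},
        forall x, A x -> B (f x) /\ g (f x) = x &
        forall y, B y -> A (g y) /\ f (g y) = y].

Section Manifolds.
Variables (R : realType) (N : topologicalType).

Definition half_space : set 'rV[R]_3 := [set x | 0 <= x 0 0].

Definition compact_3manifold : Prop :=
  [/\ hausdorff_space N, @second_countable N, compact [set: N] &
    forall x : N, exists (U : set N) (V : set 'rV[R]_3),
      [/\ open U, U x, open V & homeomorphic_sets U (V `&` half_space)]].

Definition manifold_boundary : set N :=
  [set x | ~ exists (U : set N) (V : set 'rV[R]_3),
     [/\ open U, U x, open V & homeomorphic_sets U V]].

Definition circle : set (R * R)%type := [set x | x.1 ^+ 2 + x.2 ^+ 2 = 1].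

Definition torus : set ((R * R) * (R * R))%type := circle `*` circle.

(* A tetrahedron, in barycentric coordinates, minus open neighbourhoods of its
   vertices. *)
Definition truncated_tetrahedron : set 'rV[R]_4 :=
  [set x | \sum_i x 0 i = 1 /\ forall i, 0 <= x 0 i <= 3 / 4].

Variables (n : nat) (K : gluing n).

Inductive glued : 'I_n * 'rV[R]_4 -> 'I_n * 'rV[R]_4 -> Prop :=
  | glued_refl u : glued u u
  | glued_face nu (x : 'rV[R]_4) f u : x 0 f = 0 ->
      glued (gl_tet K nu f, \row_i x 0 ((gl_perm K nu f)^-1%g i)) u ->
      glued (nu, x) u.

(* The map q identifies N with the quotient of the disjoint union of the n
   truncated tetrahedra, that is, with K minus a small open neighbourhood of
   its vertex. *)
Definition ideal_triangulation : Prop :=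
  one_vertex K /\
  exists q : 'I_n -> 'rV[R]_4 -> N,
    [/\ forall y, exists nu x, truncated_tetrahedron x /\ q nu x = y,
        forall nu x mu y, truncated_tetrahedron x -> truncated_tetrahedron y ->
          (q nu x = q mu y <-> glued (nu, x) (mu, y)) &
        forall U : set N, open U <->
          forall nu, exists2 V : set 'rV[R]_4, open V &
            truncated_tetrahedron `&` q nu @^-1` U =
            truncated_tetrahedron `&` V].

End Manifolds.
Arguments manifold_boundary R N _ : clear implicits.
Arguments torus R _ : clear implicits.

(* Main.v *)
(* Near a point where z_nu tends to i_nu, use the coordinates t_nu = 1 - z_nu, z_nu or 1 / z_nu, which tend to 0. The
   gluing equations become prod_nu t_nu^(r(I)_(j, nu)) * (unit) = +-1, the unit being a monomial in the 1 - t_nu. The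
   Smith normal form of R(I) provides monomial coordinates s, u_1, ..., u_(n-1) in which t_nu = s^(a_nu) * (monomial in
   the u_m), where a is the primitive vector proportional to d(I), hence positive, and in which the equations read
   u_m^(h_m) = e_m * (unit in the 1 - t_nu), with h_1 ... h_(n-1) = gcd d(I). By Hensel's lemma each of the
   h_1 ... h_(n-1) solutions eta of eta_m^(h_m) = e_m extends to a unique power series solution u(s).

   These solutions are in bijection with the ideal points. A solution u(s) is a point z(s) of the variety over the field
   of Laurent series. The polynomials vanishing at z(s) define a curve: logarithmic differentiation of the system shows
   that all derivations of F(z(s)) are proportional, so that the transcendence degree is 1, and the Nullstellensatz over
   an uncountable field identifies the ideal of the curve. The inverse of the birational map sends z(s) to a branch of
   the smooth model, whose centre is the ideal point. Conversely the smooth model has at each of its points a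
   parametrization by power series; at an ideal point corresponding to I the monomials u_m of its coordinates are
   units, their constant terms form a solution eta, and by uniqueness the parametrization is z(sigma) for some power
   series sigma without constant term. The point determines eta because u_m is a rational function on the curve. *)
Require Import Defs.
From HB Require Import structures.
From mathcomp Require Import all_boot all_order all_fingroup all_algebra.
From mathcomp Require Import complex.
From mathcomp Require Import -(notations) mpoly.
From mathcomp Require Import all_classical all_reals all_analysis.
From mathcomp Require Import separable ring zify.
Set Implicit Arguments.
Unset Strict Implicit.
Unset Printing Implicit Defensive.
Import Order.TTheory GRing.Theory Num.Theory.
Import numFieldNormedType.Exports.
Local Open Scope ring_scope.
Local Open Scope classical_set_scope.

(** * Formal power series *)

(** An ideal point is a pair of a curve and a point of its smooth model, so the bijection must
    recover the curve too: it is the zero set, in the shape space, of the polynomials vanishing at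
    [z(s)]. Neither function fields nor local rings are built. A curve enters through generic
    points, tuples of series at which exactly the polynomials (or forms) vanishing on the curve
    vanish. An identity of rational functions then becomes the vanishing of one polynomial, checked
    on a dense open part of the curve and read along a series; elements of a local ring carry
    explicit denominators that are nonzero at the point. Since regular maps are given by forms only
    near each point, representations must be compared again and again. Positivity of [d(I)] makes
    every [t_nu] divisible by [s]. This makes the system contracting, so that lifting needs no
    Jacobian condition, and conversely forces [s] to have positive order along a branch at an ideal
    point. Characteristic 0 makes the [h_m] invertible, which serves to count roots, to lift them
    and to invert the logarithmic Jacobian; it also allows derivations to be extended to algebraic
    elements. *)

Fact fpsM_key : unit. Proof. exact: tt. Qed.

Section PowerSeries.
Variable F : fieldType.

Record fps := Fps { fcoef :> nat -> F }.

Lemma fpsP (f g : fps) : (forall n, f n = g n) -> f = g.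
Proof. by case: f => f; case: g => g /= h; congr Fps; apply: funext. Qed.

HB.instance Definition _ := gen_eqMixin fps.
HB.instance Definition _ := gen_choiceMixin fps.

Definition fps0 := Fps (fun=> 0).
Definition fpsN (f : fps) := Fps (fun n => - f n).
Definition fpsD (f g : fps) := Fps (fun n => f n + g n).
(* Sealed, so that unification never expands a product coefficientwise. *)
Definition fpsM : fps -> fps -> fps := locked_with fpsM_key
  (fun f g : fps => Fps (fun n => \sum_(i < n.+1) f i * g (n - i)%N)).
Lemma coef_fpsM f g n : fpsM f g n = \sum_(i < n.+1) f i * g (n - i)%N.
Proof. by rewrite /fpsM unlock. Qed.
Definition fpsC (c : F) := Fps (fun n => if n is 0%N then c else 0).

Fact fpsDA : associative fpsD.
Proof. by move=> f g h; apply: fpsP => n /=; rewrite addrA. Qed.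
Fact fpsDC : commutative fpsD.
Proof. by move=> f g; apply: fpsP => n /=; rewrite addrC. Qed.
Fact fps0D : left_id fps0 fpsD.
Proof. by move=> f; apply: fpsP => n /=; rewrite add0r. Qed.
Fact fpsND : left_inverse fps0 fpsN fpsD.
Proof. by move=> f; apply: fpsP => n /=; rewrite addNr. Qed.
HB.instance Definition _ := GRing.isZmodule.Build fps fpsDA fpsDC fps0D fpsND.

Definition ftrunc N (f : fps) : {poly F} := \poly_(i < N) f i.

Lemma coef_ftrunc N f i : (i < N)%N -> (ftrunc N f)`_i = f i.
Proof. by move=> h; rewrite coef_poly h. Qed.

(** Low coefficients of a product only see truncations, so the ring axioms are inherited from
    [{poly F}]. *)
Lemma fpsM_trunc N f g n : (n < N)%N ->
  fpsM f g n = (ftrunc N f * ftrunc N g)`_n.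
Proof.
move=> h; rewrite coefM coef_fpsM; apply: eq_bigr => i _.
rewrite !coef_ftrunc //; first by apply: leq_ltn_trans h; apply: leq_subr.
by apply: leq_trans h; case: i.
Qed.

Fact fpsMC : commutative fpsM.
Proof.
by move=> f g; apply: fpsP => n; rewrite !(@fpsM_trunc n.+1) // mulrC.
Qed.

Lemma coefM_congr (R : nzRingType) (p q p' q' : {poly R}) n :
  (forall i, (i <= n)%N -> p`_i = p'`_i) -> (forall i, (i <= n)%N -> q`_i = q'`_i) ->
  (p * q)`_n = (p' * q')`_n.
Proof.
move=> hp hq; rewrite !coefM; apply: eq_bigr => i _.
by rewrite hp ?hq ?leq_subr // -ltnS.
Qed.

Fact fpsMA : associative fpsM.
Proof.
move=> f g h; apply: fpsP => n; rewrite !(@fpsM_trunc n.+1) //.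
transitivity ((ftrunc n.+1 f * (ftrunc n.+1 g * ftrunc n.+1 h))`_n).
  by apply: coefM_congr => // i hi; rewrite coef_ftrunc // (@fpsM_trunc n.+1).
rewrite mulrA; apply: coefM_congr => // i hi.
by rewrite coef_ftrunc // (@fpsM_trunc n.+1).
Qed.
Fact fps1M : left_id (fpsC 1) fpsM.
Proof.
move=> f; apply: fpsP => n; rewrite coef_fpsM big_ord_recl /= mul1r subn0.
by rewrite big1 ?addr0 // => i _; rewrite mul0r.
Qed.
Fact fpsMDl : left_distributive fpsM +%R.
Proof.
move=> f g h; apply: fpsP => n /=; rewrite !coef_fpsM -big_split /=.
by apply: eq_bigr => i _; rewrite mulrDl.
Qed.
Fact fps1_neq0 : fpsC 1 != 0.
Proof. by apply/eqP => /(congr1 (fun f : fps => f 0%N)) /= /eqP; rewrite oner_eq0. Qed.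
HB.instance Definition _ :=
  GRing.Zmodule_isComNzRing.Build fps fpsMA fpsMC fps1M fpsMDl fps1_neq0.

Lemma fcoefB (f g : fps) n : (f - g) n = f n - g n. Proof. by []. Qed.
Lemma fcoefM (f g : fps) n : (f * g) n = \sum_(i < n.+1) f i * g (n - i)%N.
Proof. exact: coef_fpsM. Qed.
Fact fpsC_zmod : zmod_morphism fpsC.
Proof. by move=> a b; apply: fpsP => -[|n] //=; rewrite ?subr0 // fcoefB subrr. Qed.
HB.instance Definition _ := GRing.isZmodMorphism.Build F fps fpsC fpsC_zmod.
Lemma fcoefCM c (f : fps) n : (fpsC c * f) n = c * f n.
Proof.
rewrite fcoefM big_ord_recl /= subn0 big1 ?addr0 // => i _; exact: mul0r.
Qed.
Fact fpsC_monoid : monoid_morphism fpsC.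
Proof.
split=> // a b; apply: fpsP => n; rewrite fcoefCM; case: n => //= n.
by rewrite mulr0.
Qed.
HB.instance Definition _ := GRing.isMonoidMorphism.Build F fps fpsC fpsC_monoid.

Definition fconst (f : fps) : F := f 0%N.
Fact fconst_zmod : zmod_morphism fconst. Proof. by []. Qed.
HB.instance Definition _ := GRing.isZmodMorphism.Build fps F fconst fconst_zmod.
Fact fconst_monoid : monoid_morphism fconst.
Proof. by split=> // f g; rewrite /fconst fcoefM big_ord1. Qed.
HB.instance Definition _ := GRing.isMonoidMorphism.Build fps F fconst fconst_monoid.

Lemma fconstC c : fconst (fpsC c) = c. Proof. by []. Qed.
Lemma fconst1 : fconst 1 = 1. Proof. by []. Qed.
Lemma fconstD f g : fconst (f + g) = fconst f + fconst g. Proof. exact: rmorphD. Qed.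
Lemma fconstB f g : fconst (f - g) = fconst f - fconst g. Proof. exact: rmorphB. Qed.
Lemma fconstM f g : fconst (f * g) = fconst f * fconst g. Proof. exact: rmorphM. Qed.
Lemma fconstXn f k : fconst (f ^+ k) = fconst f ^+ k. Proof. exact: rmorphXn. Qed.
Lemma fconst_sum (I : Type) (r : seq I) (P : pred I) (G : I -> fps) :
  fconst (\sum_(i <- r | P i) G i) = \sum_(i <- r | P i) fconst (G i).
Proof. exact: rmorph_sum. Qed.
Lemma fconst_prod (I : Type) (r : seq I) (P : pred I) (G : I -> fps) :
  fconst (\prod_(i <- r | P i) G i) = \prod_(i <- r | P i) fconst (G i).
Proof. exact: rmorph_prod. Qed.

Section Inverse.
Variable f : fps.
(** Each coefficient of the inverse needs all the earlier ones, so the recursion carries their list.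
    The term [(m == 0%N)%:R] is the coefficient of the series 1 to be reached. *)
Fixpoint finv_seq n : seq F := if n is m.+1 then
  rcons (finv_seq m)
   ((((m == 0%N)%:R - \sum_(i < m) f (m - i)%N * (finv_seq m)`_i) / f 0%N)) else [::].
Lemma size_finv_seq n : size (finv_seq n) = n.
Proof. by elim: n => //= n IH; rewrite size_rcons IH. Qed.
Definition finv := Fps (fun n => (finv_seq n.+1)`_n).
Lemma nth_finv_seq n i : (i < n)%N -> (finv_seq n)`_i = finv i.
Proof.
elim: n => // n IH; rewrite ltnS leq_eqVlt => /orP[/eqP-> //|h].
by rewrite /= nth_rcons size_finv_seq h IH.
Qed.
Lemma mul_finv : f 0%N != 0 -> finv * f = 1.
Proof.
move=> f0; apply: fpsP => n; rewrite fcoefM big_ord_recr subnn.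
rewrite {2}/finv /= nth_rcons size_finv_seq ltnn eqxx mulfVK //.
have -> : \sum_(i < n) finv i * f (n - i)%N = \sum_(i < n) f (n - i)%N * (finv_seq n)`_i.
  by apply: eq_bigr => i _; rewrite mulrC nth_finv_seq.
by rewrite addrC subrK; case: n.
Qed.
End Inverse.

Definition fps_unit : pred fps := fun f => f 0%N != 0.
Definition fps_inv f := if f \in fps_unit then finv f else f.
Fact fps_mulV : {in fps_unit, left_inverse 1 fps_inv *%R}.
Proof. by move=> f h; rewrite /fps_inv h mul_finv. Qed.
Fact fps_unitP (f g : fps) : g * f = 1 -> f \in fps_unit.
Proof.
move=> h; rewrite unfold_in; apply/eqP => f0.
have := congr1 (fun f : fps => f 0%N) h; rewrite fcoefM big_ord1 f0 mulr0.
by move/eqP; rewrite eq_sym oner_eq0.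
Qed.
Fact fps_inv_out : {in [predC fps_unit], fps_inv =1 id}.
Proof. by move=> f; rewrite inE /= /fps_inv => /negbTE ->. Qed.
HB.instance Definition _ :=
  GRing.ComNzRing_hasMulInverse.Build fps fps_mulV fps_unitP fps_inv_out.

Lemma unitfpsE (f : fps) : (f \is a GRing.unit) = (fconst f != 0).
Proof. by []. Qed.

Definition fX : fps := Fps (fun n => (n == 1%N)%:R).

Lemma fcoefXM (f : fps) n : (fX * f) n = if n is m.+1 then f m else 0.
Proof.
rewrite fcoefM; case: n => [|n]; first by rewrite big_ord1 mul0r.
rewrite big_ord_recl mul0r add0r big_ord_recl /= mul1r subSS subn0.
by rewrite big1 ?addr0 // => i _; rewrite mul0r.
Qed.

Lemma fcoefXnM N (f : fps) n :
  (fX ^+ N * f) n = if (n < N)%N then 0 else f (n - N)%N.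
Proof.
elim: N n => [|N IH] n; first by rewrite mul1r subn0.
by rewrite exprS -mulrA fcoefXM; case: n => // n; rewrite IH ltnS subSS.
Qed.

Definition fshift N (f : fps) := Fps (fun n => f (n + N)%N).

Lemma fshiftK N (f : fps) : (forall i, (i < N)%N -> f i = 0) -> f = fX ^+ N * fshift N f.
Proof.
move=> h; apply: fpsP => n; rewrite fcoefXnM; case: ltnP => [/h //|hn].
by rewrite /= subnK.
Qed.

Lemma fps_order (f : fps) : f != 0 ->
  exists N g, g \is a GRing.unit /\ f = fX ^+ N * g.
Proof.
move=> f0; have /cid[n hn] : exists n, f n != 0.
  apply: contrapT => h; case/eqP: f0; apply: fpsP => n.
  by apply: contrapT => /eqP hn; apply: h; exists n.
have ex : exists n, f n != 0 by exists n.
case: (ex_minnP ex) => N hN minN; exists N, (fshift N f); split.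
  by rewrite unitfpsE /fconst /= add0n.
by apply: fshiftK => i hi; apply: contraTeq hi => /minN; rewrite -leqNgt.
Qed.

Lemma fX_neq0 : fX != 0.
Proof. by apply/eqP => /(congr1 (fun f : fps => f 1%N)) /= /eqP; rewrite oner_eq0. Qed.

Lemma fXn_neq0 N : fX ^+ N != 0.
Proof.
apply/eqP => /(congr1 (fun f : fps => f N)); rewrite -[fX ^+ N]mulr1 fcoefXnM ltnn subnn.
by move/eqP; rewrite oner_eq0.
Qed.

Fact fps_integral (f g : fps) : f * g = 0 -> (f == 0) || (g == 0).
Proof.
apply: contra_eqT; rewrite negb_or => /andP[/fps_order[N [u [uu ->]]] /fps_order[M [v [uv ->]]]].
rewrite mulrACA -exprD; apply/eqP => /(congr1 (fun f : fps => f (N + M)%N)).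
rewrite fcoefXnM ltnn subnn => /eqP; apply/negP.
by have := unitrM u v; rewrite uu uv unitfpsE.
Qed.
HB.instance Definition _ := GRing.ComUnitRing_isIntegral.Build fps fps_integral.

Definition fdvdX N (f : fps) := exists g, f = fX ^+ N * g.

Lemma fdvdX_coef N (f : fps) i : fdvdX N f -> (i < N)%N -> f i = 0.
Proof. by case=> g -> hi; rewrite fcoefXnM hi. Qed.
Lemma fdvdXI N (f : fps) : (forall i, (i < N)%N -> f i = 0) -> fdvdX N f.
Proof. by move=> h; exists (fshift N f); apply: fshiftK. Qed.

Lemma fdvdX0 N : fdvdX N 0. Proof. by exists 0; rewrite mulr0. Qed.
Lemma fdvdXD N f g : fdvdX N f -> fdvdX N g -> fdvdX N (f + g).
Proof. by move=> [f' ->] [g' ->]; exists (f' + g'); rewrite mulrDr. Qed.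
Lemma fdvdXN N f : fdvdX N f -> fdvdX N (- f).
Proof. by move=> [f' ->]; exists (- f'); rewrite mulrN. Qed.
Lemma fdvdXMl N f g : fdvdX N f -> fdvdX N (g * f).
Proof. by case=> h ->; exists (g * h); rewrite mulrCA. Qed.
Lemma fdvdXMr N f g : fdvdX N f -> fdvdX N (f * g).
Proof. by rewrite mulrC; apply: fdvdXMl. Qed.
Lemma fdvdXM N M f g : fdvdX N f -> fdvdX M g -> fdvdX (N + M) (f * g).
Proof. by case=> f' ->; case=> g' ->; exists (f' * g'); rewrite exprD mulrACA. Qed.
Lemma fdvdX1 f : fdvdX 1 f <-> fconst f = 0.
Proof. by split=> [h|h]; [apply: (fdvdX_coef h)|apply: fdvdXI => -[|i]]. Qed.
Lemma fdvdX_leq N M f : (N <= M)%N -> fdvdX M f -> fdvdX N f.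
Proof. by move=> h [g ->]; exists (fX ^+ (M - N) * g); rewrite mulrA -exprD subnKC. Qed.
Lemma fdvdX_unit N (f g : fps) : f \is a GRing.unit -> fdvdX N (f * g) -> fdvdX N g.
Proof. by move=> uf h; rewrite -(mulKr uf g); apply: fdvdXMl. Qed.
Lemma fdvdX_eq0 f : (forall N, fdvdX N f) -> f = 0.
Proof. by move=> h; apply: fpsP => n; apply: (fdvdX_coef (h n.+1)). Qed.

(** * Substitution of a series without constant term *)

Section Composition.
Variable s : fps.
Hypothesis s0 : fconst s = 0.

Lemma fdvdX_expr i : fdvdX i (s ^+ i).
Proof.
elim: i => [|i IH]; first by apply: fdvdXI.
by rewrite exprS -add1n; apply: fdvdXM => //; apply/fdvdX1.
Qed.

Definition fpeval (p : {poly F}) : fps := (map_poly fpsC p).[s].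
HB.instance Definition _ := GRing.RMorphism.copy fpeval
  (horner_eval s \o map_poly fpsC).

Lemma fpeval_dvd N (p : {poly F}) :
  (forall i, (i < N)%N -> p`_i = 0) -> fdvdX N (fpeval p).
Proof.
move=> h; rewrite /fpeval horner_coef size_map_poly.
elim/big_ind: _; [exact: fdvdX0|exact: fdvdXD|].
move=> i _; rewrite coef_map; case: (ltnP i N) => hi.
  by rewrite h // raddf0 mul0r; apply: fdvdX0.
by apply: fdvdXMl; apply: fdvdX_leq hi _; apply: fdvdX_expr.
Qed.

(** Since [s ^+ i] is divisible by [X^i], only the terms of [f] up to degree [n] reach the
    coefficient [n] of the infinite sum. *)
Definition fcomp (f : fps) := Fps (fun n => fpeval (ftrunc n.+1 f) n).

Lemma fcomp_trunc N (f : fps) n (p : {poly F}) : (n < N)%N -> (forall i, (i < N)%N -> p`_i = f i) ->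
  fcomp f n = fpeval p n.
Proof.
move=> h hp /=; apply/eqP; rewrite -subr_eq0 -fcoefB -rmorphB /=.
apply/eqP/(@fdvdX_coef n.+1) => //; apply: fpeval_dvd => i hi.
by rewrite coefB coef_ftrunc // hp ?subrr //; apply: leq_trans hi h.
Qed.

Fact fcomp_zmod : zmod_morphism fcomp.
Proof.
move=> f g; apply: fpsP => n.
rewrite (@fcomp_trunc n.+1 _ _ (ftrunc n.+1 f - ftrunc n.+1 g)) //.
  by rewrite rmorphB.
by move=> i hi; rewrite coefB !coef_ftrunc.
Qed.
HB.instance Definition _ := GRing.isZmodMorphism.Build fps fps fcomp fcomp_zmod.

Fact fcomp_monoid : monoid_morphism fcomp.
Proof.
split=> [|f g]; apply: fpsP => n.
  rewrite (@fcomp_trunc n.+1 _ _ 1) ?rmorph1 // => i hi; rewrite coef1.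
  by case: i hi.
rewrite (@fcomp_trunc n.+1 _ _ (ftrunc n.+1 f * ftrunc n.+1 g)) //; last first.
  by move=> i hi; rewrite -fpsM_trunc.
rewrite rmorphM !fcoefM; apply: eq_bigr => i _; congr (_ * _).
  by symmetry; apply: (@fcomp_trunc n.+1) => // j hj; rewrite coef_ftrunc.
symmetry; apply: (@fcomp_trunc n.+1) => [|j hj]; last by rewrite coef_ftrunc.
by rewrite ltnS leq_subr.
Qed.
HB.instance Definition _ := GRing.isMonoidMorphism.Build fps fps fcomp fcomp_monoid.

Lemma fcompC c : fcomp (fpsC c) = fpsC c.
Proof.
apply: fpsP => n; rewrite (@fcomp_trunc n.+1 _ _ c%:P) //.
  by rewrite /fpeval map_polyC hornerC.
by move=> [|i] _; rewrite coefC.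
Qed.

Lemma fcompX : fcomp fX = s.
Proof.
apply: fpsP => n; rewrite (@fcomp_trunc n.+1 _ _ 'X) //.
  by rewrite /fpeval map_polyX hornerX.
by move=> i _; rewrite coefX.
Qed.

Lemma fconst_comp f : fconst (fcomp f) = fconst f.
Proof.
rewrite {1}/fconst (@fcomp_trunc 1 _ _ (f 0%N)%:P) //.
  by rewrite /fpeval map_polyC hornerC.
by case=> // _; rewrite coefC.
Qed.

(** If [f] has order [N], its image is [s ^+ N] times a series with nonzero constant term. *)
Lemma fcomp_inj : s != 0 -> injective fcomp.
Proof.
move=> sn0; apply: raddf_inj => f; apply: contra_eq => /fps_order[N [g [ug ->]]].
rewrite -[X in X != 0]/(fcomp (fX ^+ N * g)) rmorphM rmorphXn /= fcompX mulf_neq0 ?expf_neq0 //.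
by apply: contra_eqN (fconst_comp g) => /eqP ->; rewrite eq_sym.
Qed.

End Composition.
End PowerSeries.

Arguments fcoef {F} _ _ : simpl never.
Arguments fpsM {F} _ _.
Arguments fpsD {F} _ _ : simpl never.
Arguments fpsN {F} _ : simpl never.
Arguments fpsC {F} _ : simpl never.
Arguments fconst {F} _ : simpl never.
Arguments fX {F}.

Notation "x %:F" := (@FracField.tofrac _ x) : ring_scope.

(** * Functoriality of the field of fractions *)

Section FractionField.
Import generic_quotient.
Variables (R S : idomainType).

Lemma fraction_ex (x : {fraction R}) : exists n d : R, d != 0 /\ x = n%:F / d%:F.
Proof.
elim/quotW: x => r; have d0 : (frac r).2 != 0 by apply: denom_ratioP.
exists (frac r).1, (frac r).2; split => //.
apply: (mulIf (x := ((frac r).2)%:F)); first by rewrite tofrac_eq0.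
rewrite mulfVK ?tofrac_eq0 //.
rewrite -[LHS]/(FracField.mul _ _); unlock FracField.tofrac.
rewrite -FracField.pi_mul.
apply/eqmodP => /=; rewrite /FracField.equivf /FracField.mulf.
by rewrite !numden_Ratio ?mulr1 ?mulf_neq0 ?oner_neq0 //= mulrC.
Qed.

Variable f : {rmorphism R -> S}.
Hypothesis f_inj : injective f.

(** The representing fraction is picked by [cid]; that the value does not depend on it is
    [fraction_mapE], which needs [f] injective to keep denominators nonzero. *)
Definition fraction_map (x : {fraction R}) : {fraction S} :=
  let h := cid (fraction_ex x) in let h' := cid (projT2 h) in
  (f (projT1 h))%:F / (f (projT1 h'))%:F.

Lemma fraction_mapE n d : d != 0 -> fraction_map (n%:F / d%:F) = (f n)%:F / (f d)%:F.
Proof.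
move=> d0; rewrite /fraction_map.
case: cid => /= n' h; case: cid => d' /= [d'0 /eqP].
have fn (x : R) : x != 0 -> (f x)%:F != 0.
  by move=> x0; rewrite tofrac_eq0 -(rmorph0 f) (inj_eq f_inj).
rewrite eqr_div ?tofrac_eq0 // -!rmorphM tofrac_eq => /eqP e.
by apply/eqP; rewrite eqr_div ?fn // -!rmorphM e.
Qed.

Lemma fraction_map_tofrac n : fraction_map n%:F = (f n)%:F.
Proof.
have := @fraction_mapE n 1 (oner_neq0 _).
by rewrite !rmorph1 !divr1.
Qed.

Fact fraction_map_zmod : zmod_morphism fraction_map.
Proof.
move=> x y; have [n [d [d0 ->]]] := fraction_ex x.
have [m [e [e0 ->]]] := fraction_ex y.
have fn (z : R) : z != 0 -> (f z)%:F != 0.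
  by move=> x0; rewrite tofrac_eq0 -(rmorph0 f) (inj_eq f_inj).
rewrite -mulNr addf_div ?tofrac_eq0 // mulNr -!rmorphM -rmorphB.
rewrite !fraction_mapE ?mulf_neq0 // -[X in _ = _ + X]mulNr addf_div ?fn //.
by rewrite !(rmorphB, rmorphM) mulNr.
Qed.

Fact fraction_map_monoid : monoid_morphism fraction_map.
Proof.
split=> [|x y]; first by rewrite -tofrac1 fraction_map_tofrac !rmorph1.
have [n [d [d0 ->]]] := fraction_ex x; have [m [e [e0 ->]]] := fraction_ex y.
rewrite mulf_div -!rmorphM !fraction_mapE ?mulf_neq0 // mulf_div.
by rewrite !rmorphM.
Qed.

End FractionField.

(** * Noetherian polynomial rings and the Nullstellensatz *)

Section Ideals.
Variable R : comNzRingType.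

Definition is_ideal (J : R -> Prop) :=
  [/\ J 0, forall a b, J a -> J b -> J (a + b) & forall r a, J a -> J (r * a)].

Definition ideal_gen (A : R -> Prop) : R -> Prop :=
  fun p => forall J, is_ideal J -> (forall x, A x -> J x) -> J p.

Lemma ideal_gen_ideal A : is_ideal (ideal_gen A).
Proof.
split=> [J [] //|a b ha hb J iJ hJ|r a ha J iJ hJ].
  by have [_ h _] := iJ; apply: h; [apply: ha|apply: hb].
by have [_ _ h] := iJ; apply: h; apply: ha.
Qed.

Lemma ideal_genS (A : R -> Prop) x : A x -> ideal_gen A x.
Proof. by move=> h J _; apply. Qed.

(** This form of the ascending chain condition is contradicted directly by a sequence each of whose
    terms is chosen outside an ideal containing the earlier ones. *)
Definition noetherian :=
  forall g : nat -> R, exists K, ideal_gen (fun x => exists2 i, (i < K)%N & x = g i) (g K).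

Definition prime_ideal (J : R -> Prop) :=
  [/\ is_ideal J, ~ J 1 & forall a b, J (a * b) -> J a \/ J b].

Lemma idealN J a : is_ideal J -> J a -> J (- a).
Proof. by case=> _ _ h /(h (-1)); rewrite mulN1r. Qed.
Lemma idealB J a b : is_ideal J -> J a -> J b -> J (a - b).
Proof. by move=> iJ ha hb; case: (iJ) => _ h _; apply: h => //; apply: idealN. Qed.
Lemma idealMr J a r : is_ideal J -> J a -> J (a * r).
Proof. by case=> _ _ h; rewrite mulrC; apply: h. Qed.
Lemma ideal_sum (I : Type) (r : seq I) (P : pred I) (G : I -> R) J : is_ideal J ->
  (forall i, P i -> J (G i)) -> J (\sum_(i <- r | P i) G i).
Proof. by case=> h0 hD _ h; apply: big_ind. Qed.

(** The sum of [J] and the principal ideal of [x]. *)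
Definition ideal_adj (J : R -> Prop) x : R -> Prop :=
  fun p => exists b, J (p - b * x).

Lemma ideal_adj_ideal J x : is_ideal J -> is_ideal (ideal_adj J x).
Proof.
move=> iJ; have [h0 hD hM] := iJ; split.
- by exists 0; rewrite mul0r subr0.
- by move=> a b [c hc] [d hd]; exists (c + d); rewrite mulrDl opprD addrACA; apply: hD.
by move=> r a [c hc]; exists (r * c); rewrite -mulrA -mulrBr; apply: hM.
Qed.
Lemma ideal_adjS J x p : is_ideal J -> J p -> ideal_adj J x p.
Proof. by move=> _ h; exists 0; rewrite mul0r subr0. Qed.
Lemma ideal_adj_mem J x : is_ideal J -> ideal_adj J x x.
Proof. by case=> h _ _; exists 1; rewrite mul1r subrr. Qed.

End Ideals.

(** * Hilbert's basis theorem *)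

Section Noetherian.

Lemma field_noetherian (F : fieldType) : noetherian F.
Proof.
move=> g; have [g0|g0] := eqVneq (g 0%N) 0.
  by exists 0%N; rewrite g0; case: (ideal_gen_ideal (fun x => exists2 i, (i < 0)%N & x = g i)).
exists 1%N => J [_ _ h] hJ; rewrite -[g 1%N](divfK g0); apply: h; apply: hJ.
by exists 0%N.
Qed.

Lemma surj_noetherian (R S : comNzRingType) (f : {rmorphism R -> S}) :
  (forall y, exists x, f x = y) -> noetherian R -> noetherian S.
Proof.
move=> sf nR g; have [g' hg'] := choice (fun i => sf (g i)).
have [K hK] := nR g'; exists K => J [h0 hD hM] hJ.
rewrite -hg'; apply: (hK (fun x => J (f x))).
  by split=> [|a b|r a]; rewrite ?rmorph0 ?rmorphD ?rmorphM //; [apply: hD|apply: hM].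
by move=> _ [i hi ->]; apply: hJ; exists i.
Qed.

(** In a chain that never stops, polynomials of least degree outside the ideal of the earlier
    choices are selected; noetherianity of [R] applied to their leading coefficients then produces
    one of smaller degree. *)
Lemma poly_noetherian (R : comNzRingType) : noetherian R -> noetherian {poly R}.
Proof.
move=> nR g; apply: contrapT => hn.
pose G K := ideal_gen (fun x => exists2 i, (i < K)%N & x = g i).
have hG K : ~ G K (g K) by move=> h; apply: hn; exists K.
have GS K L p : (K <= L)%N -> G K p -> G L p.
  move=> h hp J iJ hJ; apply: hp => // x [i hi ->]; apply: hJ; exists i => //.
  exact: leq_trans hi h.
pose J p := exists K, G K p.
have iJ : is_ideal J.
  split=> [|a b [K ha] [L hb]|r a [K ha]].
  - by exists 0%N; case: (ideal_gen_ideal (fun x => exists2 i, (i < 0)%N & x = g i)).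
  - exists (maxn K L); case: (ideal_gen_ideal (fun x => exists2 i, (i < maxn K L)%N & x = g i)) => _ h _.
    by apply: h; [apply: GS ha|apply: GS hb]; rewrite ?leq_maxl ?leq_maxr.
  - exists K; case: (ideal_gen_ideal (fun x => exists2 i, (i < K)%N & x = g i)) => _ _ h.
    exact: h.
(* Finitely many elements of [J] lie in a single [G K], which misses [g K]; so some element of [J]
   is outside the ideal of [s], and one of least size is taken. *)
have next (s : seq {poly R}) : exists p, (forall x, x \in s -> J x) ->
    [/\ J p, ~ ideal_gen (fun x => x \in s) p &
      forall q, J q -> ~ ideal_gen (fun x => x \in s) q -> (size p <= size q)%N].
  have [hs|hs] := pselect (forall x, x \in s -> J x); last by exists 0 => /hs.
  have [K hK] : exists K, forall x, x \in s -> G K x.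
    elim: s hs => [|x s IH] hs; first by exists 0%N.
    have [|K hK] := IH; first by move=> y hy; apply: hs; rewrite inE hy orbT.
    have [L hL] := hs x (mem_head _ _).
    exists (maxn K L) => y; rewrite inE => /orP[/eqP->|/hK].
      by apply: GS hL; rewrite leq_maxr.
    by apply: GS; rewrite leq_maxl.
  have hex : exists m, `[< exists2 q : {poly R}, size q = m & J q /\ ~ ideal_gen (fun x => x \in s) q >].
    exists (size (g K)); apply/asboolP; exists (g K) => //; split.
      by exists K.+1; apply: ideal_genS; exists K.
    by move=> /(_ (G K) (ideal_gen_ideal _) hK); apply: hG.
  case: (ex_minnP hex) => m /asboolP[p <- [Jp np]] hm.
  exists p => _; split=> // q Jq nq; apply: hm; apply/asboolP; by exists q.
have [nx hnx] := choice next.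
pose fix S k := if k is l.+1 then rcons (S l) (nx (S l)) else [::].
have SJ k x : x \in S k -> J x.
  elim: k x => //= k IH x; rewrite mem_rcons inE => /orP[/eqP->|/IH//].
  by have [] := hnx _ IH.
have SS k l x : (k <= l)%N -> x \in S k -> x \in S l.
  elim: l => [|l IH]; first by rewrite leqn0 => /eqP->.
  rewrite leq_eqVlt => /orP[/eqP->//|/IH h /h].
  by rewrite /= mem_rcons inE orbC => ->.
pose h k := nx (S k).
have hS i k : (i < k)%N -> h i \in S k.
  by move=> ik; apply: (SS i.+1) => //=; rewrite mem_rcons mem_head.
have hgen k : ~ ideal_gen (fun x => x \in S k) (h k) by have [] := hnx _ (SJ k).
have hJ k : J (h k) by have [] := hnx _ (SJ k).
have h0 k : h k != 0.
  apply/eqP => e; apply: (hgen k); rewrite e.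
  by case: (ideal_gen_ideal (fun x => x \in S k)).
have hsize i k : (i <= k)%N -> (size (h i) <= size (h k))%N.
  move=> ik; have [_ _] := hnx _ (SJ i); apply=> //.
  move=> hh; apply: (hgen k) => I iI hI; apply: hh => // x /(SS _ _ _ ik); exact: hI.
have [K hK] := nR (fun k => lead_coef (h k)).
pose D := (size (h K)).-1.
have sD : size (h K) = D.+1 by rewrite /D prednK // size_poly_gt0.
(* The coefficients in degree [D] of the elements of degree at most [D] form an ideal of [R]; it
   contains the leading coefficients of the earlier [h i], shifted to degree [D] by a power of
   ['X]. *)
have [||p [hp sp pD]] := hK (fun a => exists p, [/\ ideal_gen (fun x => x \in S K) p,
   (size p <= D.+1)%N & p`_D = a]).
- have [i0 iD iM] := ideal_gen_ideal (fun x => x \in S K).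
  split=> [|a b [p [hp sp <-]] [q [hq sq <-]]|r a [p [hp sp <-]]].
  + by exists 0; rewrite size_poly0 coef0.
  + exists (p + q); rewrite coefD; split=> //; first exact: iD.
    by apply: leq_trans (size_polyD _ _) _; rewrite geq_max sp.
  + exists (r *: p); rewrite coefZ; split=> //; first by rewrite -mul_polyC; apply: iM.
    exact: leq_trans (size_scale_leq _ _) sp.
- move=> _ [i iK ->]; exists ('X^(D.+1 - size (h i)) * h i).
  have si : (size (h i) <= D.+1)%N by rewrite -sD hsize // ltnW.
  have s1 : (0 < size (h i))%N by rewrite size_poly_gt0.
  split.
  + by have [_ _] := ideal_gen_ideal (fun x => x \in S K); apply; apply: ideal_genS; apply: hS.
  + apply: leq_trans (size_polyMleq _ _) _; rewrite size_polyXn addSn /= subnK //.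
  + rewrite coefXnM lead_coefE ltnNge; have -> : (D.+1 - size (h i) <= D)%N by lia.
    by congr (_`__); lia.
have [_ _ hmin] := hnx _ (SJ K).
(* [h K - p] is still outside the ideal of [S K] but has lost its term of degree [D], against the
   minimality of [h K]. *)
have hq : ~ ideal_gen (fun x => x \in S K) (h K - p).
  move=> hh; apply: (hgen K); rewrite -(subrK p (h K)).
  by have [_ iD _] := ideal_gen_ideal (fun x => x \in S K); apply: iD.
have Jq : J (h K - p).
  apply: idealB => //; apply: hp => //; exact: SJ.
have := hmin _ Jq hq; rewrite leqNgt => /negP; apply.
rewrite -/(h K) sD ltnS; apply/leq_sizeP => j; rewrite leq_eqVlt => /orP[/eqP<-|jD].
  by rewrite coefB pD lead_coefE -/D subrr.
by rewrite coefB !nth_default ?subrr // ?sD //; apply: leq_trans sp _.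
Qed.

Lemma mpoly_ring_ind (F : comNzRingType) n (P : mpoly n F -> Prop) :
  (forall c, P (mpolyC n c)) -> (forall i, P (mpolyX F (mnm1 i))) ->
  (forall p q, P p -> P q -> P (p + q)) -> (forall p q, P p -> P q -> P (p * q)) ->
  forall p, P p.
Proof.
move=> hC hX hD hM p; rewrite (mpolyE p).
apply: big_ind => [||m _]; [by rewrite -mpolyC0|exact: hD|].
rewrite -mul_mpolyC; apply: (hM _ _ (hC _)); rewrite mpolyXE_id.
apply: big_ind => [||i _]; [by rewrite -mpolyC1|exact: hM|].
elim: (m i) => [|k IH]; first by rewrite expr0 -mpolyC1.
by rewrite exprS; apply: hM.
Qed.

(** Induction on the number of variables: [{poly mpoly n F}] maps onto [mpoly n.+1 F], with ['X]
    going to the last variable. *)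
Lemma mpoly_noetherian (F : fieldType) n : noetherian (mpoly n F).
Proof.
elim: n => [|n IH].
  apply: (@surj_noetherian F (mpoly 0 F) (@mpolyC 0 F) _ (@field_noetherian F)).
  by move=> y; exists (mcoeff (@mnm0 0) y); rewrite [RHS]nvar0_mpolyC.
pose f : {rmorphism {poly mpoly n F} -> mpoly n.+1 F} :=
  horner_eval (mpolyX F (mnm1 ord_max)) \o map_poly (@mwiden n F).
apply: (@surj_noetherian _ _ f _ (poly_noetherian IH)).
have fC p : f p%:P = mwiden p by rewrite /= /horner_eval map_polyC hornerC.
apply: mpoly_ring_ind => [c|i|p q [x <-] [y <-]|p q [x <-] [y <-]].
- by exists ((mpolyC n c)%:P); rewrite fC mwidenC.
- case: (unliftP ord_max i) => [j ->|->].
    exists ((mpolyX F (mnm1 j))%:P); rewrite fC mwidenX mnmwiden1.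
    by congr (mpolyX _ (mnm1 _)); apply: val_inj => /=; rewrite /bump leqNgt ltn_ord.
  by exists 'X; rewrite /= /horner_eval map_polyX hornerX.
- by exists (x + y); rewrite rmorphD.
- by exists (x * y); rewrite rmorphM.
Qed.

End Noetherian.

(** * The Nullstellensatz over an uncountable algebraically closed field *)

Section Nullstellensatz.
Variable F : closedFieldType.
(* This holds as soon as [F] is uncountable. *)
Hypothesis F_fiber : forall f : F -> nat, exists k, infinite_set [set c | f c = k].
Variable n : nat.
Implicit Types p q f : mpoly n F.
Local Notation "''Y_' i" := (mpolyX F (mnm1 i)) (at level 8, i at level 2).
Local Notation C := (@mpolyC n F).

Definition ideal_avoids (f : mpoly n F) (J : mpoly n F -> Prop) :=
  is_ideal J /\ forall k, ~ J (f ^+ k).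

(** Noetherianity replaces Zorn's lemma: without a maximal ideal one could adjoin elements forever
    without meeting a power of [f], and the adjoined elements would contradict
    [mpoly_noetherian]. *)
Lemma maximal_avoiding f P : ideal_avoids f P ->
  exists2 J, ideal_avoids f J /\ (forall p, P p -> J p) &
    forall x, ~ J x -> exists k, ideal_adj J x (f ^+ k).
Proof.
move=> hP; apply: contrapT => hn.
have next (J : mpoly n F -> Prop) : exists Jx : (mpoly n F -> Prop) * mpoly n F,
   ideal_avoids f J /\ (forall p, P p -> J p) ->
   [/\ ideal_avoids f Jx.1, forall p, J p -> Jx.1 p, Jx.1 Jx.2 & ~ J Jx.2].
  have [[aJ PJ]|hJ] := pselect (ideal_avoids f J /\ (forall p, P p -> J p)); last first.
    by exists (J, 0) => /hJ.
  apply: contrapT => hJn; apply: hn; exists J => // x Jx.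
  apply: contrapT => hk; apply: hJn; exists (ideal_adj J x, x) => _ /=.
  have [iJ _] := aJ; split=> //.
  - by split=> [|k hfk]; [apply: ideal_adj_ideal|apply: hk; exists k].
  - by move=> p; apply: ideal_adjS.
  - exact: ideal_adj_mem.
have [nx hnx] := choice next.
pose S := fix S k := if k is l.+1 then (nx (S l)).1 else P.
have hS k : ideal_avoids f (S k) /\ (forall p, P p -> S k p).
  elim: k => [|k IH] //=; have [a1 a2 _ _] := hnx _ IH; split=> // p hp.
  by apply: a2; apply: (IH.2).
have SS k l p : (k <= l)%N -> S k p -> S l p.
  elim: l => [|l IH]; first by rewrite leqn0 => /eqP->.
  rewrite leq_eqVlt => /orP[/eqP->//|/IH h /h] /=.
  by have [_ a2 _ _] := hnx _ (hS l); apply: a2.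
have [K hK] := @mpoly_noetherian F n (fun k => (nx (S k)).2).
have [_ _ _] := hnx _ (hS K); apply; apply: hK; first by case: (hS K) => -[].
move=> _ [i iK ->]; apply: (SS i.+1) => //=.
by have [] := hnx _ (hS i).
Qed.

(** If neither factor were in [J], powers of [f] would lie in [J + (a)] and in [J + (b)], and their
    product in [J + (ab)], which is [J]. *)
Lemma maximal_avoiding_prime f J : ideal_avoids f J ->
    (forall x, ~ J x -> exists k, ideal_adj J x (f ^+ k)) -> prime_ideal J.
Proof.
move=> [iJ aJ] mJ; split=> // [|a b ab]; first by rewrite -(expr0 f); apply: aJ.
apply: contrapT => /not_orP[/mJ[k [u hu]] /mJ[l [v hv]]].
apply: (aJ (k + l)%N); have [_ hD hM] := iJ; rewrite exprD.
have -> : f ^+ k * f ^+ l = (f ^+ k - u * a) * f ^+ l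
     + (u * a * (f ^+ l - v * b) + u * v * (a * b)) by ring.
apply: (hD); first exact: idealMr.
by apply: hD; apply: hM.
Qed.

Lemma infinite_uniq_seq (T : choiceType) (A : set T) N : infinite_set A ->
  exists s : seq T, [/\ uniq s, size s = N & forall x, x \in s -> A x].
Proof.
move=> iA; elim: N => [|N [s [us ss sA]]]; first by exists [::].
have [x [Ax xs]] : exists x, A x /\ x \notin s.
  apply: contrapT => hn; apply: iA; apply: (@sub_finite_set _ _ [set` s]) => //.
  by move=> x Ax /=; apply: contrapT => /negP xs; apply: hn; exists x.
exists (x :: s); rewrite /= xs us ss; split=> // y; rewrite inE => /orP[/eqP-> //|].
exact: sA.
Qed.

Lemma mpoly_dependent D m (b : 'I_m -> mpoly n F) :
  (forall j, (msize (b j) <= D)%N) -> (#|{: bmultinom n D}| < m)%N ->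
  exists2 a : 'I_m -> F, (exists j, a j != 0) & \sum_j a j *: b j = 0.
Proof.
move=> hb hm; pose B : 'M[F]_(m, #|{: bmultinom n D}|) :=
  \matrix_(j, e) mcoeff (bmnm (enum_val e)) (b j).
have : kermx B != 0.
  rewrite -mxrank_eq0 mxrank_ker -lt0n subn_gt0.
  by apply: leq_ltn_trans hm; rewrite rank_leq_col.
case/rowV0Pn => v /sub_kermxP vB v0; exists (v 0).
  apply: contrapT => h; case/eqP: v0; apply/rowP => j; rewrite mxE.
  by apply/eqP; apply: contrapT => /negP h'; apply: h; exists j.
apply/mpolyP => m'; rewrite mcoeff0 raddf_sum /=.
case: (ltnP (mdeg m') D) => hD; last first.
  rewrite big1 // => j _; rewrite mcoeffZ memN_msupp_eq0 ?mulr0 //.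
  by apply: msize_mdeg_ge; apply: leq_trans hD.
move/rowP: vB => /(_ (enum_rank (BMultinom hD))); rewrite !mxE => vB.
by rewrite -[RHS]vB; apply: eq_bigr => j _; rewrite mcoeffZ mxE enum_rankK.
Qed.

Lemma prime_ideal_prod (R : comNzRingType) (J : R -> Prop) (I : Type) (r : seq I) (G : I -> R) :
  prime_ideal J -> J (\prod_(i <- r) G i) -> exists i, J (G i).
Proof.
case=> iJ J1 Jp; elim: r => [|i r IH]; first by rewrite big_nil => /J1.
by rewrite big_cons => /Jp[h|/IH//]; exists i.
Qed.

(* Otherwise every [X_i - c] divides a power of [f] modulo [J]; for infinitely many [c] the exponent and the degree
   of the quotient are the same, so that these quotients are linearly dependent, and clearing denominators puts a
   nonzero polynomial in [X_i] into [J]. *)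
Lemma coord_constant f J i : ideal_avoids f J ->
    (forall x, ~ J x -> exists k, ideal_adj J x (f ^+ k)) ->
  exists c, J ('Y_i - C c).
Proof.
move=> aJ mJ; have pJ := maximal_avoiding_prime aJ mJ; have [iJ _] := aJ.
apply: contrapT => hn.
have /choice[kb hkb] : forall c, exists kb : nat * mpoly n F,
    J (f ^+ kb.1 - kb.2 * ('Y_i - C c)).
  move=> c; have [|k [b hb]] := mJ ('Y_i - C c); last by exists (k, b).
  by move=> h; apply: hn; exists c.
(* [pickle] codes exponent and size as one natural number, so that one infinite fibre fixes both. *)
have [N fN] := F_fiber (fun c => pickle ((kb c).1, msize (kb c).2)).
have [s0 [_ s0s s0N]] := infinite_uniq_seq 1 fN.
case: s0 s0s s0N => // c0 _ _ /(_ c0 (mem_head _ _)) c0N.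
set k := (kb c0).1 in c0N; set D := msize (kb c0).2 in c0N.
have [s [us ss sN]] := infinite_uniq_seq (#|{: bmultinom n D}|.+1) fN.
pose c (j : 'I_(#|{: bmultinom n D}|.+1)) := s`_j.
have cN j : (kb (c j)).1 = k /\ msize (kb (c j)).2 = D.
  have : s`_j \in s by rewrite mem_nth // ss.
  move/sN; rewrite /= -c0N => /(pcan_inj pickleK) [h1 h2]; split => //.
have c_inj : injective c.
  by move=> j l /eqP; rewrite nth_uniq ?ss // => /eqP /val_inj.
have [//|//|a [j0 aj0] ha] := @mpoly_dependent D _ (fun j => (kb (c j)).2).
  by move=> j; rewrite (cN j).2.
(* The numerator of the sum of the [a_j / (X - c_j)]; at [c j0] a single nonzero term survives. *)
pose Q : {poly F} := \sum_j a j *: \prod_(l | l != j) ('X - (c l)%:P).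
have Q0 : Q != 0.
  apply/eqP => /(congr1 (horner^~ (c j0))) /eqP; apply/negP.
  rewrite horner0 /Q horner_sum (bigD1 j0) //= [X in _ + X]big1 => [|j jj0].
    rewrite addr0 hornerZ mulf_neq0 // horner_prod prodf_seq_neq0.
    apply/allP => l _; apply/implyP => lj; rewrite hornerXsubC subr_eq0.
    by apply: contra lj => /eqP/c_inj->.
  rewrite hornerZ horner_prod (bigD1 j0) 1?eq_sym //= hornerXsubC subrr.
  by rewrite mul0r mulr0.
pose E : {rmorphism {poly F} -> mpoly n F} := horner_eval 'Y_i \o map_poly C.
have EX x : E ('X - x%:P) = 'Y_i - C x.
  by rewrite /= /horner_eval rmorphB /= map_polyX map_polyC hornerXsubC.
have EC x : E x%:P = C x by rewrite /= /horner_eval map_polyC hornerC.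
have EQ : J (f ^+ k * E Q).
  (* The relation [ha], multiplied by all the ['Y_i - C (c l)], is subtracted; what remains is a
     combination of the elements [hkb (c j)] of [J]. *)
  have -> : f ^+ k * E Q = \sum_j C (a j) * (\prod_(l | l != j) ('Y_i - C (c l)))
      * (f ^+ k - (kb (c j)).2 * ('Y_i - C (c j))).
    have -> : E Q = \sum_j C (a j) * (\prod_(l | l != j) ('Y_i - C (c l))).
      rewrite rmorph_sum; apply: eq_bigr => j _.
      rewrite -mul_polyC rmorphM EC rmorph_prod; congr (_ * _).
      by apply: eq_bigr => l _; rewrite EX.
    have hz : \sum_j (\prod_l ('Y_i - C (c l))) * (a j *: (kb (c j)).2) = 0.
      by rewrite -mulr_sumr ha mulr0.
    rewrite mulr_sumr -[LHS]subr0 -[X in _ - X]hz -sumrB.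
    apply: eq_bigr => j _; rewrite -(mul_mpolyC (a j)) [X in _ - X * _](bigD1 j) //=.
    move: (\prod_(l | l != j) _) => P; ring.
  apply: ideal_sum => // j _; have [_ _ hM] := iJ; apply: hM.
  by have := hkb (c j); rewrite (cN j).1.
have {}EQ : J (E Q).
  have [_ _ /(_ _ _ EQ)[//|]] := pJ; by case: aJ => _ /(_ k).
have [r hr] := closed_field_poly_normal Q.
move: EQ; rewrite hr -mul_polyC rmorphM EC rmorph_prod; have [_ J1 Jp] := pJ.
case/Jp => [h|/(prime_ideal_prod pJ)[x]]; last by rewrite EX => h; apply: hn; exists x.
apply: J1; rewrite -mpolyC1 -(mulVf (x := lead_coef Q)) ?lead_coef_eq0 // mpolyCM.
by have [_ _ hM] := iJ; apply: hM.
Qed.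

Lemma ideal_of_point J (z : 'I_n -> F) : is_ideal J ->
  (forall i, J ('Y_i - C (z i))) -> forall p, J (p - C (meval z p)).
Proof.
move=> iJ hz; have [h0 hD hM] := iJ.
apply: mpoly_ring_ind => [c|i|p q hp hq|p q hp hq].
- by rewrite mevalC subrr.
- by rewrite mevalXU.
- by rewrite mevalD mpolyCD opprD addrACA; apply: hD.
rewrite mevalM mpolyCM.
have -> : p * q - C (meval z p) * C (meval z q) =
  q * (p - C (meval z p)) + C (meval z p) * (q - C (meval z q)) by ring.
by apply: hD; apply: hM.
Qed.

(** An ideal containing [P] and maximal among those avoiding the powers of [f] contains some
    ['Y_i - C (z i)] for every [i], so modulo it every polynomial equals its value at [z]. *)
Theorem nullstellensatz (P : mpoly n F -> Prop) f : is_ideal P ->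
  (forall k, ~ P (f ^+ k)) ->
  exists z : 'I_n -> F, (forall p, P p -> meval z p = 0) /\ meval z f != 0.
Proof.
move=> iP aP; have [J [aJ PJ] mJ] := maximal_avoiding (conj iP aP).
have [z hz] := choice (fun i => coord_constant i aJ mJ).
have [iJ J1 _] := maximal_avoiding_prime aJ mJ.
have hJ := ideal_of_point iJ hz.
have J0 c : J (C c) -> c = 0.
  move=> Jc; apply/eqP; apply: contrapT => /negP c0; apply: J1.
  by rewrite -mpolyC1 -(mulVf c0) mpolyCM; have [_ _ hM] := iJ; apply: hM.
exists z; split=> [p /PJ Jp|].
  apply: J0; rewrite -[C _](subKr p); exact: idealB (hJ p).
apply/eqP => fz; case: aJ => _ /(_ 1%N); apply.
by rewrite expr1; have := hJ f; rewrite fz mpolyC0 subr0.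
Qed.

End Nullstellensatz.

(** A countable set has Lebesgue measure 0, while the unit interval has measure 1. *)
Lemma realType_uncountable (R : realType) : ~ countable [set: R].
Proof.
move=> h; have /countable_lebesgue_measure0 : countable (`[0, 1]%classic : set R).
  by apply: sub_countable h; apply: subset_card_le.
rewrite lebesgue_measure_itv /= lte_fin ltr01 sube0 => /eqP.
by rewrite eqe oner_eq0.
Qed.

Lemma uncountable_fiber (T : choiceType) (f : T -> nat) : ~ countable [set: T] ->
  exists k, infinite_set [set c | f c = k].
Proof.
move=> h; apply: contrapT => hn; apply: h.
have -> : [set: T] = \bigcup_k [set c | f c = k].
  by apply/seteqP; split=> // x _; exists (f x).
apply: bigcup_countable => // k _; apply: finite_set_countable.
by apply: contrapT => hk; apply: hn; exists k.
Qed.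

Lemma complex_uncountable (R : realType) : ~ countable [set: R[i]].
Proof.
move=> h; apply: (@realType_uncountable R).
apply/countable_injP; have /countable_injP[f hf] := h.
by exists (fun x => f (x%:C)%C) => x y _ _ /hf; rewrite !inE => /(_ I I) [] ->.
Qed.

(** * Derivations and algebraic dependence *)

Section Derivations.
Variable L : fieldType.
Hypothesis L0 : [pchar L] =i pred0.

Definition subring_pred (E : L -> Prop) :=
  [/\ E 1, forall a b, E a -> E b -> E (a - b) & forall a b, E a -> E b -> E (a * b)].

(** The values lie in all of [L], and [D] is arbitrary outside [E]; with the domain kept as a
    predicate, extending a derivation requires no new ring. *)
Definition derivation_on (E : L -> Prop) (D : L -> L) :=
  [/\ subring_pred E, forall a b, E a -> E b -> D (a + b) = D a + D b &
      forall a b, E a -> E b -> D (a * b) = D a * b + a * D b].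

Section SubringTheory.
Variable E : L -> Prop.
Hypothesis sE : subring_pred E.
Lemma subring0 : E 0. Proof. by case: sE => h1 hB _; rewrite -(subrr 1); apply: hB. Qed.
Lemma subringN a : E a -> E (- a).
Proof. by move=> h; rewrite -sub0r; case: sE => _ hB _; apply: hB => //; apply: subring0. Qed.
Lemma subringD a b : E a -> E b -> E (a + b).
Proof. by move=> ha hb; rewrite -(opprK b); case: sE => _ hB _; apply: hB => //; apply: subringN. Qed.
Lemma subringM a b : E a -> E b -> E (a * b). Proof. by case: sE => _ _; apply. Qed.
Lemma subring1 : E 1. Proof. by case: sE. Qed.
Lemma subring_sum (I : Type) (r : seq I) (P : pred I) (G : I -> L) :
  (forall i, P i -> E (G i)) -> E (\sum_(i <- r | P i) G i).
Proof. by move=> h; apply: big_ind => //; [exact: subring0|exact: subringD]. Qed.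
Lemma subring_nat k : E k%:R.
Proof. by elim: k => [|k IH]; [exact: subring0|rewrite mulrS; apply: subringD => //; apply: subring1]. Qed.

Definition poly_over (p : {poly L}) := forall i, E p`_i.

Lemma poly_overC c : E c -> poly_over c%:P.
Proof. by move=> h i; rewrite coefC; case: ifP => // _; apply: subring0. Qed.
Lemma poly_overX : poly_over 'X.
Proof. by move=> i; rewrite coefX; apply: subring_nat. Qed.
Lemma poly_overD p q : poly_over p -> poly_over q -> poly_over (p + q).
Proof. by move=> hp hq i; rewrite coefD; apply: subringD. Qed.
Lemma poly_overN p : poly_over p -> poly_over (- p).
Proof. by move=> hp i; rewrite coefN; apply: subringN. Qed.
Lemma poly_overB p q : poly_over p -> poly_over q -> poly_over (p - q).
Proof. by move=> hp hq; apply: poly_overD => //; apply: poly_overN. Qed.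
Lemma poly_overM p q : poly_over p -> poly_over q -> poly_over (p * q).
Proof. by move=> hp hq i; rewrite coefM; apply: subring_sum => j _; apply: subringM. Qed.
Lemma poly_overXn n : poly_over 'X^n.
Proof. by move=> i; rewrite coefXn; apply: subring_nat. Qed.
Lemma poly_over_deriv p : poly_over p -> poly_over (deriv p).
Proof. by move=> hp i; rewrite coef_deriv -mulr_natr; apply: subringM => //; apply: subring_nat. Qed.

Definition adjoin a : L -> Prop := fun x => exists2 p, poly_over p & x = p.[a].

Lemma adjoin_subring a : subring_pred (adjoin a).
Proof.
split=> [|_ _ [p hp ->] [q hq ->]|_ _ [p hp ->] [q hq ->]].
- by exists 1; rewrite ?hornerC //; apply: poly_overC; apply: subring1.
- by exists (p - q); rewrite ?hornerD ?hornerN //; apply: poly_overB.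
- by exists (p * q); rewrite ?hornerM //; apply: poly_overM.
Qed.
Lemma adjoin_base a x : E x -> adjoin a x.
Proof. by exists x%:P; rewrite ?hornerC //; apply: poly_overC. Qed.
Lemma adjoin_gen a : adjoin a a.
Proof. by exists 'X; rewrite ?hornerX //; apply: poly_overX. Qed.
End SubringTheory.

Section DerivationTheory.
Variables (E : L -> Prop) (D : L -> L).
Hypothesis dD : derivation_on E D.
Let sE : subring_pred E. Proof. by case: dD. Qed.
Lemma derivationD a b : E a -> E b -> D (a + b) = D a + D b. Proof. by case: dD => _ + _; apply. Qed.
Lemma derivationM a b : E a -> E b -> D (a * b) = D a * b + a * D b. Proof. by case: dD => _ _; apply. Qed.
Lemma derivation0 : D 0 = 0.
Proof.
have E0 := subring0 sE; apply: (addrI (D 0)).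
by rewrite -derivationD // !addr0.
Qed.
Lemma derivation1 : D 1 = 0.
Proof.
have E1 := subring1 sE; apply: (addrI (D 1)).
by rewrite addr0 -{3}[1]mulr1 derivationM // mulr1 mul1r.
Qed.
Lemma derivationN a : E a -> D (- a) = - D a.
Proof.
move=> Ea; apply: (addrI (D a)).
by rewrite -derivationD ?subrr ?derivation0 //; apply: subringN.
Qed.
Lemma derivation_sum (I : Type) (r : seq I) (P : pred I) (G : I -> L) :
  (forall i, P i -> E (G i)) -> D (\sum_(i <- r | P i) G i) = \sum_(i <- r | P i) D (G i).
Proof.
move=> h; suff [] : E (\sum_(i <- r | P i) G i) /\
   D (\sum_(i <- r | P i) G i) = \sum_(i <- r | P i) D (G i) by [].
elim: r => [|i r [IH1 IH2]].
  by rewrite !big_nil derivation0; split=> //; apply: subring0.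
rewrite !big_cons; case: ifP => // Pi; split; last by rewrite derivationD ?IH2 //; apply: h.
by apply: subringD => //; apply: h.
Qed.

Definition poly_deriv (p : {poly L}) := \poly_(i < size p) D p`_i.
Lemma coef_poly_deriv p i : (poly_deriv p)`_i = D p`_i.
Proof. by rewrite coef_poly; case: ltnP => // h; rewrite nth_default // derivation0. Qed.

Variables (a v : L).
(** The value at [p.[a]] forced on any extension of [D] that sends [a] to [v]. *)
Definition adjoin_deriv_val (p : {poly L}) := (poly_deriv p).[a] + (deriv p).[a] * v.
Local Notation T := adjoin_deriv_val.

Lemma deriv_valD p q : poly_over E p -> poly_over E q -> T (p + q) = T p + T q.
Proof.
move=> hp hq; rewrite /T.
have -> : poly_deriv (p + q) = poly_deriv p + poly_deriv q.
  by apply/polyP => i; rewrite coefD !coef_poly_deriv coefD derivationD.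
by rewrite derivD !hornerD mulrDl addrACA.
Qed.
Lemma deriv_valM p q : poly_over E p -> poly_over E q ->
  T (p * q) = T p * q.[a] + p.[a] * T q.
Proof.
move=> hp hq; rewrite /T.
have -> : poly_deriv (p * q) = poly_deriv p * q + p * poly_deriv q.
  apply/polyP => i; rewrite coefD coef_poly_deriv !coefM derivation_sum.
    rewrite -big_split /=; apply: eq_bigr => j _.
    by rewrite !coef_poly_deriv derivationM.
  by move=> j _; apply: subringM.
rewrite derivM !hornerD !hornerM; ring.
Qed.
Lemma deriv_valC c : T c%:P = D c.
Proof.
rewrite /T derivC horner0 mul0r addr0.
have -> : poly_deriv c%:P = (D c)%:P.
  by apply/polyP => i; rewrite coef_poly_deriv !coefC; case: eqP => // _; rewrite derivation0.
by rewrite hornerC.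
Qed.
Lemma deriv_valX : T 'X = v.
Proof.
rewrite /T derivX hornerC mul1r.
have -> : poly_deriv 'X = 0; last by rewrite horner0 add0r.
apply/polyP => i; rewrite coef_poly_deriv coefX coef0.
by case: eqP => _; rewrite ?derivation1 ?derivation0.
Qed.
Lemma deriv_valN p : poly_over E p -> T (- p) = - T p.
Proof.
move=> hp; apply: (addrI (T p)); rewrite -deriv_valD ?subrr; last exact: poly_overN.
  by rewrite -(polyC0 L) deriv_valC derivation0.
by [].
Qed.

Hypothesis T0 : forall p, poly_over E p -> p.[a] = 0 -> T p = 0.

(** By [T0] the forced value depends on [p.[a]] only, not on the polynomial [p] that represents
    it. *)
Lemma adjoin_derivation : exists D', [/\ derivation_on (adjoin E a) D',
   forall x, E x -> D' x = D x & D' a = v].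
Proof.
have /choice[D' hD'] : forall x, exists y, forall p, poly_over E p -> x = p.[a] -> y = T p.
  move=> x; have [[p hp xp]|h] := pselect (adjoin E a x); last first.
    by exists 0 => p hp xp; case: h; exists p.
  exists (T p) => q hq xq; apply/eqP; rewrite -subr_eq0 -deriv_valN //.
  rewrite -deriv_valD //; last exact: poly_overN.
  by rewrite T0 //; [apply: poly_overB|rewrite hornerD hornerN -xp -xq subrr].
exists D'; split=> [|x Ex|].
- split; first exact: adjoin_subring.
    move=> _ _ [p hp ->] [q hq ->].
    rewrite (hD' p.[a] p) ?(hD' q.[a] q) // -(deriv_valD hp hq).
    by apply: hD'; rewrite ?hornerD //; apply: poly_overD.
  move=> _ _ [p hp ->] [q hq ->].
  rewrite (hD' p.[a] p) ?(hD' q.[a] q) // -(deriv_valM hp hq).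
  by apply: hD'; rewrite ?hornerM //; apply: poly_overM.
- by rewrite (hD' _ x%:P) ?hornerC ?deriv_valC //; apply: poly_overC.
- by rewrite (hD' _ 'X) ?hornerX ?deriv_valX //; apply: poly_overX.
Qed.
End DerivationTheory.

Definition transcendental_over (E : L -> Prop) a :=
  forall p, poly_over E p -> p.[a] = 0 -> p = 0.

Lemma adjoin_derivation_transcendental E D a v :
  derivation_on E D -> transcendental_over E a ->
  exists D', [/\ derivation_on (adjoin E a) D', forall x, E x -> D' x = D x & D' a = v].
Proof.
move=> dD ta; apply: adjoin_derivation => // p hp /(ta p hp) ->.
by rewrite -(polyC0 L) (deriv_valC dD) (derivation0 dD).
Qed.

Lemma natr_neq0 k : (k.+1)%:R != 0 :> L.
Proof. by have /pcharf0P -> := L0. Qed.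

(** When [a] is algebraic, its image is forced by differentiating a relation [m] of least degree. In
    characteristic 0 the derivative of [m] is nonzero, so by minimality it does not vanish at
    [a]. *)
Lemma adjoin_derivation_exists E D a : derivation_on E D ->
  exists D', derivation_on (adjoin E a) D' /\ forall x, E x -> D' x = D x.
Proof.
move=> dD; have sE : subring_pred E by case: dD.
have [ta|] := pselect (transcendental_over E a).
  by have [D' [h1 h2 _]] := adjoin_derivation_transcendental 0 dD ta; exists D'.
move=> nt.
have : exists m, `[< exists p : {poly L}, [/\ size p = m, poly_over E p, p.[a] = 0 & p != 0] >].
  apply: contrapT => h; apply: nt => p hp pa; apply/eqP; apply: contrapT => /negP p0.
  by apply: h; exists (size p); apply/asboolP; exists p.
case/ex_minnP => _ /asboolP[m [<- hm ma m0]] minm.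
have {}minm q : poly_over E q -> q.[a] = 0 -> q != 0 -> (size m <= size q)%N.
  by move=> hq qa q0; apply: minm; apply/asboolP; exists q.
have sm : (1 < size m)%N.
  rewrite ltnNge; apply/negP => /size1_polyC e; move: ma m0.
  by rewrite e hornerC => ->; rewrite eqxx.
have m'a : (deriv m).[a] != 0.
  apply/eqP => h; have hm' := poly_over_deriv sE hm.
  have m'0 : deriv m != 0.
    apply/eqP => /polyP /(_ (size m).-2); rewrite coef_deriv coef0.
    have -> : (size m).-2.+1 = (size m).-1 by lia.
    rewrite -mulr_natr; apply/eqP; rewrite mulf_neq0 -?lead_coefE ?lead_coef_eq0 //.
    have -> : (size m).-1 = (size m).-2.+1 by lia.
    exact: natr_neq0.
  have := minm _ hm' h m'0; rewrite leqNgt => /negP; apply; exact: lt_size_deriv.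
pose v := - (poly_deriv D m).[a] / (deriv m).[a].
have Tm : adjoin_deriv_val D a v m = 0.
  by rewrite /adjoin_deriv_val /v mulrC divfK // subrr.
have T0 p : poly_over E p -> p.[a] = 0 -> adjoin_deriv_val D a v p = 0.
  move: {2}(size p) (leqnn (size p)) => N; elim: N p => [|N IH] p.
    rewrite leqn0 size_poly_eq0 => /eqP-> _ _.
    by rewrite -(polyC0 L) (deriv_valC dD) (derivation0 dD).
  move=> sp hp pa; have [->|p0] := eqVneq p 0.
    by rewrite -(polyC0 L) (deriv_valC dD) (derivation0 dD).
  have smp := minm _ hp pa p0.
  (* [E] is only a ring, so [p] is pseudo-divided by [m]: it is first multiplied by [c], and then
     the top terms cancel. *)
  set c := lead_coef m; set d := lead_coef p; set k := (size p - size m)%N.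
  have Ec : E c by apply: hm.
  have Ed : E d by apply: hp.
  have hcp : poly_over E (c%:P * p) by apply: poly_overM => //; apply: poly_overC.
  have hdX : poly_over E (d%:P * 'X^k).
    by apply: poly_overM => //; [apply: poly_overC|apply: poly_overXn].
  have hdm : poly_over E (d%:P * 'X^k * m) by apply: poly_overM.
  have := IH (c%:P * p - d%:P * 'X^k * m).
  rewrite (deriv_valD dD) ?(deriv_valN dD) //; last exact: poly_overN.
  rewrite !(deriv_valM dD) //; do ?[exact: poly_overC|exact: poly_overXn].
  rewrite Tm ma pa hornerC !mulr0 add0r addr0 subr0 => h.
  suff : c * adjoin_deriv_val D a v p = 0.
    by move/eqP; rewrite mulf_eq0 lead_coef_eq0 (negbTE m0) => /eqP.
  apply: h; last 2 first.
  - by apply: poly_overB.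
  - by rewrite hornerD hornerN !hornerM ma pa !mulr0 subrr.
  apply/leq_sizeP => j; rewrite leq_eqVlt => /orP[/eqP<-|jN].
    rewrite coefB mul_polyC coefZ -mulrA [_ * m]mulrC coefCM coefMXn.
    move: sp; rewrite leq_eqVlt => /orP[/eqP sp|sp]; last first.
      have Nm : (N < k)%N = false by apply/negbTE; rewrite -leqNgt /k; lia.
      have h1 : (size m <= N - k)%N by rewrite /k; lia.
      by rewrite Nm (nth_default _ h1) nth_default ?mulr0 ?subrr.
    have Nk : (N < k)%N = false by apply/negbTE; rewrite -leqNgt /k; lia.
    rewrite Nk; have -> : (N - k)%N = (size m).-1 by rewrite /k; lia.
    rewrite -lead_coefE; have -> : N = (size p).-1 by lia.
    by rewrite -lead_coefE mulrC subrr.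
  rewrite coefB mul_polyC coefZ -mulrA [_ * m]mulrC coefCM coefMXn.
  have jk : (j < k)%N = false by apply/negbTE; rewrite -leqNgt /k; lia.
  have h1 : (size m <= j - k)%N by rewrite /k; lia.
  by rewrite jk (nth_default _ h1) nth_default ?mulr0 ?subrr //; apply: leq_trans sp jN.
by have [D' [h1 h2 _]] := adjoin_derivation dD T0; exists D'.
Qed.

Lemma derivation_extend E D (s : seq L) : derivation_on E D ->
  exists E' D', [/\ derivation_on E' D', forall x, E x -> E' x, forall x, E x -> D' x = D x &
     forall x, x \in s -> E' x].
Proof.
elim: s E D => [|a s IH] E D dD; first by exists E, D.
have sE : subring_pred E by case: dD.
have [D1 [d1 h1]] := adjoin_derivation_exists a dD.
have [E2 [D2 [d2 h2 h3 h4]]] := IH _ _ d1.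
exists E2, D2; split=> // [x Ex|x Ex|x].
- by apply: h2; apply: adjoin_base.
- by rewrite h3 ?h1 //; apply: adjoin_base.
- rewrite inE => /orP[/eqP->|/h4 //]; apply: h2; exact: adjoin_gen.
Qed.

Variables (F : fieldType) (iota : {rmorphism F -> L}).

Definition eval2 (x y : L) (Q : {poly {poly F}}) : L :=
  (map_poly (fun q => (map_poly iota q).[x]) Q).[y].

(* Were [f] and [h] independent, there would be derivations with values (1, 0) and (0, 1) on them. *)
Lemma algebraic_dependence (s : seq L) (y f h cf ch : L) :
  (forall E D, derivation_on E D -> (forall c, E (iota c) /\ D (iota c) = 0) ->
     (forall x, x \in s -> E x) -> E f -> E h -> D f = cf * D y /\ D h = ch * D y) ->
  exists2 Q, Q != 0 & eval2 f h Q = 0.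
Proof.
move=> H; apply: contrapT => hQ.
have {}hQ Q : eval2 f h Q = 0 -> Q = 0.
  by move=> e; apply/eqP; apply: contrapT => /negP Q0; apply: hQ; exists Q.
pose E0 x := exists c, x = iota c.
have s0 : subring_pred E0.
  split=> [|_ _ [c ->] [d ->]|_ _ [c ->] [d ->]].
  - by exists 1; rewrite rmorph1.
  - by exists (c - d); rewrite rmorphB.
  - by exists (c * d); rewrite rmorphM.
have d0 : derivation_on E0 (fun=> 0).
  by split=> // a b _ _; rewrite ?addr0 // mul0r mulr0 addr0.
have E0P p : poly_over E0 p -> exists q, p = map_poly iota q.
  move=> hp; have [g hg] := choice hp.
  exists (\poly_(i < size p) g i); apply/polyP => i; rewrite coef_map coef_poly.
  by case: ltnP => hi; [apply: hg|rewrite raddf0 nth_default].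
have mapE x : {morph (fun q => (map_poly iota q).[x]) : p q / p - q}.
  by move=> p q /=; rewrite rmorphB hornerD hornerN.
pose ev x := horner_eval x \o map_poly iota : {rmorphism {poly F} -> L}.
have tf : transcendental_over E0 f.
  move=> p /E0P[q ->] qf; apply/eqP; rewrite map_poly_eq0; apply/eqP.
  apply: polyC_inj; rewrite polyC0; apply: hQ.
  by rewrite /eval2 -[fun q => _]/(ev f : _ -> _) map_polyC hornerC.
have th : transcendental_over (adjoin E0 f) h.
  move=> p hp ph.
  have /choice[g hg] : forall i, exists q, p`_i = ev f q.
    by move=> i; have [q' /E0P[q ->] e] := hp i; exists q.
  have pE : p = map_poly (ev f) (\poly_(i < size p) g i).
    apply/polyP => i; rewrite coef_map coef_poly.
    by case: ltnP => hi; [apply: hg|rewrite raddf0 nth_default].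
  rewrite pE (hQ (\poly_(i < size p) g i)) ?map_poly0 //.
  by rewrite /eval2 -[fun q => _]/(ev f : _ -> _) -pE.
have key a b : exists E D, [/\ derivation_on E D, forall c, E (iota c) /\ D (iota c) = 0,
   forall x, x \in s -> E x, E f /\ E h & D f = a /\ D h = b].
  have [D1 [d1 h1 f1]] := adjoin_derivation_transcendental a d0 tf.
  have [D2 [d2 h2 f2]] := adjoin_derivation_transcendental b d1 th.
  have [E3 [D3 [d3 h3 h3' h3s]]] := derivation_extend s d2.
  have E0c c : E0 (iota c) by exists c.
  have s1 := adjoin_subring s0 f.
  have E1c c := adjoin_base s0 f (E0c c); have E2c c := adjoin_base s1 h (E1c c).
  have E2f := adjoin_base s1 h (adjoin_gen s0 f).
  exists E3, D3; split=> //.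
  - by move=> c; split; [apply: h3|rewrite h3' ?h2 ?h1].
  - by split; apply: h3 => //; apply: adjoin_gen.
  - by rewrite !h3' //; [rewrite h2 //; apply: adjoin_gen|apply: adjoin_gen].
have [E1 [D1 [d1 c1 s1 [f1 g1] [a1 b1]]]] := key 1 0.
have [E2 [D2 [d2 c2 s2 [f2 g2] [a2 b2]]]] := key 0 1.
have [e1 e2] := H _ _ d1 c1 s1 f1 g1; have [e3 e4] := H _ _ d2 c2 s2 f2 g2.
(* [cf * D1 y = 1] and [ch * D1 y = 0] force [ch = 0], which is incompatible with [D2 h = 1]. *)
move: e1 e2; rewrite a1 b1 => e1 /esym/eqP; rewrite mulf_eq0 => /orP[/eqP ch0|/eqP y0].
  by move/eqP: e4; rewrite b2 ch0 mul0r oner_eq0.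
by move/eqP: e1; rewrite y0 mulr0 oner_eq0.
Qed.

End Derivations.

(** * Smith normal form and monomial maps *)

Section Lattice.
Variables (n : nat) (A : 'M[int]_(n, n.+1)).

Definition minor_vector (v : 'I_n.+1) : int := (-1) ^+ v * \det (col' v A).

Definition stack_row (x : 'rV[int]_n.+1) (B : 'M[int]_(n, n.+1)) : 'M[int]_(1 + n) :=
  col_mx x B.

(** Laplace expansion along the added row: pairing with the vector of minors is a determinant. *)
Lemma det_col_mx_minor (x : 'rV[int]_n.+1) :
  \det (stack_row x A) = \sum_v x 0 v * minor_vector v.
Proof.
rewrite (expand_det_row _ (lshift n 0)); apply: eq_bigr => v _.
rewrite col_mxEu /cofactor /minor_vector add0n; congr (_ * (_ * \det _)).
apply/matrixP => i j; rewrite !mxE.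
have -> : lift (lshift n 0) i = rshift 1 i by apply: val_inj.
by rewrite (unsplitK (inr i)).
Qed.

(** Each entry is the determinant of a matrix with a repeated row. *)
Lemma minor_vector_ker : A *m (\col_v minor_vector v) = 0.
Proof.
apply/matrixP => i j; rewrite !mxE.
transitivity (\det (stack_row (row i A) A)).
  by rewrite det_col_mx_minor; apply: eq_bigr => v _; rewrite !mxE.
apply: (determinant_alternate (i1 := lshift n 0) (i2 := rshift 1 i)) => [|v]; first by [].
by rewrite col_mxEu col_mxEd mxE.
Qed.

Lemma big_gcdn_mul (I : Type) (r : seq I) (P : pred I) c (b : I -> nat) :
  \big[gcdn/0%N]_(i <- r | P i) (c * b i)%N = (c * \big[gcdn/0%N]_(i <- r | P i) b i)%N.
Proof.
symmetry; apply: (big_morph (fun x => c * x)%N); last by rewrite muln0.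
by move=> x y; rewrite muln_gcdr.
Qed.

Lemma big_gcdn_dvd m (b : 'I_m -> nat) i : (\big[gcdn/0%N]_(j < m) b j %| b i)%N.
Proof. by rewrite (bigD1 i) //= dvdn_gcdl. Qed.

Definition diag_block (h : 'I_n -> int) : 'M[int]_(n, n.+1) :=
  \matrix_(i, j) (h i *+ (i == j :> nat)).

Lemma det_diag_block h :
  absz (\det (stack_row (delta_mx ord0 ord_max) (diag_block h))) = (\prod_i absz (h i))%N.
Proof.
rewrite (expand_det_row _ (lshift n 0)) (bigD1 ord_max) //= big1 ?addr0; last first.
  by move=> v vm; rewrite col_mxEu mxE (negbTE vm) andbF mul0r.
rewrite col_mxEu mxE !eqxx mul1r /cofactor abszMsign.
transitivity (absz (\det (diag_mx (\row_i h i)))); last first.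
  rewrite det_diag (big_morph absz (id1 := 1%N) abszM) //.
  by apply: eq_bigr => i _; rewrite mxE.
apply: (congr1 (fun B : 'M[int]_n => absz (\det B))).
apply/matrixP => i j; rewrite !mxE.
rewrite [fintype.split _](_ : _ = inr i); last first.
  by rewrite -[RHS](unsplitK (inr i)); congr fintype.split; apply: val_inj.
rewrite mxE; congr (_ *+ _).
by rewrite lift_max -val_eqE.
Qed.

Lemma absz_det_unit m (B : 'M[int]_m) : B \in unitmx -> `|\det B|%N = 1%N.
Proof.
move=> uB; have := det_mulmx B (invmx B); rewrite mulmxV // det1.
by move/(congr1 absz); rewrite abszM => /esym/eqP; rewrite muln_eq1 => /andP[/eqP].
Qed.

(* The vector of signed maximal minors spans the kernel of [A] over the rationals, and so does the last column of [U];
   the latter is primitive, which makes the gcd of the minors appear. *)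
Lemma smith_positive_kernel :
    (forall v, 0 < minor_vector v) \/ (forall v, minor_vector v < 0) ->
  exists (V V' : 'M[int]_n) (U W : 'M[int]_n.+1) (h : 'I_n -> nat),
   [/\ V *m A *m U = diag_block (fun i => (h i)%:Z),
       V' *m V = 1%:M,
       U *m W = 1%:M /\ W *m U = 1%:M,
       (forall v, 0 < U v ord_max) &
       (forall i, (0 < h i)%N) /\
       (\prod_i h i)%N = \big[gcdn/0%N]_v `|minor_vector v|%N].
Proof.
move=> hd; have [L uL [R uR [d _ AE]]] := int_Smith_normal_form A.
pose g (i : 'I_n) := d`_i.
have {}AE : A = L *m diag_block g *m R by [].
pose U := invmx R.
have uU : U \in unitmx by rewrite unitmx_inv.
have AU : A *m U = L *m diag_block g by rewrite AE mulmxK.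
have d0 : minor_vector ord_max != 0.
  by case: hd => /(_ ord_max); [move/lt0r_neq0|move/ltr0_neq0].
(* A zero invariant factor would annihilate every maximal minor. *)
have g0 i : g i != 0.
  apply/eqP => gi; case/eqP: d0; rewrite /minor_vector AE -mulmxA col'Esub -mulmx_colsub det_mulmx.
  suff -> : \det (colsub (lift ord_max) (diag_block g *m R)) = 0 by rewrite !mulr0.
  rewrite (expand_det_row _ i) big1 // => j _; rewrite mxE mxE big1 ?mul0r // => k _.
  by rewrite mxE gi mul0rn mul0r.
pose dv := \col_v minor_vector v.
(* The coordinates of the vector of minors in the basis of columns of [U]. All but the last vanish,
   since [A] kills the vector and the diagonal entries are nonzero; so the vector is a multiple of
   the last column. *)
pose y := R *m dv.
have dvE : dv = U *m y by rewrite mulKmx.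
have yi (i : 'I_n) : y (widen_ord (leqnSn n) i) 0 = 0.
  have : diag_block g *m y = 0.
    by apply: (can_inj (mulKmx uL)); rewrite mulmx0 !mulmxA -AE minor_vector_ker.
  move/matrixP => /(_ i 0); rewrite mxE [RHS]mxE (bigD1 (widen_ord (leqnSn n) i)) //= big1 ?addr0.
    by rewrite [diag_block _ _ _]mxE eqxx mulr1n => /eqP; rewrite mulf_eq0 (negbTE (g0 i)) => /eqP.
  move=> k ki; rewrite mxE; case: eqP => [e|_]; last by rewrite mul0r.
  by case/eqP: ki; apply: val_inj.
have dE v : minor_vector v = U v ord_max * y ord_max 0.
  have := congr1 (fun B : 'cV_n.+1 => B v 0) dvE; rewrite mxE [RHS]mxE => ->.
  by rewrite big_ord_recr /= big1 ?add0r // => i _; rewrite yi mulr0.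
(* The multiplier is the determinant of [A] stacked under the last row of [R]; the unimodular base
   changes turn it, up to sign, into that of the diagonal block. *)
have yP : absz (y ord_max 0) = (\prod_i absz (g i))%N.
  have -> : y ord_max 0 = \det (stack_row (row ord_max R) A).
    by rewrite det_col_mx_minor mxE; apply: eq_bigr => v _; rewrite !mxE.
  rewrite -(det_diag_block g).
  have e : stack_row (row ord_max R) A *m (U : 'M[int]_(1 + n)) =
     (block_mx 1%:M 0 0 L : 'M[int]_(1 + n)) *m stack_row (delta_mx ord0 ord_max) (diag_block g).
    rewrite /stack_row (mul_col_mx (m1 := 1) (m2 := n)).
    rewrite (mul_block_col (m1 := 1) (m2 := n) (n1 := 1) (n2 := n)).
    rewrite !mul0mx add0r addr0 mul1mx -row_mul mulmxV // AU.
    by congr col_mx; apply/rowP => j; rewrite !mxE eqxx eq_sym.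
  have := congr1 (fun B => absz (\det B)) e.
  rewrite !det_mulmx !abszM (absz_det_unit uU) muln1 det_ublock det1 mul1r.
  by rewrite (absz_det_unit uL) mul1n.
(* The sign matrices [S], acting on rows, and [T], acting on the last column, make the diagonal and
   the last column of [U] positive; that column has constant sign because the minors do. *)
pose s (i : 'I_n) : int := (-1) ^+ (g i < 0)%R.
pose b : bool := U ord_max ord_max < 0.
have Ub v : 0 < (-1) ^+ b * U v ord_max.
  rewrite /b.
  have hp : 0 < U ord_max ord_max * U v ord_max.
    have : 0 < minor_vector ord_max * minor_vector v.
      by case: hd => hd; [apply: mulr_gt0|rewrite nmulr_rgt0].
    rewrite !dE mulrACA -expr2 => h; move: (h); rewrite pmulr_lgt0 //.
    rewrite exprn_even_gt0 //=; apply/eqP => y0.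
    by move: h; rewrite y0 expr0n mulr0 ltxx.
  case: (ltgtP (U ord_max ord_max) 0) hp => [h|h|->] /=; last by rewrite mul0r ltxx.
    by rewrite nmulr_rgt0 // expr1 mulN1r oppr_gt0.
  by rewrite pmulr_rgt0 // expr0 mul1r.
pose T : 'M[int]_n.+1 := diag_mx (\row_j (if j == ord_max then (-1) ^+ b else 1)).
have TT : T *m T = 1%:M.
  rewrite mulmx_diag -diag_const_mx; congr diag_mx; apply/rowP => j; rewrite !mxE.
  by case: eqP; rewrite ?mulr1 // -signr_addb addbb.
pose S : 'M[int]_n := diag_mx (\row_i s i).
have SS : S *m S = 1%:M.
  rewrite mulmx_diag -diag_const_mx; congr diag_mx; apply/rowP => j; rewrite !mxE.
  by rewrite -signr_addb addbb.
exists (S *m invmx L), (L *m S), (U *m T), (T *m R), (fun i => absz (g i)); split.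
- rewrite !mulmxA -(mulmxA _ A U) AU -(mulmxA S) mulKmx //.
  apply/matrixP => i j; rewrite mul_mx_diag mul_diag_mx !mxE.
  case: (altP (j =P ord_max)) => [->|_].
    by rewrite /= ltn_eqF ?ltn_ord // !mulr0n mulr0 mul0r.
  rewrite mulr1; case: eqP => _; rewrite ?mulr0n ?mulr0 //.
  by rewrite !mulr1n abszE /s -{2}[g i]mulr1; case: (ltP (g i) 0) => h /=; rewrite ?expr1 ?expr0; lia.
- by rewrite !mulmxA -(mulmxA L S S) SS mulmx1 mulmxV.
- split; first by rewrite !mulmxA -(mulmxA U T T) TT mulmx1 mulVmx.
  by rewrite !mulmxA -(mulmxA T R U) mulmxV // mulmx1 TT.
- by move=> v; rewrite mul_mx_diag !mxE eqxx mulrC.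
split=> [i|]; first by rewrite absz_gt0.
rewrite -yP.
under eq_bigr => v _ do rewrite dE mulrC abszM.
(* [G] is the gcd of the last column of [U]; it divides the last diagonal entry of [R *m U], which
   is 1. *)
rewrite big_gcdn_mul; set G := \big[gcdn/0%N]_v _.
suff -> : G = 1%N by rewrite muln1.
apply/eqP; rewrite -dvdn1.
have /matrixP/(_ ord_max ord_max) := mulmxV uR; rewrite !mxE eqxx => e.
have : (G%:Z %| (\sum_j R ord_max j * U j ord_max)%R)%Z.
  apply: (big_ind (fun x : int => (G%:Z %| x)%Z)) => [|x1 x2|j _]; first exact: dvdz0.
    exact: rpredD.
  by apply: dvdz_mull; rewrite dvdzE /=; apply: big_gcdn_dvd.
by rewrite e dvdzE.
Qed.

End Lattice.

(** * Monomial maps given by integer matrices *)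

Section Monomials.
Variable K : fieldType.

(** Integer matrices act on tuples of nonzero elements; by [monomials_mul] the matrix product
    becomes composition, so unimodular matrices act by changes of coordinates. *)
Definition monomials m k (x : 'I_k -> K) (B : 'M[int]_(m, k)) (i : 'I_m) : K :=
  \prod_j x j ^ B i j.

Lemma exprz_prod (I : Type) (r : seq I) (P : pred I) (G : I -> K) (z : int) :
  (\prod_(i <- r | P i) G i) ^ z = \prod_(i <- r | P i) G i ^ z.
Proof.
apply: (big_morph (fun x => x ^ z)); last exact: exp1rz.
by move=> x y; rewrite expfzMl.
Qed.

Lemma exprz_sum (x : K) (I : Type) (r : seq I) (P : pred I) (G : I -> int) : x != 0 ->
  x ^ (\sum_(i <- r | P i) G i) = \prod_(i <- r | P i) x ^ G i.
Proof.
move=> x0; apply: (big_morph (fun z => x ^ z)); last exact: expr0z.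
by move=> a b; rewrite expfzDr.
Qed.

Lemma monomials_neq0 m k (x : 'I_k -> K) (B : 'M[int]_(m, k)) i :
  (forall j, x j != 0) -> monomials x B i != 0.
Proof. by move=> hx; apply/prodf_neq0 => j _; rewrite expfz_neq0. Qed.

Lemma monomials_mul l m k (x : 'I_k -> K) (B : 'M[int]_(m, k)) (C : 'M[int]_(l, m)) i :
  (forall j, x j != 0) -> monomials (monomials x B) C i = monomials x (C *m B) i.
Proof.
move=> hx; rewrite /monomials.
under eq_bigr => j _ do rewrite exprz_prod.
rewrite exchange_big /=; apply: eq_bigr => j _.
rewrite mxE exprz_sum //; apply: eq_bigr => k' _.
by rewrite exprz_exp mulrC.
Qed.

Lemma monomials1 k (x : 'I_k -> K) i : monomials x 1%:M i = x i.
Proof.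
rewrite /monomials (bigD1 i) //= mxE eqxx expr1z big1 ?mulr1 // => j ji.
by rewrite mxE eq_sym (negbTE ji) expr0z.
Qed.

Lemma eq_monomials m k (x y : 'I_k -> K) (B : 'M[int]_(m, k)) i :
  x =1 y -> monomials x B i = monomials y B i.
Proof. by move=> h; apply: eq_bigr => j _; rewrite h. Qed.

Lemma monomialsM m k (x y : 'I_k -> K) (B : 'M[int]_(m, k)) i :
  monomials (fun j => x j * y j) B i = monomials x B i * monomials y B i.
Proof. by rewrite /monomials -big_split; apply: eq_bigr => j _; rewrite expfzMl. Qed.

End Monomials.

(** * Hensel's lemma for a system of power series *)

Section PowerSeriesSystem.
Variable F : fieldType.
Hypothesis F0 : [pchar F] =i pred0.
Implicit Types f g : fps F.

Lemma fcongM N f f' g g' : fdvdX N (f - f') -> fdvdX N (g - g') ->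
  fdvdX N (f * g - f' * g').
Proof.
move=> hf hg; have -> : f * g - f' * g' = (f - f') * g + f' * (g - g') by ring.
by apply: fdvdXD; [apply: fdvdXMr|apply: fdvdXMl].
Qed.
Lemma fcong_refl N f : fdvdX N (f - f). Proof. by rewrite subrr; apply: fdvdX0. Qed.
Lemma fcong_trans N f g k : fdvdX N (f - g) -> fdvdX N (g - k) -> fdvdX N (f - k).
Proof. by move=> h1 h2; rewrite -(subrKA g); apply: fdvdXD. Qed.
Lemma fcong_sym N f g : fdvdX N (f - g) -> fdvdX N (g - f).
Proof. by rewrite -opprB => /fdvdXN; rewrite opprK. Qed.
Lemma fcong_prod N (I : Type) (r : seq I) (G G' : I -> fps F) :
  (forall i, fdvdX N (G i - G' i)) -> fdvdX N (\prod_(i <- r) G i - \prod_(i <- r) G' i).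
Proof.
move=> h; apply: (big_ind2 (fun x y => fdvdX N (x - y))) => [|x1 x2 y1 y2|i _]; last exact: h.
  exact: fcong_refl.
exact: fcongM.
Qed.
Lemma fcongX N k f f' : fdvdX N (f - f') -> fdvdX N (f ^+ k - f' ^+ k).
Proof.
move=> h; elim: k => [|k IH]; first exact: fcong_refl.
by rewrite !exprS; apply: fcongM.
Qed.
Lemma fcongV N f f' : f \is a GRing.unit -> f' \is a GRing.unit ->
  fdvdX N (f - f') -> fdvdX N (f^-1 - f'^-1).
Proof.
move=> uf uf' h; have -> : f^-1 - f'^-1 = - (f^-1 * f'^-1) * (f - f').
  by rewrite mulrBr !mulNr mulrVK // mulrAC mulVr // mul1r opprK addrC.
exact: fdvdXMl.
Qed.
Lemma fcongz N (z : int) f f' : f \is a GRing.unit -> f' \is a GRing.unit ->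
  fdvdX N (f - f') -> fdvdX N (f ^ z - f' ^ z).
Proof.
move=> uf uf' h; case: z => k; first exact: fcongX.
rewrite NegzE -!exprnN -!exprVn; apply: fcongX; exact: fcongV.
Qed.

Lemma unitfps_fconst f : (f \is a GRing.unit) = (fconst f != 0). Proof. by []. Qed.
Lemma unitfps_1B f : fconst f = 0 -> 1 - f \is a GRing.unit.
Proof. by move=> h; rewrite unitfps_fconst fconstB fconst1 h subr0 oner_neq0. Qed.

(** The cofactor of [f - g] in [f ^+ k - g ^+ k] has constant term [k c^(k-1)], nonzero in
    characteristic 0, so it is a unit. *)
Lemma fcong_root N k f g (c : F) : (0 < k)%N -> c != 0 -> fconst f = c -> fconst g = c ->
  fdvdX N (f ^+ k - g ^+ k) -> fdvdX N (f - g).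
Proof.
case: k => // k _ c0 fc gc; rewrite subrXX mulrC; apply: fdvdX_unit.
rewrite unitfps_fconst fconst_sum.
rewrite (eq_bigr (fun=> c ^+ k)) => [|i _]; last first.
  by rewrite fconstM !fconstXn fc gc -exprD subnK // -ltnS.
rewrite sumr_const card_ord -mulr_natr mulf_neq0 ?expf_neq0 //.
by have /pcharf0P -> := F0.
Qed.

Variables (n : nat) (h : 'I_n -> nat) (e : 'I_n -> F) (a : 'I_n.+1 -> nat).
Variables (A : 'M[int]_(n.+1, n)) (Q : 'M[int]_(n, n.+1)).
Hypothesis h_gt0 : forall m, (0 < h m)%N.
Hypothesis a_gt0 : forall v, (0 < a v)%N.
Implicit Types (s : fps F) (u : 'I_n -> fps F).

(* The system reads [u_m ^ h_m = e_m * prod_v (1 - t_v) ^ Q_mv] with [t_v = s ^ a_v * prod_m u_m ^ A_vm]; modulo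
   [X ^ (N + 1)] the right-hand sides depend on [u] modulo [X ^ N] only. *)
Definition param s u (v : 'I_n.+1) : fps F := s ^+ a v * \prod_m u m ^ A v m.
Definition system_rhs s u m : fps F := fpsC (e m) * \prod_v (1 - param s u v) ^ Q m v.
Definition system s u := forall m, u m ^+ h m = system_rhs s u m.

Lemma fconst_param s u v : fconst s = 0 -> fconst (param s u v) = 0.
Proof. by move=> s0; rewrite /param rmorphM rmorphXn /= s0 expr0n eqn0Ngt a_gt0 mul0r. Qed.

Lemma unit_exprz f (z : int) : f \is a GRing.unit -> f ^ z \is a GRing.unit.
Proof. by move=> uf; case: z => k; rewrite ?NegzE -?exprnN ?unitrV unitrX. Qed.

(** The gain of one power of X comes from the factor [s ^+ a v], where [a v] is positive. *)
Lemma param_congr N s u u' v : fconst s = 0 ->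
  (forall m, u m \is a GRing.unit) -> (forall m, u' m \is a GRing.unit) ->
  (forall m, fdvdX N (u m - u' m)) -> fdvdX N.+1 (param s u v - param s u' v).
Proof.
move=> s0 uu uu' hN; rewrite /param -mulrBr -add1n; apply: fdvdXM.
  rewrite -(prednK (a_gt0 v)) exprS; apply: fdvdXMr; exact/fdvdX1.
by apply: fcong_prod => m; apply: fcongz.
Qed.

Lemma rhs_congr N s u u' m : fconst s = 0 ->
  (forall m, u m \is a GRing.unit) -> (forall m, u' m \is a GRing.unit) ->
  (forall m, fdvdX N (u m - u' m)) -> fdvdX N.+1 (system_rhs s u m - system_rhs s u' m).
Proof.
move=> s0 uu uu' hN; rewrite /system_rhs -mulrBr; apply: fdvdXMl.
apply: fcong_prod => v; apply: fcongz; do ?[by apply/unitfps_1B/fconst_param].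
have -> (x y : fps F) : 1 - x - (1 - y) = - (x - y) by ring.
by apply: fdvdXN; apply: param_congr.
Qed.

Lemma fconst_rhs s u m : fconst s = 0 -> fconst (system_rhs s u m) = e m.
Proof.
move=> s0; rewrite /system_rhs fconstM fconst_prod big1 ?mulr1 // => v _.
have e1 : fconst (1 - param s u v) = 1 by rewrite fconstB fconst1 fconst_param // subr0.
case: (Q m v) => k; first by rewrite fconstXn e1 expr1n.
rewrite NegzE -exprnN -exprVn fconstXn.
rewrite (_ : fconst _ = 1) ?expr1n //; apply: (mulIf (oner_neq0 F)).
rewrite -{1}e1 -fconstM mulVr ?fconst1 ?mulr1 //.
by apply: unitfps_1B; apply: fconst_param.
Qed.

(** A congruence modulo [X^N] improves to [X^(N+1)] in the right-hand sides by [rhs_congr], and then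
    passes to the roots by [fcong_root]. *)
Lemma system_unique s u u' (eta : 'I_n -> F) : fconst s = 0 -> (forall m, eta m != 0) ->
  (forall m, fconst (u m) = eta m) -> (forall m, fconst (u' m) = eta m) ->
  system s u -> system s u' -> u =1 u'.
Proof.
move=> s0 eta0 uc u'c su su'.
have uu m : u m \is a GRing.unit by rewrite unitfps_fconst uc.
have uu' m : u' m \is a GRing.unit by rewrite unitfps_fconst u'c.
have hN N : forall m, fdvdX N (u m - u' m).
  elim: N => [|N IH] m; first by exists (u m - u' m); rewrite mul1r.
   apply: (@fcong_root _ (h m) _ _ (eta m)) => //.
  by rewrite su su'; apply: rhs_congr.
by move=> m; apply/eqP; rewrite -subr_eq0; apply/eqP/fdvdX_eq0 => N.
Qed.

(** Newton iteration, started at the constants [eta], which solve the system modulo X. *)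
Lemma system_exists s (eta : 'I_n -> F) : fconst s = 0 -> (forall m, eta m != 0) ->
  (forall m, eta m ^+ h m = e m) ->
  exists u, (forall m, fconst (u m) = eta m) /\ system s u.
Proof.
move=> s0 eta0 etah.
pose ok N u := forall m, fconst (u m) = eta m /\ fdvdX N.+1 (u m ^+ h m - system_rhs s u m).
have step Nu : exists u', ok Nu.1 Nu.2 ->
    ok Nu.1.+1 u' /\ forall m, fdvdX Nu.1.+1 (u' m - Nu.2 m).
  case: Nu => N u /=; have [hu|] := pselect (ok N u); last by exists u.
  have /choice[u' hu'] : forall m, exists g, fdvdX N.+1 (g - u m) /\
     fdvdX N.+2 (g ^+ h m - system_rhs s u m).
    move=> m; have [um [g hg]] := hu m.
    have hn0 : (h m)%:R * eta m ^+ (h m).-1 != 0.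
      rewrite mulf_neq0 ?expf_neq0 //.
      by have /pcharf0P -> := F0; rewrite -lt0n.
    (* Adding [c X^(N+1)] to [u m] changes [u m ^+ h m] to first order by
       [h_m eta_m^(h_m - 1) c X^(N+1)], which has to cancel the leading term of the error. *)
    pose c := - fconst g / ((h m)%:R * eta m ^+ (h m).-1).
    exists (u m + fX ^+ N.+1 * fpsC c); rewrite addrAC subrr add0r; split.
      by exists (fpsC c).
    set w := u m + _.
    have wc : fconst w = eta m.
      by rewrite /w fconstD fconstM fconstXn um expr0n mul0r addr0.
    rewrite -(subrKA (u m ^+ h m)).
    rewrite hg subrXX {1}/w addrAC subrr add0r -mulrA -mulrDr -addn1.
    apply: fdvdXM; first by exists 1; rewrite mulr1.
    apply/fdvdX1; rewrite fconstD fconstM fconst_sum fconstC.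
    rewrite (eq_bigr (fun=> eta m ^+ (h m).-1)) => [|i _]; last first.
      rewrite fconstM !fconstXn wc um -exprD; congr (_ ^+ _); have := ltn_ord i; lia.
    rewrite sumr_const card_ord -mulr_natl /c mulrC mulrA [_ * (- _)]mulrC.
    by rewrite mulfK // addNr.
  have ucong m : fdvdX N.+1 (u' m - u m) by case: (hu' m).
  have uc m : fconst (u' m) = eta m.
    have [<- _] := hu m; have /eqP := fdvdX_coef (ucong m) (ltn0Sn N).
    by rewrite fcoefB subr_eq0 => /eqP.
  exists u' => _; split; last exact: ucong.
  move=> m; split; first exact: uc.
  have [_ h2] := hu' m.
  apply: fcong_trans h2 _; apply: fcong_sym; apply: rhs_congr => // k.
    by rewrite unitfps_fconst uc.
  by rewrite unitfps_fconst (hu k).1.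
have [nx hnx] := choice step.
pose S := fix S k := if k is l.+1 then nx (l, S l) else (fun m => fpsC (eta m)).
have S_ok k : ok k (S k).
  elim: k => [m|k IH]; last by have [] := hnx (k, S k) IH.
  rewrite /= fconstC; split=> //; apply/fdvdX1.
  by rewrite fconstB fconstXn fconstC etah fconst_rhs // subrr.
have S_cong k l m : (k <= l)%N -> fdvdX k.+1 (S l m - S k m).
  elim: l => [|l IH]; first by rewrite leqn0 => /eqP->; apply: fcong_refl.
  rewrite leq_eqVlt => /orP[/eqP->|kl]; first exact: fcong_refl.
  have [_ h2] := hnx (l, S l) (S_ok l).
  by apply: fcong_trans (IH kl); apply: fdvdX_leq kl (h2 m).
(* The limit is a diagonal: coefficient [i] no longer changes after stage [i]. *)
pose u m := Fps (fun i => S i m i).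
have uS k m : fdvdX k.+1 (u m - S k m).
  apply: fdvdXI => i ik; rewrite fcoefB; have /eqP := fdvdX_coef (@S_cong i k m ik) (ltnSn i).
  by rewrite fcoefB subr_eq0 => /eqP ->; rewrite subrr.
have uc m : fconst (u m) = eta m by [].
exists u; split=> // m; apply/eqP; rewrite -subr_eq0; apply/eqP/fdvdX_eq0 => N.
apply: (@fdvdX_leq _ _ N.+1) => //.
apply: fcong_trans (fcongX (h m) (uS N m)) _; apply: fcong_trans (S_ok N m).2 _.
apply: fcong_sym; apply: (@fdvdX_leq _ _ N.+2) => //; apply: rhs_congr => // k.
by rewrite unitfps_fconst (S_ok N k).1.
Qed.

End PowerSeriesSystem.

(** * Smooth points of affine curves *)

Section SpanOfForms.
Variables (F : fieldType) (M : nat).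

(** A free family of maximal length in [W] spans it, which turns the predicate into a row space; the
    columns of the cokernel matrix then test membership. *)
Lemma double_annihilator (W : 'rV[F]_M -> Prop) (xi : 'rV[F]_M) :
  W 0 -> (forall x y, W x -> W y -> W (x + y)) -> (forall c x, W x -> W (c *: x)) ->
  (forall w : 'cV[F]_M, (forall x, W x -> x *m w = 0) -> xi *m w = 0) -> W xi.
Proof.
move=> W0 WD WZ hxi.
pose P r := `[< exists A : 'M[F]_(r, M), (forall i, W (row i A)) /\ row_free A >].
have P0 : exists r, P r.
  exists 0%N; apply/asboolP; exists 0; split; first by case.
  by rewrite /row_free mxrank0.
have PM r : P r -> (r <= M)%N.
  by move/asboolP => [A [_ /eqP <-]]; apply: rank_leq_col.
case: (ex_maxnP P0 PM) => r /asboolP[A [WA fA]] maxr.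
have WS x : (x <= A)%MS -> W x.
  move=> /submxP[y ->]; rewrite mulmx_sum_row.
  by apply: (big_ind W) => // i _; apply: WZ.
have SW x : W x -> (x <= A)%MS.
  move=> Wx; apply: contrapT => /negP nx; suff /maxr : P r.+1 by rewrite ltnn.
  apply/asboolP; exists (col_mx x A : 'M[F]_(1 + r, M)); split=> [i|].
    case: (splitP (i : 'I_(1 + r))) => j e.
      have -> : i = lshift r j by apply: val_inj.
      have -> : row (lshift r j) (col_mx x A) = x; last by [].
      by apply/rowP => k; rewrite !mxE (unsplitK (inl j)) ord1.
    have -> : i = rshift 1 j by apply: val_inj.
    have -> : row (rshift 1 j) (col_mx x A) = row j A; last by [].
    by apply/rowP => k; rewrite !mxE (unsplitK (inr j)).
  apply/eqP/anti_leq/andP; split; first exact: rank_leq_row.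
  rewrite -(addsmxE x A) (leq_trans (n := (\rank A).+1)) ?(eqP fA) //.
  have : (A < x + A)%MS.
    rewrite ltmxE addsmxSr /=; apply: contra nx => h.
    by apply: submx_trans h; apply: addsmxSl.
  by move/rank_ltmx; rewrite (eqP fA).
apply: WS; rewrite submxE; apply/eqP/matrixP => i j; rewrite ord1 !mxE.
have := hxi (col j (cokermx A)) => /(_ _)/matrixP/(_ 0 0); rewrite !mxE => h.
rewrite -[RHS]h; first by apply: eq_bigr => k _; rewrite !mxE.
move=> x /SW; rewrite submxE => /eqP/matrixP/(_ 0 j); rewrite !mxE => hx.
apply/matrixP => a b; rewrite !ord1 !mxE -[RHS]hx.
by apply: eq_bigr => k _; rewrite !mxE.
Qed.

End SpanOfForms.

Section SmoothPoint.
Variables (F : fieldType) (M : nat).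
Local Notation R := (mpoly M F).
Local Notation X := (fun i : 'I_M => mpolyX F (mnm1 i)).
Local Notation C := (@mpolyC M F).
Variables (I : R -> Prop) (v0 : 'I_M -> F).
Local Notation e := (meval v0).
Hypothesis pI : prime_ideal I.
Hypothesis I0 : forall p, I p -> e p = 0.

Let iI : is_ideal I. Proof. by case: pI. Qed.
Let x i : R := X i - C (v0 i).

Lemma taylor1 p : exists g : 'I_M -> R, p = C (e p) + \sum_j x j * g j.
Proof.
move: p; apply: mpoly_ring_ind => [c|i|p q [g hp] [h hq]|p q [g hp] [h hq]].
- by exists (fun=> 0); rewrite mevalC big1 ?addr0 // => j _; rewrite mulr0.
- exists (fun j => (j == i)%:R); rewrite mevalXU (bigD1 i) //= eqxx mulr1 big1.
    by rewrite /x addr0 addrC subrK.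
  by move=> j /negbTE ->; rewrite mulr0.
- exists (fun j => g j + h j); rewrite mevalD mpolyCD {1}hp {1}hq addrACA -big_split.
  by congr (_ + _); apply: eq_bigr => j _; rewrite mulrDr.
exists (fun j => g j * q + C (e p) * h j).
have -> : \sum_j x j * (g j * q + C (e p) * h j) =
    (\sum_j x j * g j) * q + C (e p) * (\sum_j x j * h j).
  rewrite mulr_suml mulr_sumr -big_split; apply: eq_bigr => j _ /=; ring.
have hq' : C (e q) = q - \sum_j x j * h j by rewrite {2}hq addrK.
move: (\sum_j x j * g j) (\sum_j x j * h j) hp hq' => P Q hp hq'.
rewrite mevalM mpolyCM hq' {1}hp; ring.
Qed.

Lemma taylor1_deriv p (g : 'I_M -> R) i : p = C (e p) + \sum_j x j * g j ->
  e (mderiv i p) = e (g i).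
Proof.
move=> ->; rewrite mderivD mderivC add0r.
have -> : mderiv i (\sum_j x j * g j) = \sum_j mderiv i (x j * g j) by apply: raddf_sum.
rewrite (raddf_sum (meval v0)) (bigD1 i) //= big1 => [|j ji].
  rewrite addr0 mderivM /x mderivB mderivC subr0 mderivX mevalD !mevalM mevalZ mevalB.
  rewrite mevalXU mevalC subrr mul0r addr0 mnm1E eqxx mul1r.
  have -> : mnm_sub (mnm1 i) (mnm1 i) = @mnm0 M by apply/mnmP => k; rewrite mnmBE subnn mnm0E.
  by rewrite mpolyX0 meval1 mul1r.
rewrite mderivM /x mderivB mderivC subr0 mderivX mevalD !mevalM mevalZ mevalB.
by rewrite mevalXU mevalC subrr !mul0r addr0 mnm1E (negbTE ji) !mul0r.
Qed.

Variable w0 : 'I_M -> F.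
Hypothesis tangent : forall w : 'I_M -> F,
  (forall p, I p -> \sum_i e (mderiv i p) * w i = 0) -> exists c, forall i, w i = c * w0 i.
Variable j0 : 'I_M.
Hypothesis wj0 : w0 j0 != 0.

Let u := x j0.

(** By [double_annihilator], a covector killing the tangent space is the differential of an element
    of [I]. This applies to [x i - C c * u] with [c = w0 i / w0 j0], and what is left has order two
    at [v0]. *)
Lemma cotangent_gen i : exists c p (g : 'I_M -> R),
  [/\ I p, forall j, e (g j) = 0 & x i - C c * u - p = \sum_j x j * g j].
Proof.
pose c := w0 i / w0 j0.
pose W (z : 'rV[F]_M) := exists2 p, I p & forall k, z 0 k = e (mderiv k p).
pose xi : 'rV[F]_M := \row_k ((k == i)%:R - c * (k == j0)%:R).
have [i0 iD iM] := iI.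
have [] : W xi.
  apply: double_annihilator.
  - by exists 0 => // k; rewrite mderiv0 meval0 mxE.
  - move=> a b [p hp ha] [q hq hb]; exists (p + q) => [|k]; first exact: iD.
    by rewrite mxE ha hb mderivD mevalD.
  - move=> d a [p hp ha]; exists (C d * p) => [|k]; first exact: iM.
    by rewrite mxE ha mul_mpolyC mderivZ mevalZ.
  move=> w hw; apply/matrixP => a b; rewrite !ord1 !mxE.
  have [|d hd] := tangent (w := fun k => w k 0).
    move=> p Ip; have /hw/matrixP/(_ 0 0) : W (\row_k e (mderiv k p)).
      by exists p => // k; rewrite mxE.
    by rewrite !mxE => hp0; rewrite -[RHS]hp0; apply: eq_bigr => k _; rewrite mxE.
  rewrite (eq_bigr (fun k => (k == i)%:R * w k 0 - c * ((k == j0)%:R * w k 0))); last first.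
    by move=> k _; rewrite mxE mulrBl mulrA.
  have hs k0 : \sum_k (k == k0)%:R * w k 0 = w k0 0.
    by rewrite (bigD1 k0) //= eqxx mul1r big1 ?addr0 // => k /negbTE ->; rewrite mul0r.
  rewrite sumrB -mulr_sumr !hs.
  by rewrite !hd mulrCA /c divfK ?subrr.
move=> p Ip hp; have [g hg] := taylor1 (x i - C c * u - p).
exists c, p, g; split=> // [j|].
  rewrite -(taylor1_deriv j hg) !mderivB mderiv_mulC /u /x !mderivB !mderivC !subr0.
  rewrite !mevalB mevalM mevalC !mderivX !mevalZ -hp mxE !mnm1E.
  rewrite [i == j]eq_sym [j0 == j]eq_sym.
  have hX k : (j == k)%:R * e (mpolyX F (mnm_sub (mnm1 k) (mnm1 j))) = (j == k)%:R.
    case: eqP => [->|_]; last by rewrite mul0r.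
    have -> : mnm_sub (mnm1 k) (mnm1 k) = @mnm0 M by apply/mnmP => l; rewrite mnmBE subnn mnm0E.
    by rewrite mpolyX0 meval1 mulr1.
  by rewrite !hX subrr.
rewrite {1}hg !mevalB mevalM /u /x !mevalB !mevalXU !mevalC !subrr mulr0 (I0 Ip) !subrr.
by rewrite mpolyC0 add0r.
Qed.

(** The determinant trick: the matrix [1 - g] is the identity at [v0], and its adjugate solves the
    relations of [cotangent_gen] for the [x i]. So [u] generates the maximal ideal of the local
    ring. *)
Lemma nakayama : exists2 q, e q = 1 & forall i, exists r, I (q * x i - r * u).
Proof.
have /choice[c /choice[p /choice[g hg]]] := cotangent_gen.
pose B : 'M[R]_M := 1%:M - \matrix_(i, j) g i j.
pose xv : 'cV[R]_M := \col_i x i.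
exists (\det B) => [|i].
  rewrite -det_map_mx; have -> : map_mx e B = 1%:M; last by rewrite det1.
  rewrite /B map_mxB map_mx1; apply/matrixP => i j; rewrite !mxE.
  rewrite [X in _ - X](_ : _ = 0) ?subr0 //.
  by have [_ hgi _] := hg i; apply: hgi.
exists (\sum_j (\adj B) i j * C (c j)).
have -> : \det B * x i - (\sum_j (\adj B) i j * C (c j)) * u =
   \sum_j (\adj B) i j * p j; last first.
  by apply: ideal_sum => // j _; have [_ _ iM] := iI; apply: iM; have [] := hg j.
have -> : \det B * x i = ((\det B)%:M *m xv) i 0.
  by rewrite mul_scalar_mx !mxE.
rewrite -mul_adj_mx -mulmxA mxE mulr_suml -sumrB; apply: eq_bigr => j _.
rewrite -mulrA -mulrBr; congr (_ * _).
rewrite /B mulmxBl mul1mx !mxE; have [_ _ hj] := hg j.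
have -> : \sum_k (\matrix_(i1, j1) g i1 j1) j k * xv k 0 = \sum_k x k * g j k.
  by apply: eq_bigr => k _; rewrite !mxE mulrC.
rewrite -hj; ring.
Qed.

(* [p] is divisible by [u ^ N] in the local ring of the curve at [v0]. *)
Definition ord_ge N p := exists q r, e q != 0 /\ I (q * p - r * u ^+ N).

Lemma ord_ge0 p : ord_ge 0 p.
Proof. by exists 1, p; rewrite meval1 oner_neq0 mul1r mulr1 subrr; split=> //; case: iI. Qed.

Lemma ord_geD N p p' : ord_ge N p -> ord_ge N p' -> ord_ge N (p + p').
Proof.
move=> [q [r [q0 h]]] [q' [r' [q'0 h']]]; exists (q * q'), (q' * r + q * r').
rewrite mevalM mulf_neq0 //; split=> //.
have -> : q * q' * (p + p') - (q' * r + q * r') * u ^+ N =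
   q' * (q * p - r * u ^+ N) + q * (q' * p' - r' * u ^+ N) by ring.
by have [_ iD iM] := iI; apply: iD; apply: iM.
Qed.
Lemma ord_geMl N s p : ord_ge N p -> ord_ge N (s * p).
Proof.
move=> [q [r [q0 h]]]; exists q, (s * r); split=> //.
have -> : q * (s * p) - s * r * u ^+ N = s * (q * p - r * u ^+ N) by ring.
by have [_ _ iM] := iI; apply: iM.
Qed.
Lemma ord_geN N p : ord_ge N p -> ord_ge N (- p).
Proof. by rewrite -mulN1r; apply: ord_geMl. Qed.
Lemma ord_geB N p p' : ord_ge N p -> ord_ge N p' -> ord_ge N (p - p').
Proof. by move=> h /ord_geN; apply: ord_geD. Qed.
Lemma ord_ge_u N s : ord_ge N (u ^+ N * s).
Proof.
exists 1, s; rewrite meval1 oner_neq0 mul1r mulrC subrr; split=> //; by case: iI.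
Qed.
Lemma ord_ge_I N p : I p -> ord_ge N p.
Proof.
move=> Ip; exists 1, 0; rewrite meval1 oner_neq0 mul1r mul0r subr0; by split.
Qed.

Lemma ord_ge1 p : e p = 0 -> ord_ge 1 p.
Proof.
move=> p0; have [q q1 /choice[r hr]] := nakayama.
have [g ->] := taylor1 p; rewrite p0 mpolyC0 add0r.
exists q, (\sum_j r j * g j); rewrite q1 oner_neq0; split=> //.
rewrite mulr_sumr mulr_suml -sumrB; apply: ideal_sum => // j _.
have -> : q * (x j * g j) - r j * g j * u ^+ 1 = (q * x j - r j * u) * g j by ring.
exact: idealMr.
Qed.

Lemma eval_u : e u = 0. Proof. by rewrite /u /x mevalB mevalXU mevalC subrr. Qed.

Hypothesis not_point : exists2 p, e p = 0 & ~ I p.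

Lemma prime_cancel q p : e q != 0 -> I (q * p) -> I p.
Proof. by move=> q0; have [_ _ h] := pI => /h[/I0 /eqP|//]; rewrite (negbTE q0). Qed.

Lemma u_notin : ~ I u.
Proof.
move=> Iu; have [q q1 hr] := nakayama; have [p p0] := not_point; apply.
have Ix j : I (x j).
  apply: (@prime_cancel q); first by rewrite q1 oner_neq0.
  have [r] := hr j => h; rewrite -(subrK (r * u) (q * x j)).
  by have [_ iD iM] := iI; apply: iD => //; apply: iM.
have [g ->] := taylor1 p; rewrite p0 mpolyC0 add0r.
by apply: ideal_sum => // j _; apply: idealMr.
Qed.

Lemma un_cancel N p : I (u ^+ N * p) -> I p.
Proof.
elim: N p => [|N IH] p; first by rewrite mul1r.
rewrite exprS -mulrA; have [_ _ h] := pI => /h[/u_notin //|]; exact: IH.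
Qed.

Lemma ord_geS N p q r : e q != 0 -> I (q * p - r * u ^+ N) -> ord_ge N.+1 p -> e r = 0.
Proof.
move=> q0 h [q' [r' [q'0 h']]].
have : I (u ^+ N * (q' * r - q * r' * u)).
  have -> : u ^+ N * (q' * r - q * r' * u) =
     q * (q' * p - r' * u ^+ N.+1) - q' * (q * p - r * u ^+ N) by rewrite exprS; ring.
  by have [_ _ iM] := iI; apply: idealB => //; apply: iM.
move/un_cancel/I0; rewrite mevalB !mevalM eval_u mulr0 subr0 => /eqP.
by rewrite mulf_eq0 (negbTE q'0) => /eqP.
Qed.

(** Krull's theorem with explicit denominators. If [q_N p = r_N u^N] modulo [I], then [r_i] is
    locally a multiple of [u r_K] for [i < K]. Once [r_K] lies in the ideal of its predecessors, it
    is locally a multiple of [u r_K], hence zero. *)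
Lemma krull_intersection p : (forall N, ord_ge N p) -> I p.
Proof.
move=> /choice[q /choice[r hqr]].
have [K hK] := @mpoly_noetherian F M r.
have [qK hpK] := hqr K; have [i0 iD iM] := iI.
have [||y hy] := hK (fun z => exists y, I (q K * z - y * (u * r K))).
- split=> [|a b [y hy] [z hz]|s a [y hy]].
  + by exists 0; rewrite mulr0 mul0r subrr.
  + exists (y + z); rewrite mulrDr mulrDl opprD addrACA; exact: iD.
  + exists (s * y); have -> : q K * (s * a) - s * y * (u * r K) =
      s * (q K * a - y * (u * r K)) by ring.
    exact: iM.
- move=> _ [i iK ->]; have [_ hpi] := hqr i; exists (q i * u ^+ (K - i).-1).
  apply: (@un_cancel i).
  have -> : u ^+ i * (q K * r i - q i * u ^+ (K - i).-1 * (u * r K)) =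
     q i * (q K * p - r K * u ^+ K) - q K * (q i * p - r i * u ^+ i).
    have -> : u ^+ K = u ^+ i * (u * u ^+ (K - i).-1).
      by rewrite -exprS -exprD; congr (_ ^+ _); lia.
    ring.
  by apply: idealB => //; apply: iM.
apply: (@prime_cancel (q K)) => //; rewrite -(subrK (r K * u ^+ K) (q K * p)).
apply: iD => //; apply: idealMr => //; apply: (@prime_cancel (q K - y * u)).
  by rewrite mevalB mevalM eval_u mulr0 subr0.
have -> : (q K - y * u) * r K = q K * r K - y * (u * r K) by ring.
by [].
Qed.

(** The order is finite by [krull_intersection]; were the cofactor [r] zero at [v0], [ord_ge1] would
    extract one more factor [u]. *)
Lemma ord_exact p : ~ I p ->
  exists N q r, [/\ e q != 0, e r != 0 & I (q * p - r * u ^+ N)].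
Proof.
move=> np; have : exists N, `[< ~ ord_ge N p >].
  apply: contrapT => h; apply: np; apply: krull_intersection => N.
  by apply: contrapT => hN; apply: h; exists N; apply/asboolP.
case/ex_minnP => -[/asboolP /(_ (ord_ge0 p)) //|N /asboolP hN minN].
have [q [r [q0 h]]] : ord_ge N p.
  apply: contrapT => h; have := minN N; rewrite ltnn => hh.
  by have : false by apply: hh; apply/asboolP.
exists N, q, r; split=> //; apply/eqP => r0; apply: hN.
have [q' [r' [q'0 h']]] := ord_ge1 r0.
exists (q' * q), r'; rewrite mevalM mulf_neq0 //; split=> //.
have -> : q' * q * p - r' * u ^+ N.+1 =
   q' * (q * p - r * u ^+ N) + u ^+ N * (q' * r - r' * u ^+ 1) by rewrite exprS; ring.
by have [_ iD iM] := iI; apply: iD; apply: iM.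
Qed.

(* Every rational function on a smooth curve has a value in the projective line at the point. *)
Theorem smooth_ratio A B : ~ I A -> ~ I B ->
  exists A' B', I (A * B' - A' * B) /\ (e A' != 0 \/ e B' != 0).
Proof.
move=> /ord_exact[N [q [r [q0 r0 h]]]] /ord_exact[N' [q' [r' [q'0 r'0 h']]]].
have [i0 iD iM] := iI.
case: (leqP N N') => hN.
  exists (r * q'), (q * r' * u ^+ (N' - N)); split; last by left; rewrite mevalM mulf_neq0.
  have -> : A * (q * r' * u ^+ (N' - N)) - r * q' * B =
     r' * u ^+ (N' - N) * (q * A - r * u ^+ N) - r * (q' * B - r' * u ^+ N').
    have -> : u ^+ N' = u ^+ N * u ^+ (N' - N) by rewrite -exprD subnKC.
    ring.
  by apply: idealB => //; apply: iM.
exists (r * q' * u ^+ (N - N')), (q * r'); split; last by right; rewrite mevalM mulf_neq0.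
have -> : A * (q * r') - r * q' * u ^+ (N - N') * B =
   r' * (q * A - r * u ^+ N) - r * u ^+ (N - N') * (q' * B - r' * u ^+ N').
  have -> : u ^+ N = u ^+ N' * u ^+ (N - N') by rewrite -exprD subnKC // ltnW.
  ring.
by apply: idealB => //; apply: iM.
Qed.

Let E : {rmorphism {poly F} -> R} := horner_eval u \o map_poly C.

(** [f] is the Taylor series of [p] in the uniformizer [u]. *)
Definition expansion p (f : fps F) := forall N, ord_ge N (p - E (ftrunc N f)).

Lemma E_X : E 'X = u. Proof. by rewrite /= /horner_eval map_polyX hornerX. Qed.
Lemma E_C c : E c%:P = C c. Proof. by rewrite /= /horner_eval map_polyC hornerC. Qed.
Lemma E_ord N (P : {poly F}) : (forall i, (i < N)%N -> P`_i = 0) -> ord_ge N (E P).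
Proof.
move=> hP; have -> : P = 'X^N * (\poly_(i < size P) P`_(i + N)%N).
  apply/polyP => i; rewrite coefXnM; case: ltnP => hi; first exact: hP.
  rewrite coef_poly subnK //; case: ltnP => // h.
  by rewrite nth_default // (leq_trans h) // leq_subr.
by rewrite rmorphM rmorphXn E_X; apply: ord_ge_u.
Qed.

Lemma expansionC c : expansion (C c) (fpsC c).
Proof.
move=> N; rewrite -E_C -rmorphB; apply: E_ord => i hi.
by rewrite coefB coefC coef_ftrunc //; case: i {hi} => [|i]; rewrite /= subrr.
Qed.
Lemma expansionD p q f g : expansion p f -> expansion q g -> expansion (p + q) (f + g).
Proof.
move=> hp hq N; have := ord_geD (hp N) (hq N).
rewrite addrACA -opprD -rmorphD; congr (ord_ge N (_ - E _)).
by apply/polyP => i; rewrite coefD !coef_poly; case: ifP; rewrite ?addr0.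
Qed.
Lemma expansionM p q f g : expansion p f -> expansion q g -> expansion (p * q) (f * g).
Proof.
move=> hp hq N.
have -> : p * q - E (ftrunc N (f * g)) = (p - E (ftrunc N f)) * q +
   (E (ftrunc N f) * (q - E (ftrunc N g)) + E (ftrunc N f * ftrunc N g - ftrunc N (f * g))).
  rewrite rmorphB rmorphM; ring.
apply: ord_geD; first by rewrite mulrC; apply: ord_geMl.
apply: ord_geD; first by apply: ord_geMl.
by apply: E_ord => i hi; rewrite coefB coef_ftrunc // -fpsM_trunc // subrr.
Qed.

(** The remainder of order [N] is locally [s / q] times [u ^+ N], and the value [e s / e q] at the
    point is the next coefficient. *)
Lemma expansion_exists p : exists f, expansion p f.
Proof.
have /choice[c hc] : forall Np, exists c : F, ord_ge Np.1 Np.2 ->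
    ord_ge Np.1.+1 (Np.2 - C c * u ^+ Np.1).
  case=> N r /=; have [[q [s [q0 h]]]|] := pselect (ord_ge N r); last by exists 0.
  exists (e s / e q) => _; set d := _ / _.
  have /ord_ge1[q' [r' [q'0 h']]] : e (s - C d * q) = 0.
    by rewrite mevalB mevalM mevalC /d divfK ?subrr.
  exists (q' * q), r'; rewrite mevalM mulf_neq0 //; split=> //.
  have -> : q' * q * (r - C d * u ^+ N) - r' * u ^+ N.+1 =
    q' * (q * r - s * u ^+ N) + u ^+ N * (q' * (s - C d * q) - r' * u ^+ 1).
    rewrite exprS; ring.
  by have [_ iD iM] := iI; apply: iD; apply: iM.
pose rem := fix rem N := if N is k.+1 then rem k - C (c (k, rem k)) * u ^+ k else p.
have hrem N : ord_ge N (rem N) by elim: N => [|N IH]; [exact: ord_ge0|apply: (hc (N, rem N))].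
exists (Fps (fun N => c (N, rem N))) => N; set f := Fps _.
suff -> : p - E (ftrunc N f) = rem N by [].
elim: N => [|N IH]; first by rewrite /ftrunc poly_def big_ord0 rmorph0 subr0.
have -> : rem N.+1 = rem N - C (f N) * u ^+ N by [].
rewrite -IH -addrA -opprD -E_C -E_X -rmorphXn -rmorphM -rmorphD; congr (_ - E _).
rewrite /ftrunc !poly_def big_ord_recr /=; congr (_ + _).
by rewrite mul_polyC.
Qed.

(** One direction is [krull_intersection]; in the other, the lowest remaining coefficient is killed
    by [ord_geS]. *)
Lemma expansion0 p f : expansion p f -> f = 0 <-> I p.
Proof.
move=> hf; split=> [f0|Ip].
  apply: krull_intersection => N; have := hf N.
  have -> : ftrunc N f = 0 by apply/polyP => i; rewrite f0 coef_poly coef0; case: ifP.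
  by rewrite rmorph0 subr0.
apply: fpsP; elim/ltn_ind => N IH.
have h : ord_ge N.+1 (E (ftrunc N.+1 f)).
  by rewrite -(subKr p (E _)); apply: ord_geB; [apply: ord_ge_I|apply: hf].
have fE : E (ftrunc N.+1 f) = C (f N) * u ^+ N.
  rewrite -E_C -E_X -rmorphXn -rmorphM mul_polyC; congr (E _); apply/polyP => i.
  rewrite coef_poly coefZ coefXn ltnS leq_eqVlt.
  case: eqP => [->|_] /=; first by rewrite mulr1.
  by rewrite mulr0; case: ifP => // /IH ->.
rewrite fE in h; have := ord_geS (q := 1) (r := C (f N)) _ _ h.
by rewrite meval1 oner_neq0 mevalC mul1r subrr; apply=> //; case: iI.
Qed.

Lemma expansion_const p f : expansion p f -> fconst f = e p.
Proof.
move=> h; have [q [r [q0 /I0]]] := h 1%N.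
rewrite mevalB !mevalM eval_u mulr0 subr0 => /eqP.
rewrite mulf_eq0 (negbTE q0) orFb mevalB subr_eq0 => /eqP ->.
have -> : ftrunc 1 f = (fconst f)%:P.
  by apply/polyP => -[|i]; rewrite coef_poly coefC.
by rewrite E_C mevalC.
Qed.

Theorem smooth_branch : exists g : 'I_M -> fps F, (forall i, fconst (g i) = v0 i) /\
  forall p, mmap (@fpsC F) g p = 0 <-> I p.
Proof.
have /choice[g hg] : forall i, exists f, expansion (X i) f by move=> i; apply: expansion_exists.
exists g; split=> [i|p]; first by rewrite (expansion_const (hg i)) mevalXU.
apply: expansion0; move: p; apply: mpoly_ring_ind => [c|i|p q hp hq|p q hp hq].
- by rewrite mmapC; apply: expansionC.
- by rewrite mmapX mmap1U.
- by rewrite rmorphD; exact: (expansionD hp hq).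
- by rewrite rmorphM; exact: (expansionM hp hq).
Qed.

End SmoothPoint.

(** * Projective curves *)

Section Homogeneous.
Variable F : fieldType.

Section Evaluation.
Variables (M : nat) (K : comNzRingType) (iota : {rmorphism F -> K}).
Implicit Types (p q : mpoly M F) (w : 'I_M -> K).

Lemma eq_mmap w w' p : w =1 w' -> mmap iota w p = mmap iota w' p.
Proof. by move=> h; apply: eq_bigr => m _; rewrite (mmap1_eq m h). Qed.

Lemma mmap1_scale (c : K) w (m : multinom M) :
  mmap1 (fun i => c * w i) m = c ^+ mdeg m * mmap1 w m.
Proof.
rewrite /mmap1 mdegE -prodrXr -big_split; apply: eq_bigr => i _.
by rewrite exprMn.
Qed.

Lemma homogeneous_mmap d (c : K) w p : homogeneous d p ->
  mmap iota (fun i => c * w i) p = c ^+ d * mmap iota w p.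
Proof.
move=> /dhomogP hp; rewrite /mmap mulr_sumr [LHS]big_seq [RHS]big_seq.
apply: eq_bigr => m /hp md; rewrite mmap1_scale md mulrCA; congr (_ * (_ * _)).
Qed.

Lemma mmap_mpolyX w i : mmap iota w (mpolyX F (mnm1 i)) = w i.
Proof. by rewrite mmapX mmap1U. Qed.

End Evaluation.

Lemma homogeneousP M d (p : mpoly M F) (m : multinom M) :
  homogeneous d p -> m \in msupp p -> (\sum_i m i)%N = d.
Proof. by move=> /dhomogP h /h <-; symmetry; apply: mdegE. Qed.

Lemma homogeneousX M i : homogeneous 1 (mpolyX F (@mnm1 M i)).
Proof. by rewrite /homogeneous dhomogX; apply/eqP; apply: mdeg1. Qed.
Lemma homogeneousM M d d' (p q : mpoly M F) :
  homogeneous d p -> homogeneous d' q -> homogeneous (d + d') (p * q).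
Proof. exact: dhomogM. Qed.
Lemma homogeneousD M d (p q : mpoly M F) :
  homogeneous d p -> homogeneous d q -> homogeneous d (p + q).
Proof. exact: dhomogD. Qed.
Lemma homogeneousN M d (p : mpoly M F) : homogeneous d p -> homogeneous d (- p).
Proof. by rewrite /homogeneous => h; rewrite rpredN. Qed.
Lemma homogeneousB M d (p q : mpoly M F) :
  homogeneous d p -> homogeneous d q -> homogeneous d (p - q).
Proof. by move=> hp hq; apply: homogeneousD => //; apply: homogeneousN. Qed.
Lemma homogeneousXn M d k (p : mpoly M F) : homogeneous d p -> homogeneous (d * k) (p ^+ k).
Proof. exact: dhomogMn. Qed.
Lemma homogeneous1 M : homogeneous 0 (1 : mpoly M F). Proof. exact: dhomog1. Qed.
Lemma homogeneous0 M d : homogeneous d (0 : mpoly M F). Proof. exact: dhomog0. Qed.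
Lemma homogeneous_prod M (I : Type) (r : seq I) (P : pred I) (d : I -> nat) (G : I -> mpoly M F) :
  (forall i, homogeneous (d i) (G i)) ->
  homogeneous (\sum_(i <- r | P i) d i)%N (\prod_(i <- r | P i) G i).
Proof.
move=> h; apply: (big_ind2 (fun k p => homogeneous k p)) => //; first exact: homogeneous1.
by move=> k p l q; apply: homogeneousM.
Qed.
Lemma homogeneous_sum M (I : Type) (r : seq I) (P : pred I) d (G : I -> mpoly M F) :
  (forall i, P i -> homogeneous d (G i)) -> homogeneous d (\sum_(i <- r | P i) G i).
Proof.
move=> h; apply: (big_ind (homogeneous d)) => //; first exact: homogeneous0.
exact: homogeneousD.
Qed.

(* For [p] of degree at most [D], the polynomial [y0 ^ D * p (y / y0)]. *)
Definition homog_subst M n (y0 : mpoly M F) (y : 'I_n -> mpoly M F) D (p : mpoly n F) : mpoly M F :=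
  \sum_(m <- msupp p) mcoeff m p *: (y0 ^+ (D - mdeg m) * mmap1 y m).

Lemma homog_subst_homogeneous M n d y0 (y : 'I_n -> mpoly M F) D p :
  homogeneous d y0 -> (forall i, homogeneous d (y i)) -> (msize p <= D.+1)%N ->
  homogeneous (d * D) (homog_subst y0 y D p).
Proof.
move=> h0 hy sp; rewrite /homog_subst big_seq; apply: homogeneous_sum => m mp.
apply: dhomogZ; have mD : (mdeg m <= D)%N.
  by rewrite -ltnS; apply: leq_trans sp; apply: msize_mdeg_lt.
rewrite -(subnK mD) mulnDr addnK; apply: homogeneousM; first exact: homogeneousXn.
rewrite mdegE big_distrr /=; apply: homogeneous_prod => i; exact: homogeneousXn.
Qed.

Lemma homog_subst_mmap M n (K : fieldType) (iota : {rmorphism F -> K}) (w : 'I_M -> K)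
    y0 (y : 'I_n -> mpoly M F) D (p : mpoly n F) :
  mmap iota w y0 != 0 -> (msize p <= D.+1)%N ->
  mmap iota w (homog_subst y0 y D p) =
    mmap iota w y0 ^+ D * mmap iota (fun i => mmap iota w (y i) / mmap iota w y0) p.
Proof.
move=> a0 sp; set a := mmap iota w y0 in a0 *.
rewrite /homog_subst raddf_sum /= [in RHS]/mmap mulr_sumr [LHS]big_seq [RHS]big_seq.
apply: eq_bigr => m mp; have mD : (mdeg m <= D)%N.
  by rewrite -ltnS; apply: leq_trans sp; apply: msize_mdeg_lt.
rewrite mmapZ rmorphM rmorphXn /= -/a [RHS]mulrCA; congr (_ * _).
rewrite -[in RHS](subnK mD) exprD -mulrA; congr (_ * _).
rewrite -mmap1_scale /mmap1 rmorph_prod; apply: eq_bigr => i _.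
by rewrite rmorphXn /= mulrC divfK.
Qed.

Lemma comp_homogeneous M n d d' (q : mpoly n F) (G : 'I_n -> mpoly M F) :
  homogeneous d' q -> (forall i, homogeneous d (G i)) ->
  homogeneous (d * d') (mmap (@mpolyC M F) G q).
Proof.
move=> hq hG; rewrite /mmap big_seq; apply: homogeneous_sum => m /(homogeneousP hq) <-.
rewrite mul_mpolyC; apply: dhomogZ; rewrite big_distrr /=.
by apply: homogeneous_prod => i; apply: homogeneousXn.
Qed.

Lemma mmap_comp M n (K : comNzRingType) (iota : {rmorphism F -> K}) (w : 'I_M -> K)
    (q : mpoly n F) (G : 'I_n -> mpoly M F) :
  mmap iota w (mmap (@mpolyC M F) G q) = mmap iota (fun i => mmap iota w (G i)) q.
Proof.
move: q; apply: mpoly_ring_ind => [c|i|p q hp hq|p q hp hq].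
- by rewrite !mmapC.
- by rewrite !mmap_mpolyX.
- by rewrite !rmorphD /= hp hq.
- by rewrite !rmorphM /= hp hq.
Qed.

(** Euler's identity, which puts the coordinates of a point into the tangent space of the cone
    there. *)
Lemma euler M d (p : mpoly M F) (v : 'I_M -> F) : homogeneous d p ->
  \sum_i meval v (mderiv i p) * v i = d%:R * meval v p.
Proof.
move=> hp; rewrite (mpolyE p) raddf_sum /= mulr_sumr.
under eq_bigr => i _ do rewrite (raddf_sum (mderiv i)) raddf_sum /= mulr_suml.
rewrite exchange_big /= [LHS]big_seq [RHS]big_seq; apply: eq_bigr => m /(homogeneousP hp) md.
rewrite mevalZ mulrCA.
under eq_bigr => i _ do rewrite mderivZ mevalZ -mulrA.
rewrite -mulr_sumr; congr (_ * _); rewrite -md natr_sum mulr_suml.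
apply: eq_bigr => i _; rewrite mderivX mevalZ.
case: (posnP (m i)) => [->|mi]; first by rewrite !mul0r.
rewrite -mulrA; congr (_ * _); rewrite -{1}(mevalXU v i) -mevalM -mpolyXD submK //.
by rewrite lep1mP -lt0n.
Qed.

End Homogeneous.

(** * Points, closed sets and forms in projective space *)

Section ProjectiveSpace.
Variables (F : fieldType) (m : nat).
Implicit Types (x y : ppoint F m) (v w : 'rV[F]_m.+1) (p q : mpoly m.+1 F).

Lemma hcoords_exists x : exists v, hcoords x v.
Proof.
case: x => L dL; exists (vpick L); split; last exact: memv_pick.
by rewrite vpick0 -dimv_eq0 (eqP dL).
Qed.

Lemma hcoords_line x v : hcoords x v -> val x = <[v]>%VS.
Proof.
case: x => L dL [v0 /= vL]; apply/esym/eqP; rewrite eqEdim (eqP dL) dim_vline v0 andbT.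
by rewrite -memvE.
Qed.

Lemma hcoords_inj x y v : hcoords x v -> hcoords y v -> x = y.
Proof. by move=> /hcoords_line hx /hcoords_line hy; apply: val_inj; rewrite hx hy. Qed.

Lemma hcoords_prop x v w : hcoords x v -> hcoords x w -> exists2 c, c != 0 & w = c *: v.
Proof.
move=> hv [w0 wx]; move: wx; rewrite (hcoords_line hv) => /vlineP[c wE].
by exists c => //; apply: contraNneq w0 => c0; rewrite wE c0 scale0r.
Qed.

Lemma hcoordsZ x v c : c != 0 -> hcoords x v -> hcoords x (c *: v).
Proof. by move=> c0 [v0 vx]; split; [rewrite scaler_eq0 negb_or c0|apply: memvZ]. Qed.

Lemma hcoords_point v : v != 0 -> exists x, hcoords x v.
Proof.
move=> v0; have d1 : \dim <[v]>%VS == 1%N by rewrite dim_vline v0.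
by exists (exist _ <[v]>%VS d1); split=> //=; apply: memv_line.
Qed.

Lemma proportional v w : v != 0 -> w != 0 ->
  (forall i j, v 0 i * w 0 j = v 0 j * w 0 i) -> exists2 c, c != 0 & w = c *: v.
Proof.
move=> v0 w0 h; have [i vi] : exists i, v 0 i != 0.
  by apply: contrapT => hn; case/eqP: v0; apply/rowP => i; rewrite mxE;
     apply/eqP; apply: contrapT => /negP vi; apply: hn; exists i.
have wE : w = (w 0 i / v 0 i) *: v.
  apply/rowP => j; rewrite mxE; apply: (mulfI vi).
  by rewrite h mulrA [v 0 i * _]mulrC divfK // mulrC.
by exists (w 0 i / v 0 i) => //; apply: contraNneq w0 => e; rewrite wE e scale0r.
Qed.

Lemma poly_evalZ d p c v : homogeneous d p -> poly_eval p (c *: v) = c ^+ d * poly_eval p v.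
Proof.
move=> hp; rewrite /poly_eval -(homogeneous_mmap idfun c (fun i => v 0 i) hp).
by apply: meval_eq => i; rewrite mxE.
Qed.

Lemma pzeroP d p x v : homogeneous d p -> hcoords x v -> pzero p x <-> poly_eval p v = 0.
Proof.
move=> hp hv; split=> [|pv w hw]; first exact.
by have [c _ ->] := hcoords_prop hv hw; rewrite (poly_evalZ _ _ hp) pv mulr0.
Qed.

Lemma pzero_closed d p : homogeneous d p -> proj_closed (pzero p).
Proof.
move=> hp; exists [set p]%classic; split=> [_ ->|]; first by exists d.
by rewrite bigcap_set1.
Qed.

Lemma proj_closedP (Z : set (ppoint F m)) : proj_closed Z ->
  forall x, ~ Z x -> exists d p, [/\ homogeneous d p, Z `<=` pzero p & ~ pzero p x].
Proof.
move=> [S [hS ->]] x nx; apply: contrapT => h; apply: nx => p Sp.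
have [d hd] := hS p Sp; apply: contrapT => np; apply: h; exists d, p; split=> //.
by move=> y; apply.
Qed.

Section IrreducibleSet.
Variable X : set (ppoint F m).
Hypothesis irrX : irreducible_closed (@proj_closed F m) X.

Definition vanishes p := X `<=` pzero p.

Lemma vanishes_mul d d' p q : homogeneous d p -> homogeneous d' q ->
  vanishes (p * q) -> vanishes p \/ vanishes q.
Proof.
move=> hp hq h; have [_ _ irr] := irrX.
apply: irr; [exact: pzero_closed hp|exact: pzero_closed hq|].
move=> x Xx; have [v hv] := hcoords_exists x.
have := h x Xx v hv; rewrite /poly_eval mevalM => /eqP; rewrite mulf_eq0.
by case/orP => /eqP e; [left; rewrite (pzeroP hp hv)|right; rewrite (pzeroP hq hv)].
Qed.

Lemma vanishes_mulN d d' p q : homogeneous d p -> homogeneous d' q ->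
  ~ vanishes p -> ~ vanishes q -> ~ vanishes (p * q).
Proof. by move=> hp hq np nq /(vanishes_mul hp hq)[]. Qed.

Lemma vanishesN_ex p : ~ vanishes p ->
  exists x v, [/\ X x, hcoords x v & poly_eval p v != 0].
Proof.
move=> np; apply: contrapT => h; apply: np => x Xx v hv; apply/eqP.
by apply: contrapT => /negP nv; apply: h; exists x, v.
Qed.

(** A nonempty open part of an irreducible set is dense. Identities on the model are checked where
    an auxiliary form [p] is nonzero and then extended in this way. *)
Lemma vanishes_dense d d' p q : homogeneous d p -> homogeneous d' q -> ~ vanishes p ->
  (forall x v, X x -> hcoords x v -> poly_eval p v != 0 -> poly_eval q v = 0) -> vanishes q.
Proof.
move=> hp hq np h; case: (@vanishes_mul d d' p q hp hq) => // x Xx v hv.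
rewrite /poly_eval mevalM; apply/eqP; rewrite mulf_eq0.
by case: eqVneq => //= pv; apply/eqP; apply: h hv pv.
Qed.

Lemma eval_vanishesN x v p : X x -> hcoords x v -> poly_eval p v != 0 -> ~ vanishes p.
Proof. by move=> Xx hv pv h; move: pv; rewrite (h x Xx v hv) eqxx. Qed.

End IrreducibleSet.

(** * A smooth projective curve in an affine chart *)

Section SmoothCurve.
Variable X : set (ppoint F m).
Hypothesis smX : smooth_curve X.
Variables (x : ppoint F m) (v0 : 'rV[F]_m.+1) (i0 : 'I_m.+1).
Hypotheses (Xx : X x) (hv0 : hcoords x v0) (v0i0 : v0 0 i0 = 1).

Let irrX : irreducible_closed (@proj_closed F m) X. Proof. by case: smX => -[]. Qed.
Local Notation Xi := (fun i : 'I_m.+1 => mpolyX F (mnm1 i)).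

(** The chart keeps all [m.+1] coordinates, so its ideal contains the polynomial [X_i0 - 1], and
    forms are evaluated there without being dehomogenized. *)
Definition chart_vanishes p :=
  forall y v, X y -> hcoords y v -> v 0 i0 = 1 -> poly_eval p v = 0.

Definition chart_homog D p := homog_subst (Xi i0) Xi D p.

Lemma chart_homog_homogeneous D p : (msize p <= D.+1)%N -> homogeneous D (chart_homog D p).
Proof.
move=> h; have := @homog_subst_homogeneous F m.+1 m.+1 1 (Xi i0) Xi D p (homogeneousX _ _).
by rewrite mul1n; apply=> // i; apply: homogeneousX.
Qed.

Lemma chart_homog_eval D p v : (msize p <= D.+1)%N -> v 0 i0 = 1 ->
  poly_eval (chart_homog D p) v = poly_eval p v.
Proof.
move=> h v1; have e : mmap idfun (fun i => v 0 i) (Xi i0) = 1 by rewrite mmap_mpolyX.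
rewrite /poly_eval [LHS](homog_subst_mmap (iota := idfun)) ?e ?oner_neq0 //.
by rewrite expr1n mul1r; apply: eq_mmap => i; rewrite mmap_mpolyX divr1.
Qed.

Lemma chart_vanishesP d p : homogeneous d p -> chart_vanishes p <-> vanishes X p.
Proof.
move=> hp; split=> [h|h y v Xy hv _]; last exact: h hv.
apply: (vanishes_dense irrX (homogeneousX F i0) hp).
  by apply: (eval_vanishesN Xx hv0); rewrite /poly_eval mevalXU v0i0 oner_neq0.
move=> y v Xy hv; rewrite /poly_eval mevalXU => vi0.
have hw := hcoordsZ (invr_neq0 vi0) hv.
have := h y _ Xy hw; rewrite mxE mulVf // (poly_evalZ _ _ hp) => /(_ erefl)/eqP.
by rewrite mulf_eq0 expf_eq0 invr_eq0 (negbTE vi0) andbF => /eqP.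
Qed.

Lemma chart_vanishes_homog D p : (msize p <= D.+1)%N ->
  chart_vanishes p <-> vanishes X (chart_homog D p).
Proof.
move=> sp; rewrite -(chart_vanishesP (chart_homog_homogeneous sp)).
by split=> h y v Xy hv v1; move: (h y v Xy hv v1); rewrite chart_homog_eval.
Qed.

Lemma chart_vanishes_ideal : is_ideal chart_vanishes.
Proof.
split=> [y v *|a b ha hb y v Xy hv v1|r a ha y v Xy hv v1]; first by rewrite /poly_eval meval0.
  by rewrite /poly_eval mevalD [meval _ a](ha y v) // [meval _ b](hb y v) // addr0.
by rewrite /poly_eval mevalM [meval _ a](ha y v) // mulr0.
Qed.

Lemma chart_vanishes_prime : prime_ideal chart_vanishes.
Proof.
split=> [|h|a b hab]; first exact: chart_vanishes_ideal.
  by have := h x v0 Xx hv0 v0i0; rewrite /poly_eval meval1 => /eqP; rewrite oner_eq0.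
have sa : (msize a <= (msize a).+1)%N by []; have sb : (msize b <= (msize b).+1)%N by [].
rewrite (chart_vanishes_homog sa) (chart_vanishes_homog sb).
apply: (vanishes_mul irrX (chart_homog_homogeneous sa) (chart_homog_homogeneous sb)).
apply/(chart_vanishesP (homogeneousM (chart_homog_homogeneous sa) (chart_homog_homogeneous sb))).
move=> y v Xy hv v1; rewrite /poly_eval mevalM.
rewrite [meval _ _](chart_homog_eval sa v1) [meval _ (chart_homog _ b)](chart_homog_eval sb v1).
by have := hab y v Xy hv v1; rewrite /poly_eval mevalM.
Qed.

(** A curve has a nonempty proper closed subset, hence a second point, and a linear form vanishing
    at [v0] does not vanish there. *)
Lemma chart_not_point : exists2 p, meval (fun i => v0 0 i) p = 0 & ~ chart_vanishes p.
Proof.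
have [[_ [Y [_ [y Yy] _] YX] _] _] := smX.
have [x' Xx' xx'] : exists2 x', X x' & x' <> x.
  have [e|ne] := pselect (y = x); last by exists y => //; case: YX => + _; apply.
  case: YX => YX /existsNP[x' /not_implyP[Xx' Yx']].
  by exists x' => // e'; apply: Yx'; rewrite e' -e.
have [v' hv'] := hcoords_exists x'.
have [j hj] : exists j, v' 0 j != v0 0 j * v' 0 i0.
  apply: contrapT => h; apply: xx'; have v'E : v' = v' 0 i0 *: v0.
    apply/rowP => j; rewrite mxE mulrC; apply/eqP; apply: contrapT => /negP hj.
    by apply: h; exists j.
  have c0 : v' 0 i0 != 0.
    by case: hv' => v'0 _; apply: contraNneq v'0 => e; rewrite v'E e scale0r.
  apply: hcoords_inj hv' _; rewrite v'E; exact: hcoordsZ.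
have hp : homogeneous 1 (Xi j - mpolyC _ (v0 0 j) * Xi i0).
  apply: homogeneousB; first exact: homogeneousX.
  by rewrite mul_mpolyC; apply: dhomogZ; apply: homogeneousX.
exists (Xi j - mpolyC _ (v0 0 j) * Xi i0).
  by rewrite mevalB mevalM mevalC !mevalXU v0i0 mulr1 subrr.
move/(chart_vanishesP hp) => /(_ _ Xx' _ hv'); rewrite /poly_eval mevalB mevalM mevalC !mevalXU.
by move/eqP; rewrite subr_eq0 (negbTE hj).
Qed.

(** The tangent plane of the cone contains [v0] by Euler's identity; the equation [X_i0 = 1] of the
    chart cuts it down to the line of [w1 - w1 0 i0 *: v0]. *)
Lemma chart_tangent : exists (w0 : 'I_m.+1 -> F) j0, w0 j0 != 0 /\
  forall w : 'I_m.+1 -> F,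
    (forall p, chart_vanishes p -> \sum_i meval (fun i => v0 0 i) (mderiv i p) * w i = 0) ->
    exists c, forall i, w i = c * w0 i.
Proof.
have [_ /(_ x Xx)[T dT hT]] := smX.
have v0n : v0 != 0 by case: hv0.
have v0T : v0 \in T.
  apply/hT => d p v hp Xp hv; have [c c0 ve] := hcoords_prop hv hv0.
  have e : \sum_i meval (fun i => v 0 i) (mderiv i p) * v 0 i = 0.
    by rewrite (euler _ hp) [meval _ p](Xp x Xx v hv) mulr0.
  transitivity (c * \sum_i meval (fun i => v 0 i) (mderiv i p) * v 0 i); last by rewrite e mulr0.
  by rewrite mulr_sumr; apply: eq_bigr => i _; rewrite ve mxE mulrCA.
have [w1 w1T w1v] : exists2 w1, w1 \in T & w1 \notin <[v0]>%VS.
  apply: contrapT => h; have : (T <= <[v0]>)%VS.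
    by apply/subvP => w wT; apply: contrapT => /negP nw; apply: h; exists w.
  by move/dimvS; rewrite dT dim_vline v0n.
have TE : T = (<[v0]> + <[w1]>)%VS.
  apply/esym/eqP; rewrite eqEdim subv_add -!memvE v0T w1T dT /=.
  have w1n : w1 != 0 by apply: contraNneq w1v => ->; apply: mem0v.
  rewrite dimv_disjoint_sum ?dim_vline ?v0n ?w1n //.
  apply/eqP; rewrite -subv0; apply/subvP => z; rewrite memv_cap => /andP[/vlineP[a ->]].
  case/vlineP => b; have [->|b0] := eqVneq b 0; first by rewrite scale0r => ->; apply: mem0v.
  move=> e; case/negP: w1v; rewrite -[w1]scale1r -(mulVf b0) -scalerA -e scalerA.
  exact: memvZ (memv_line _).
pose w0 := w1 - w1 0 i0 *: v0.
have w0n : w0 != 0.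
  by apply: contraNneq w1v => /eqP; rewrite subr_eq0 => /eqP ->; apply: memvZ (memv_line _).
have w0i : w0 0 i0 = 0 by rewrite !mxE v0i0 mulr1 subrr.
have [j0 hj0] : exists j, w0 0 j != 0.
  apply: contrapT => h; case/eqP: w0n; apply/rowP => j; rewrite [RHS]mxE.
  by apply/eqP; apply: contrapT => /negP hj; apply: h; exists j.
exists (fun i => w0 0 i), j0; split=> // w hw.
pose wr : 'rV[F]_m.+1 := \row_i w i.
have wT : wr \in T.
  apply/hT => d p v hp Xp hv; have [c c0 ve] := hcoords_prop hv0 hv.
  have := hw p ((chart_vanishesP hp).2 Xp) => e.
  rewrite -[RHS](mulr0 (c ^+ d.-1)) -[in RHS]e mulr_sumr; apply: eq_bigr => i _.
  rewrite mxE mulrA; congr (_ * _); rewrite ve.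
  have hdi : homogeneous d.-1 (mderiv i p).
    apply/dhomogP => k; rewrite mcoeff_msupp mcoeff_deriv => hk.
    have hkm : mnm_add k (mnm1 i) \in msupp p.
      by rewrite mcoeff_msupp; apply: contraNneq hk => ->; rewrite mul0rn.
    by have := homogeneousP hp hkm; rewrite -mdegE mdegD mdeg1 addn1 => <-.
  by rewrite (poly_evalZ _ _ hdi).
have wi0 : w i0 = 0.
  have := hw (Xi i0 - 1); rewrite (bigD1 i0) //= big1 => [|j ji]; last first.
    rewrite mderivB -mpolyC1 mderivC subr0 mderivX mevalZ mnm1E eq_sym (negbTE ji).
    by rewrite !mul0r.
  rewrite mderivB -mpolyC1 mderivC subr0 mderivX mevalZ mnm1E eqxx mul1r addr0.
  have -> : mnm_sub (mnm1 i0) (mnm1 i0) = @mnm0 m.+1.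
    by apply/mnmP => k; rewrite mnmBE subnn mnm0E.
  rewrite mpolyX0 meval1 mul1r; apply=> y v Xy hv v1.
  by rewrite mpolyC1 /poly_eval mevalB mevalXU meval1 v1 subrr.
move: wT; rewrite TE => /memv_addP[_ /vlineP[a ->] [_ /vlineP[b ->] e]].
have a_eq : a + b * w1 0 i0 = 0.
  by move/rowP: e => /(_ i0); rewrite !mxE wi0 v0i0 mulr1 => <-.
exists b => i; move/rowP: e => /(_ i); rewrite !mxE => ->.
have -> : a = - (b * w1 0 i0) by apply/eqP; rewrite -subr_eq0 opprK a_eq.
ring.
Qed.

Theorem curve_branch : exists g : 'I_m.+1 -> fps F, (forall i, fconst (g i) = v0 0 i) /\
  forall d p, homogeneous d p -> mmap (@fpsC F) g p = 0 <-> vanishes X p.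
Proof.
have [w0 [j0 [wj0 hw]]] := chart_tangent.
have I0 p : chart_vanishes p -> meval (fun i => v0 0 i) p = 0 by move=> h; apply: h hv0 v0i0.
have [g [gc hg]] := smooth_branch chart_vanishes_prime I0 hw wj0 chart_not_point.
by exists g; split=> // d p hp; rewrite hg (chart_vanishesP hp).
Qed.

Theorem curve_ratio d A B : homogeneous d A -> homogeneous d B ->
    ~ vanishes X A -> ~ vanishes X B ->
  exists d' A' B', [/\ homogeneous d' A', homogeneous d' B', vanishes X (A * B' - A' * B) &
    poly_eval A' v0 != 0 \/ poly_eval B' v0 != 0].
Proof.
move=> hA hB nA nB.
have [w0 [j0 [wj0 hw]]] := chart_tangent.
have I0 p : chart_vanishes p -> meval (fun i => v0 0 i) p = 0 by move=> h; apply: h hv0 v0i0.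
have [|| A' [B' [hAB h0]]] := smooth_ratio chart_vanishes_prime I0 hw wj0 chart_not_point
    (A := A) (B := B).
- by rewrite (chart_vanishesP hA).
- by rewrite (chart_vanishesP hB).
pose D := maxn (msize A') (msize B').
have sA : (msize A' <= D.+1)%N by rewrite leqW // leq_maxl.
have sB : (msize B' <= D.+1)%N by rewrite leqW // leq_maxr.
have hA' := chart_homog_homogeneous sA; have hB' := chart_homog_homogeneous sB.
exists D, (chart_homog D A'), (chart_homog D B'); split=> //; last by rewrite !chart_homog_eval.
have hh : homogeneous (d + D) (A * chart_homog D B' - chart_homog D A' * B).
  apply: homogeneousB; first exact: homogeneousM.
  by rewrite addnC; apply: homogeneousM.
apply/(chart_vanishesP hh) => y v Xy hv v1.
have := hAB y v Xy hv v1; rewrite /poly_eval !mevalB !mevalM.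
by rewrite [meval _ (chart_homog _ B')]chart_homog_eval // [meval _ (chart_homog _ A')]chart_homog_eval.
Qed.

End SmoothCurve.

End ProjectiveSpace.

(** * Affine curves and their smooth models *)

Section AffineSets.
Variables (F : fieldType) (n : nat).
Implicit Types (C : set 'rV[F]_n) (p q : mpoly n F) (z : 'rV[F]_n).

Definition vanishes_on C p := forall z, C z -> poly_eval p z = 0.

Lemma vanishes_on_ideal C : is_ideal (vanishes_on C).
Proof.
split=> [z Cz|a b ha hb z Cz|r a ha z Cz]; first by rewrite /poly_eval meval0.
  by rewrite /poly_eval mevalD [meval _ a](ha z) // [meval _ b](hb z) // addr0.
by rewrite /poly_eval mevalM [meval _ a](ha z) // mulr0.
Qed.

Lemma affine_closed_shape C : affine_closed C -> C `<=` @shape_space F n.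
Proof. by move=> [S ->] z []. Qed.

Lemma affine_closedP C : affine_closed C ->
  forall z, C z <-> shape_space z /\ forall p, vanishes_on C p -> poly_eval p z = 0.
Proof.
move=> cC z; have [S CE] := cC; split=> [Cz|[sz hz]].
  by split=> [|p]; [apply: affine_closed_shape Cz|apply].
by rewrite CE; split=> // p Sp; apply: hz => y; rewrite CE => -[_]; apply.
Qed.

Lemma affine_closed_zero (P : mpoly n F -> Prop) :
  affine_closed [set z | shape_space z /\ forall p, P p -> poly_eval p z = 0]%classic.
Proof. by exists P. Qed.

Lemma irreducible_vanishes_prime C : irreducible_closed (@affine_closed F n) C ->
  prime_ideal (vanishes_on C).
Proof.
move=> [cC [z0 Cz0] irr]; split=> [|h|a b hab]; first exact: vanishes_on_ideal.
  by have /eqP := h z0 Cz0; rewrite /poly_eval meval1 oner_eq0.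
have h := irr _ _ (affine_closed_zero (eq a)) (affine_closed_zero (eq b)).
have [|h1|h1] := h.
- move=> z Cz; have sz := affine_closed_shape cC Cz.
  have /eqP := hab z Cz; rewrite /poly_eval mevalM mulf_eq0 => /orP[]/eqP e; [left|right];
  by split=> // _ <-.
- by left=> z /h1[_]; apply.
- by right=> z /h1[_]; apply.
Qed.

End AffineSets.

(** * The projective completion *)

Section Completion.
Variables (F : fieldType) (n : nat).
Implicit Types (C : set 'rV[F]_n) (p : mpoly n F) (q : mpoly n.+1 F) (z : 'rV[F]_n).

Definition affine_coords z : 'rV[F]_n.+1 := row_mx (1 : 'rV[F]_1) z.

Lemma affine_coords0 z : affine_coords z 0 ord0 = 1.
Proof.
rewrite /affine_coords mxE; case: splitP => j; rewrite ?ord1 ?mxE ?eqxx //.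
Qed.
Lemma affine_coordsS z (v : 'I_n) : affine_coords z 0 (lift ord0 v) = z 0 v.
Proof.
rewrite /affine_coords mxE; case: splitP => j /=; first by case: j => -[].
by rewrite /bump /= => -[] /val_inj ->.
Qed.
Lemma affine_coords_neq0 z : affine_coords z != 0.
Proof. by apply/eqP => /rowP/(_ ord0); rewrite affine_coords0 mxE => /eqP; rewrite oner_eq0. Qed.

Lemma affine_coordsP (w : 'rV[F]_n.+1) : w 0 ord0 != 0 ->
  w = w 0 ord0 *: affine_coords (\row_v (w 0 (lift ord0 v) / w 0 ord0)).
Proof.
move=> w0; apply/rowP => i; rewrite mxE; case: (unliftP ord0 i) => [v ->|->].
  by rewrite affine_coordsS mxE mulrC divfK.
by rewrite affine_coords0 mulr1.
Qed.

Definition dehom (q : mpoly n.+1 F) : mpoly n F :=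
  mmap (@mpolyC n F) (fun i => if unlift ord0 i is Some v then mpolyX F (mnm1 v) else 1) q.

Lemma dehom_eval q z : poly_eval (dehom q) z = poly_eval q (affine_coords z).
Proof.
rewrite /poly_eval [LHS](mmap_comp idfun); apply: eq_mmap => i.
case: unliftP => [v ->|->]; last by rewrite rmorph1 affine_coords0.
by rewrite mmap_mpolyX affine_coordsS.
Qed.

Definition hom0 D p : mpoly n.+1 F :=
  homog_subst (mpolyX F (mnm1 ord0)) (fun v => mpolyX F (mnm1 (lift ord0 v))) D p.

Lemma hom0_homogeneous D p : (msize p <= D.+1)%N -> homogeneous D (hom0 D p).
Proof.
move=> h; have := @homog_subst_homogeneous F n.+1 n 1 (mpolyX F (mnm1 ord0))
   (fun v => mpolyX F (mnm1 (lift ord0 v))) D p (homogeneousX _ _).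
by rewrite mul1n; apply=> // i; apply: homogeneousX.
Qed.

Lemma hom0_eval D p z : (msize p <= D.+1)%N ->
  poly_eval (hom0 D p) (affine_coords z) = poly_eval p z.
Proof.
move=> h; have e : mmap idfun (fun i => affine_coords z 0 i) (mpolyX F (mnm1 ord0)) = 1.
  by rewrite mmap_mpolyX affine_coords0.
rewrite /poly_eval [LHS](homog_subst_mmap (iota := idfun)) ?e ?oner_neq0 //.
by rewrite expr1n mul1r; apply: eq_mmap => i; rewrite mmap_mpolyX affine_coordsS divr1.
Qed.

Lemma completion_vanishes C d q : homogeneous d q ->
  (forall z, C z -> poly_eval q (affine_coords z) = 0) -> projective_completion C `<=` pzero q.
Proof.
move=> hq hC y; apply; split; first exact: pzero_closed hq.
by move=> x [z Cz hx]; apply/(pzeroP hq hx)/hC.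
Qed.

Lemma completion_embedding C z (y : ppoint F n) : C z -> hcoords y (affine_coords z) ->
  projective_completion C y.
Proof. by move=> Cz hy B [_]; apply; exists z. Qed.

(** A polynomial vanishing on [C] homogenizes to a form vanishing on the completion, so taking the
    closure adds no point of the shape space. *)
Lemma completion_affine C z (y : ppoint F n) : affine_closed C ->
  projective_completion C y -> hcoords y (affine_coords z) -> shape_space z -> C z.
Proof.
move=> cC Yy hy sz; apply/(affine_closedP cC); split=> // p hp.
have sp : (msize p <= (msize p).+1)%N by [].
rewrite -(hom0_eval z sp); apply: (completion_vanishes (hom0_homogeneous sp) _ Yy hy).
by move=> z' Cz'; rewrite hom0_eval //; apply: hp.
Qed.

End Completion.

(** * The smooth model and the inverse of its birational map *)

Section Model.
Variables (F : fieldType) (n : nat) (C : set 'rV[F]_n).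
Hypothesis irrC : irreducible_closed (@affine_closed F n) C.
Variable M : smooth_model (projective_completion C).
Local Notation X := (@sm_curve _ _ _ M).
Local Notation f := (@sm_map _ _ _ M).
Local Notation m := (@sm_dim _ _ _ M).
Local Notation Y := (projective_completion C).

Let cC : affine_closed C. Proof. by case: irrC. Qed.
Let pC : prime_ideal (vanishes_on C). Proof. exact: irreducible_vanishes_prime. Qed.

Lemma model_irreducible : irreducible_closed (@proj_closed F m) X.
Proof. by case: (sm_smooth M) => -[]. Qed.
Let irrX := model_irreducible.

Lemma regular_rep k l (U : set (ppoint F k)) (g : ppoint F k -> ppoint F l) x :
  regular_on U g -> U x -> exists d (G : 'I_l.+1 -> mpoly k.+1 F) e (h : mpoly k.+1 F),
    [/\ forall i, homogeneous d (G i), homogeneous e h,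
        forall v, hcoords x v -> poly_eval h v != 0 &
        forall y v, U y -> hcoords y v -> poly_eval h v != 0 ->
          hcoords (g y) (\row_i poly_eval (G i) v)].
Proof.
move=> rg Ux; have [d [G [Z [hG cZ nZ hy]]]] := rg x Ux.
have [e [h [hh Zh nh]]] := proj_closedP cZ nZ.
exists d, G, e, h; split=> // [v hv|y v Uy hv hn].
  by apply/eqP => hv0; apply: nh; rewrite (pzeroP hh hv).
by apply: hy => // Zy; move: hn; rewrite (Zh y Zy v hv) eqxx.
Qed.

(* [G] gives the map [f] in homogeneous coordinates where [h] does not vanish. *)
Definition represents x d (G : 'I_n.+1 -> mpoly m.+1 F) e (h : mpoly m.+1 F) :=
  [/\ forall i, homogeneous d (G i), homogeneous e h,
      forall v, hcoords x v -> poly_eval h v != 0 &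
      forall y v, X y -> hcoords y v -> poly_eval h v != 0 ->
        hcoords (f y) (\row_i poly_eval (G i) v)].

Lemma represents_exists x : X x -> exists d G e h, represents x d G e h.
Proof. by move=> Xx; exact: (regular_rep (@sm_regular _ _ _ M) Xx). Qed.

Lemma represents_vanishesN x d G e h : X x -> represents x d G e h -> ~ vanishes X h.
Proof.
move=> Xx [_ hh hx _]; have [v hv] := hcoords_exists x.
exact: (eval_vanishesN Xx hv (hx v hv)).
Qed.

Lemma represents_prop x x' d d' G G' e e' h h' i j : X x -> X x' ->
  represents x d G e h -> represents x' d' G' e' h' -> vanishes X (G i * G' j - G j * G' i).
Proof.
move=> Xx Xx' r r'; have [hG hh _ rG] := r; have [hG' hh' _ rG'] := r'.
have hp : homogeneous (d + d') (G i * G' j - G j * G' i).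
  by apply: homogeneousB; apply: homogeneousM.
apply: (vanishes_dense irrX (homogeneousM hh hh') hp).
  exact: (vanishes_mulN irrX hh hh' (represents_vanishesN Xx r) (represents_vanishesN Xx' r')).
move=> y v Xy hv; rewrite /poly_eval mevalM mulf_eq0 negb_or => /andP[hn hn'].
have [c c0 /rowP ce] := hcoords_prop (rG y v Xy hv hn) (rG' y v Xy hv hn').
have hi := ce i; have hj := ce j; rewrite !mxE in hi hj.
rewrite mevalB !mevalM [meval _ (G' i)]hi [meval _ (G' j)]hj /poly_eval; ring.
Qed.

(** [H] gives the inverse map in coordinates where [k] is nonzero. The form [k] also excludes the
    closed set [B] of the birational map, and [hA] excludes its closed set [A]. *)
Lemma inverse_exists : exists d' (H : 'I_m.+1 -> mpoly n.+1 F) e' (k : mpoly n.+1 F) a (hA : mpoly m.+1 F),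
  [/\ (forall i, homogeneous d' (H i)) /\ homogeneous e' k,
      homogeneous a hA /\ ~ vanishes X hA,
      exists2 z, C z & poly_eval k (affine_coords z) != 0,
      forall z, C z -> poly_eval k (affine_coords z) != 0 ->
        exists y, [/\ X y, hcoords y (\row_i poly_eval (H i) (affine_coords z)) &
                      hcoords (f y) (affine_coords z)] &
      forall y v z, X y -> hcoords y v -> poly_eval hA v != 0 -> C z ->
        hcoords (f y) (affine_coords z) -> poly_eval k (affine_coords z) != 0 ->
        hcoords y (\row_i poly_eval (H i) (affine_coords z))].
Proof.
have [A [B [g [[cA cB] [nA nB] [_ rg] fg gf]]]] := sm_birational M.
have [x1 Xx1 nAx1] : exists2 x, X x & ~ A x.
  by apply: contrapT => h; apply: nA => x Xx; apply: contrapT => nx; apply: h; exists x.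
have [y1 Yy1 nBy1] : exists2 y, Y y & ~ B y.
  by apply: contrapT => h; apply: nB => x Xx; apply: contrapT => nx; apply: h; exists x.
have [a [hA [hhA AhA nhA]]] := proj_closedP cA nAx1.
have [b [hB [hhB BhB nhB]]] := proj_closedP cB nBy1.
have [d' [H [e1 [k1 [hH hk1 k1y rH]]]]] := regular_rep rg (conj Yy1 nBy1).
have hk := homogeneousM hhB hk1.
exists d', H, (b + e1)%N, (hB * k1), a, hA; split=> //.
- by split=> // h; apply: nhA; apply: h.
- apply: contrapT => h; have [v hv] := hcoords_exists y1.
  have : poly_eval (hB * k1) v = 0.
    apply: (completion_vanishes hk _ Yy1 hv) => z Cz; apply/eqP; apply: contrapT => /negP nz.
    by apply: h; exists z.
  rewrite /poly_eval mevalM => /eqP; rewrite mulf_eq0 => /orP[/eqP e|].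
    by apply: nhB; apply/(pzeroP hhB hv).
  by rewrite [_ == _](negbTE (k1y v hv)).
- move=> z Cz; rewrite /poly_eval mevalM mulf_eq0 negb_or => /andP[hBz hkz].
  have [y hy] := hcoords_point (affine_coords_neq0 z).
  have Yy := completion_embedding Cz hy.
  have nBy : ~ B y by move=> By; move: hBz; rewrite [meval _ _](BhB y By _ hy) eqxx.
  have [[Xg _] fgy] := gf y (conj Yy nBy).
  exists (g y); split=> //; last by rewrite fgy.
  exact: rH.
move=> y v z Xy hv hAv Cz hfy; rewrite /poly_eval mevalM mulf_eq0 negb_or => /andP[hBz hkz].
have nAy : ~ A y by move=> Ay; move: hAv; rewrite [poly_eval _ _](AhA y Ay v hv) eqxx.
have [Yf gfy] := fg y (conj Xy nAy).
by rewrite -gfy; apply: rH.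
Qed.

Lemma eval_comp k l (q : mpoly k F) (G : 'I_k -> mpoly l F) (v : 'rV[F]_l) :
  poly_eval (mmap (@mpolyC l F) G q) v = meval (fun i => poly_eval (G i) v) q.
Proof. exact: mmap_comp. Qed.

Lemma eval_row k (q : mpoly k F) (w : 'I_k -> F) :
  meval w q = poly_eval q (\row_i w i).
Proof. by apply: meval_eq => i; rewrite mxE. Qed.

Section Inverse.
Variables (d' : nat) (H : 'I_m.+1 -> mpoly n.+1 F) (e' : nat) (k : mpoly n.+1 F).
Variables (a : nat) (hA : mpoly m.+1 F).
Hypotheses (hH : forall i, homogeneous d' (H i)) (hk : homogeneous e' k).
Hypotheses (hhA : homogeneous a hA) (nhA : ~ vanishes X hA).
Hypothesis k_ex : exists2 z, C z & poly_eval k (affine_coords z) != 0.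
Hypothesis inv_ex : forall z, C z -> poly_eval k (affine_coords z) != 0 ->
  exists y, [/\ X y, hcoords y (\row_i poly_eval (H i) (affine_coords z)) &
                hcoords (f y) (affine_coords z)].
Hypothesis inv_id : forall y v z, X y -> hcoords y v -> poly_eval hA v != 0 -> C z ->
  hcoords (f y) (affine_coords z) -> poly_eval k (affine_coords z) != 0 ->
  hcoords y (\row_i poly_eval (H i) (affine_coords z)).

Let H1 i := dehom (H i).
Let k1 := dehom k.

Let nk1 : ~ vanishes_on C k1.
Proof. by case: k_ex => z Cz kz /(_ z Cz); rewrite dehom_eval => /eqP; rewrite (negbTE kz). Qed.

Let comp_H (p : mpoly m.+1 F) z : poly_eval (mmap (@mpolyC n F) H1 p) z =
  poly_eval p (\row_i poly_eval (H i) (affine_coords z)).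
Proof. by rewrite eval_comp eval_row; congr poly_eval; apply/rowP => i; rewrite !mxE dehom_eval. Qed.

(** If [Q] is nonzero at a vector, then the point with these coordinates is affine, lies in the
    shape space, and is one where [H] may be used. *)
Let Q : mpoly n.+1 F := k * (mpolyX F (mnm1 ord0) *
  \prod_(v < n) (mpolyX F (mnm1 (lift ord0 v)) *
                 (mpolyX F (mnm1 (lift ord0 v)) - mpolyX F (mnm1 ord0)))).

Let hQ : exists e, homogeneous e Q.
Proof.
exists (e' + (1 + \sum_(v < n) 2))%N; apply: homogeneousM => //.
apply: homogeneousM; first exact: homogeneousX.
apply: homogeneous_prod => v; apply: (homogeneousM (d := 1) (d' := 1)); first exact: homogeneousX.
by apply: homogeneousB; apply: homogeneousX.
Qed.

Let QE w : poly_eval Q w = poly_eval k w * (w 0 ord0 *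
  \prod_(v < n) (w 0 (lift ord0 v) * (w 0 (lift ord0 v) - w 0 ord0))).
Proof.
rewrite /poly_eval !mevalM mevalXU rmorph_prod; congr (_ * (_ * _)).
by apply: eq_bigr => v _; rewrite /= mevalM mevalB !mevalXU.
Qed.

Let Q_shape z : shape_space z -> poly_eval k (affine_coords z) != 0 ->
  poly_eval Q (affine_coords z) != 0.
Proof.
move=> sz kz; rewrite QE affine_coords0 mul1r mulf_neq0 //; apply/prodf_neq0 => v _.
by have [z0 z1] := sz v; rewrite affine_coordsS mulf_neq0 // subr_eq0.
Qed.

Lemma inverse_vanishesN : exists j, ~ vanishes_on C (H1 j).
Proof.
have [z Cz kz] := k_ex; have [y [_ [Hn _] _]] := inv_ex Cz kz.
apply: contrapT => h; case/eqP: Hn; apply/rowP => j; rewrite !mxE -dehom_eval.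
by apply: contrapT => hj; apply: h; exists j => hC; apply: hj; apply: hC.
Qed.

Section Local.
Variables (x : ppoint F m) (d : nat) (G : 'I_n.+1 -> mpoly m.+1 F) (e : nat) (h : mpoly m.+1 F).
Hypotheses (Xx : X x) (rep : represents x d G e h).
Let hG : forall i, homogeneous d (G i). Proof. by case: rep. Qed.
Let hh : homogeneous e h. Proof. by case: rep. Qed.
Let QG := mmap (@mpolyC m.+1 F) G Q.

Let QG_E v : poly_eval QG v = poly_eval Q (\row_i poly_eval (G i) v).
Proof. by rewrite eval_comp eval_row. Qed.

Let hQG : exists e, homogeneous e QG.
Proof. by case: hQ => e1 he; exists (d * e1)%N; apply: comp_homogeneous. Qed.

(** At a point of the model over a point of [C], a representation [G2] is valid and [Q] is nonzero.
    Where [h] and [h2] are both nonzero, [G] and [G2] are proportional, so the nonvanishing passes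
    to [G] by irreducibility. *)
Let nQG : ~ vanishes X QG.
Proof.
have [z1 Cz1 kz1] := k_ex; have [y' [Xy' hv' fy']] := inv_ex Cz1 kz1.
have [d2 [G2 [e2 [h2 rep2]]]] := represents_exists Xy'.
have [hG2 hh2 h2y rG2] := rep2; have [eQ heQ] := hQ.
set v' := \row_i _ in hv'.
have hQG2 : homogeneous (d2 * eQ) (mmap (@mpolyC m.+1 F) G2 Q) by apply: comp_homogeneous.
have nQ2 : ~ vanishes X (mmap (@mpolyC m.+1 F) G2 Q).
  apply: (eval_vanishesN Xy' hv'); rewrite eval_comp eval_row.
  have [c c0 ->] := hcoords_prop fy' (rG2 y' v' Xy' hv' (h2y v' hv')).
  rewrite (poly_evalZ _ _ heQ) mulf_neq0 ?expf_neq0 //; apply: Q_shape => //.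
  exact: (affine_closed_shape cC Cz1).
have n3 : ~ vanishes X (h * h2 * mmap (@mpolyC m.+1 F) G2 Q).
  apply: (vanishes_mulN irrX (homogeneousM hh hh2) hQG2) => //.
  apply: (vanishes_mulN irrX hh hh2); first exact: represents_vanishesN Xx rep.
  exact: represents_vanishesN Xy' rep2.
have [y [v [Xy hv]]] := vanishesN_ex n3.
rewrite /poly_eval !mevalM !mulf_eq0 !negb_or => /andP[/andP[hn hn2]].
rewrite -[meval _ (mmap _ _ _)]/(poly_eval _ _) eval_comp eval_row => Q2n.
apply: (eval_vanishesN Xy hv); rewrite QG_E; have [_ _ _ rG] := rep.
have [c c0 ->] := hcoords_prop (rG2 y v Xy hv hn2) (rG y v Xy hv hn).
by rewrite (poly_evalZ _ _ heQ) mulf_neq0 ?expf_neq0.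
Qed.

Let good := hA * h * QG.
Let hgood : exists e, homogeneous e good.
Proof. by case: hQG => e1 he; exists (a + e + e1)%N; do !apply: homogeneousM. Qed.
Let ngood : ~ vanishes X good.
Proof.
case: hQG => e1 he; apply: (vanishes_mulN irrX (homogeneousM hhA hh) he) => //.
by apply: (vanishes_mulN irrX hhA hh) => //; apply: represents_vanishesN Xx rep.
Qed.

(** On this dense open set both maps are explicit: [G] leads to an affine point [z] of [C], and [H1]
    leads back. *)
Let good_point y v : X y -> hcoords y v -> poly_eval good v != 0 ->
  exists z c, [/\ C z, poly_eval (G ord0) v != 0,
    (forall i, poly_eval (G (lift ord0 i)) v = z 0 i * poly_eval (G ord0) v),
    c != 0 & forall i, poly_eval (H1 i) z = c * v 0 i].
Proof.
move=> Xy hv; rewrite {1}/poly_eval !mevalM !mulf_eq0 !negb_or => /andP[/andP[hAv hhv]].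
rewrite -[meval _ QG]/(poly_eval _ _) QG_E QE; set w := \row_i _.
rewrite !mulf_eq0 !negb_or => /andP[kw /andP[w0 /prodf_neq0 hw]].
have [_ _ _ rG] := rep; have hfy := rG y v Xy hv hhv.
pose z : 'rV[F]_n := \row_i (w 0 (lift ord0 i) / w 0 ord0).
have wE := affine_coordsP w0; rewrite -/z in wE.
have sz : shape_space z.
  move=> i; have := hw i isT; rewrite mulf_eq0 negb_or subr_eq0 => /andP[wi wi0]; rewrite mxE.
  rewrite mulf_neq0 ?invr_eq0 //; split=> //.
  by apply: contraNneq wi0 => e1; rewrite -[w 0 (lift _ _)](divfK w0) e1 mul1r.
have hfz : hcoords (f y) (affine_coords z).
  have := hcoordsZ (invr_neq0 w0) hfy; rewrite -/w {2}wE scalerA mulVf // scale1r.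
  by [].
have Cz : C z := completion_affine cC (sm_maps Xy) hfz sz.
have kz : poly_eval k (affine_coords z) != 0.
  by apply: contraNneq kw => e1; rewrite wE (poly_evalZ _ _ hk) e1 mulr0.
have hyH := inv_id Xy hv hAv Cz hfz kz.
have [c c0 ce] := hcoords_prop hv hyH.
exists z, c; split=> // [|i|i].
- by move: w0; rewrite mxE.
- have wi l : poly_eval (G l) v = w 0 l by rewrite [RHS]mxE.
  by rewrite !wi [z 0 i]mxE divfK.
- by rewrite dehom_eval; move/rowP: ce => /(_ i); rewrite !mxE.
Qed.

Lemma rep0_vanishesN : ~ vanishes X (G ord0).
Proof.
have [y [v [Xy hv gv]]] := vanishesN_ex ngood.
have [z [c [_ G0 _ _ _]]] := good_point Xy hv gv.
exact: (eval_vanishesN Xy hv G0).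
Qed.

(** Both curves have dense open parts exchanged by the two maps, so a form on the model may be
    tested on [C] after substituting [H1]. *)
Lemma rep_inverse_vanishes e1 p : homogeneous e1 p ->
  vanishes X p <-> vanishes_on C (mmap (@mpolyC n F) H1 p).
Proof.
move=> hp; split=> [Xp|h0].
  have [_ _ pr] := pC; have [//|//] : vanishes_on C k1 \/ vanishes_on C (mmap (@mpolyC n F) H1 p).
  apply: pr => z Cz; rewrite /poly_eval mevalM; apply/eqP; rewrite mulf_eq0.
  case: eqVneq => //= kz; have kz' : poly_eval k (affine_coords z) != 0 by rewrite -dehom_eval.
  have [y [Xy hy _]] := inv_ex Cz kz'; apply/eqP; rewrite [LHS]comp_H; exact: (Xp y Xy _ hy).
have [eg heg] := hgood; apply: (vanishes_dense irrX heg hp ngood) => y v Xy hv gv.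
have [z [c [Cz _ _ c0 Hz]]] := good_point Xy hv gv.
have := h0 z Cz; rewrite comp_H.
have -> : \row_i poly_eval (H i) (affine_coords z) = c *: v.
  by apply/rowP => i; rewrite !mxE -Hz dehom_eval.
by rewrite (poly_evalZ _ _ hp) => /eqP; rewrite mulf_eq0 expf_eq0 (negbTE c0) andbF => /eqP.
Qed.

Let hH1N : ~ vanishes_on C (mmap (@mpolyC n F) H1 h).
Proof. by rewrite -(rep_inverse_vanishes hh); apply: represents_vanishesN Xx rep. Qed.

Let khN : ~ vanishes_on C (k1 * mmap (@mpolyC n F) H1 h).
Proof. by case: pC => _ _ pr /pr[]. Qed.

Let inv_point z : C z -> poly_eval (k1 * mmap (@mpolyC n F) H1 h) z != 0 ->
  exists y v, [/\ X y, hcoords y v, v = \row_i poly_eval (H1 i) z &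
    exists2 c, c != 0 & forall i, poly_eval (G i) v = c * affine_coords z 0 i].
Proof.
move=> Cz; rewrite {1}/poly_eval mevalM mulf_eq0 negb_or => /andP[].
rewrite [meval _ k1]dehom_eval [meval _ (mmap _ _ _)]comp_H => kz hz.
have [y [Xy hy hfy]] := inv_ex Cz kz; set v := \row_i _ in hz hy.
exists y, v; split=> //; first by apply/rowP => i; rewrite [LHS]mxE [RHS]mxE dehom_eval.
have [_ _ _ rG] := rep.
have [c c0 /rowP ce] := hcoords_prop hfy (rG y v Xy hy hz).
by exists c => // i; have := ce i; rewrite !mxE.
Qed.

Lemma rep_subst_vanishes D p : (msize p <= D.+1)%N ->
  vanishes X (homog_subst (G ord0) (fun v => G (lift ord0 v)) D p) <-> vanishes_on C p.
Proof.
move=> sp; have evE (v : 'rV[F]_m.+1) (z : 'rV[F]_n) : poly_eval (G ord0) v != 0 ->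
    (forall i, poly_eval (G (lift ord0 i)) v = z 0 i * poly_eval (G ord0) v) ->
    poly_eval (homog_subst (G ord0) (fun v => G (lift ord0 v)) D p) v =
    poly_eval (G ord0) v ^+ D * poly_eval p z.
  move=> G0 Gi; rewrite /poly_eval [LHS](homog_subst_mmap (iota := idfun)) //; congr (_ * _).
  by apply: eq_mmap => i; rewrite [mmap _ _ _]Gi mulfK.
split=> [h0|Cp].
  have [_ _ pr] := pC.
  have [//|//] : vanishes_on C (k1 * mmap (@mpolyC n F) H1 h) \/ vanishes_on C p.
  apply: pr => z Cz; rewrite /poly_eval mevalM; apply/eqP; rewrite mulf_eq0.
  case: eqVneq => //= khz; have [y [v [Xy hv _ [c c0 Gv]]]] := inv_point Cz khz.
  have G0 : poly_eval (G ord0) v = c by rewrite Gv affine_coords0 mulr1.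
  have := h0 y Xy v hv; rewrite (evE v z) ?G0 //; last first.
    by move=> i; rewrite Gv affine_coordsS mulrC.
  by move/eqP; rewrite mulf_eq0 expf_eq0 (negbTE c0) andbF.
have hp : homogeneous (d * D) (homog_subst (G ord0) (fun v => G (lift ord0 v)) D p).
  by apply: homog_subst_homogeneous.
have [eg heg] := hgood; apply: (vanishes_dense irrX heg hp ngood) => y v Xy hv gv.
have [z [c [Cz G0 Gz _ _]]] := good_point Xy hv gv.
by rewrite (evE v z G0 Gz) (Cp z Cz) mulr0.
Qed.

(** Going to [C] and back is the identity; it is written as a proportionality, because coordinates
    are determined only up to a common factor. *)
Lemma rep_inverse_prop i j D : (forall i, (msize (H1 i) <= D.+1)%N) ->
  let hs p := homog_subst (G ord0) (fun v => G (lift ord0 v)) D p in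
  vanishes X (mpolyX F (mnm1 i) * hs (H1 j) - mpolyX F (mnm1 j) * hs (H1 i)).
Proof.
move=> sH hs; have hhs l : homogeneous (d * D) (hs (H1 l)) by apply: homog_subst_homogeneous.
have hp : homogeneous (1 + d * D) (mpolyX F (mnm1 i) * hs (H1 j) - mpolyX F (mnm1 j) * hs (H1 i)).
  by apply: homogeneousB; apply: homogeneousM => //; apply: homogeneousX.
have [eg heg] := hgood; apply: (vanishes_dense irrX heg hp ngood) => y v Xy hv gv.
have [z [c [Cz G0 Gz c0 Hz]]] := good_point Xy hv gv.
have hsE l : poly_eval (hs (H1 l)) v = poly_eval (G ord0) v ^+ D * (c * v 0 l).
  rewrite -Hz /poly_eval [LHS](homog_subst_mmap (iota := idfun)) //; congr (_ * _).
  by apply: eq_mmap => i'; rewrite [mmap _ _ _]Gz mulfK.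
have eE (q1 q2 : mpoly m.+1 F) : poly_eval (mpolyX F (mnm1 i) * q1 - mpolyX F (mnm1 j) * q2) v =
    v 0 i * poly_eval q1 v - v 0 j * poly_eval q2 v.
  by rewrite /poly_eval mevalB !mevalM !mevalXU.
by rewrite eE !hsE; move: (_ ^+ D) => x0; ring.
Qed.

(** The opposite composition, where the affine coordinates give an actual equality of ratios. *)
Lemma rep_inverse_id v :
  vanishes_on C (mmap (@mpolyC n F) H1 (G (lift ord0 v)) -
                 mpolyX F (mnm1 v) * mmap (@mpolyC n F) H1 (G ord0)).
Proof.
set p := _ - _; have [_ _ pr] := pC.
have [//|//] : vanishes_on C (k1 * mmap (@mpolyC n F) H1 h) \/ vanishes_on C p.
apply: pr => z Cz; rewrite /poly_eval mevalM; apply/eqP; rewrite mulf_eq0.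
case: eqVneq => //= khz; have [y [w [Xy hw we [c c0 Gw]]]] := inv_point Cz khz.
rewrite /p mevalB mevalM mevalXU -!/(poly_eval _ _) !eval_comp !eval_row -we.
by rewrite !Gw affine_coords0 affine_coordsS mulr1 mulrC subrr.
Qed.

Lemma tends_to_vanishes d0 A B v : homogeneous d0 A -> homogeneous d0 B ->
  (forall y w z, X y -> hcoords y w -> C z -> hcoords (f y) (affine_coords z) ->
     poly_eval A w = z 0 v * poly_eval B w) ->
  vanishes X (A * G ord0 - B * G (lift ord0 v)).
Proof.
move=> hA0 hB0 hAB; have hp : homogeneous (d0 + d) (A * G ord0 - B * G (lift ord0 v)).
  by apply: homogeneousB; apply: homogeneousM.
have [eg heg] := hgood; apply: (vanishes_dense irrX heg hp ngood) => y w Xy hw gw.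
have [z [c [Cz G0 Gz c0 Hz]]] := good_point Xy hw gw.
have hfz : hcoords (f y) (affine_coords z).
  have [_ _ _ rG] := rep.
  have hw' : poly_eval h w != 0.
    by move: gw; rewrite /poly_eval !mevalM !mulf_eq0 !negb_or => /andP[/andP[]].
  have := hcoordsZ (invr_neq0 G0) (rG y w Xy hw hw').
  congr hcoords; apply/rowP => i; rewrite mxE [X in _ * X]mxE.
  case: (unliftP ord0 i) => [l ->|->]; last by rewrite affine_coords0 mulVf.
  by rewrite affine_coordsS Gz mulrC mulfK.
rewrite /poly_eval mevalB !mevalM [meval _ A](hAB y w z) // [meval _ (G (lift _ _))]Gz.
rewrite /poly_eval; ring.
Qed.

(** The second clause of [tends_to] runs over all points of the model, where [f] has varying
    representations; one identity in the fixed [G] suffices, as [represents_prop] carries it to the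
    others. *)
Lemma vanishes_tends_to d0 A B v : homogeneous d0 A -> homogeneous d0 B ->
  vanishes X (A * G ord0 - B * G (lift ord0 v)) ->
  forall y w z, X y -> hcoords y w -> C z -> hcoords (f y) (affine_coords z) ->
     poly_eval A w = z 0 v * poly_eval B w.
Proof.
move=> hA0 hB0 hAB y w z Xy hw Cz hfz.
have [d2 [G2 [e2 [h2 rep2]]]] := represents_exists Xy.
have [hG2 hh2 h2y rG2] := rep2.
have [c c0 /rowP ce] := hcoords_prop hfz (rG2 y w Xy hw (h2y w hw)).
have hr := represents_prop ord0 (lift ord0 v) Xx Xy rep rep2.
have hp2 : homogeneous (d0 + d2) (A * G2 ord0 - B * G2 (lift ord0 v)).
  by apply: homogeneousB; apply: homogeneousM.
have vp : vanishes X (A * G2 ord0 - B * G2 (lift ord0 v)).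
  apply: (vanishes_dense irrX (hG ord0) hp2 rep0_vanishesN) => y' w' Xy' hw' G0.
  have := hr y' Xy' w' hw'; have := hAB y' Xy' w' hw'.
  rewrite /poly_eval !mevalB !mevalM -!/(poly_eval _ _) => e1 e2'.
  apply: (mulfI G0); rewrite mulr0.
  have -> : poly_eval (G ord0) w' * (poly_eval A w' * poly_eval (G2 ord0) w' -
       poly_eval B w' * poly_eval (G2 (lift ord0 v)) w') =
     poly_eval (G2 ord0) w' * (poly_eval A w' * poly_eval (G ord0) w' -
       poly_eval B w' * poly_eval (G (lift ord0 v)) w') -
     poly_eval B w' * (poly_eval (G ord0) w' * poly_eval (G2 (lift ord0 v)) w' -
       poly_eval (G (lift ord0 v)) w' * poly_eval (G2 ord0) w') by ring.
  by rewrite e1 e2' !mulr0 subrr.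
have := vp y Xy w hw; rewrite /poly_eval mevalB !mevalM -!/(poly_eval _ _).
have ceE i : poly_eval (G2 i) w = c * affine_coords z 0 i.
  by have := ce i; rewrite mxE [RHS]mxE.
rewrite !ceE affine_coords0 affine_coordsS.
move=> e1; apply: (mulfI c0); apply/eqP; rewrite -subr_eq0 -e1; apply/eqP; ring.
Qed.

End Local.
End Inverse.

End Model.

(** * Gluing equations in local coordinates *)

Section LocalCoordinates.
Variable K : fieldType.

(* The parameter that tends to [0] when [z] tends to the limit value. *)
Definition local_coord (a : limit_value) (z : K) : K :=
  match a with To1 => 1 - z | To0 => z | ToInfinity => z^-1 end.

Lemma local_coordK a : involutive (local_coord a).
Proof. by case: a => z /=; rewrite ?subKr ?invrK. Qed.

Lemma local_coord_shape a z : z != 0 -> z != 1 -> local_coord a z != 0 /\ 1 - local_coord a z != 0.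
Proof.
move=> z0 z1; have z1' : 1 - z != 0 by rewrite subr_eq0 eq_sym.
case: a => /=; rewrite ?subKr ?invr_eq0 //; split=> //.
by rewrite subr_eq0 eq_sym; apply: contra z1 => /eqP h; rewrite -[z]invrK h invr1.
Qed.

Variables (n : nat) (p p' p'' : 'I_n -> 'I_n.+1 -> nat) (I : 'I_n.+1 -> limit_value).
Let r' i v : int := (p i v)%:Z - (p'' i v)%:Z.
Let r'' i v : int := (p'' i v)%:Z - (p' i v)%:Z.

Definition gluing_value (z : 'I_n.+1 -> K) i :=
  \prod_v (z v ^+ p i v * (1 / (1 - z v)) ^+ p' i v * (1 - 1 / z v) ^+ p'' i v).

Definition local_exponents : 'M[int]_(n, n.+1) :=
  \matrix_(i, v) match I v with
                 | To1 => r'' i v | To0 => r' i v | ToInfinity => - r' i v - r'' i v end.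
(** The exponents of [1 - t], which is [z], [1 - z] or [- (1 - z) / z] in the three cases. *)
Definition local_exponents1 : 'M[int]_(n, n.+1) :=
  \matrix_(i, v) if I v is To1 then r' i v else r'' i v.
(** For [ToInfinity], writing [1 - z = - z (1 - t)] adds the sign of exponent [r''] to that of
    exponent [p''], and [p'' + r''] has the parity of [p']. *)
Definition local_sign i : K :=
  (-1) ^+ \sum_v (if I v is ToInfinity then p' i v else p'' i v).

Lemma local_sign_neq0 i : local_sign i != 0.
Proof. by rewrite expf_neq0 // oppr_eq0 oner_neq0. Qed.

Lemma exprzBn (x : K) (a b : nat) : x != 0 -> x ^ (a%:Z - b%:Z) = x ^+ a / x ^+ b.
Proof. by move=> x0; rewrite expfzDr // -invr_expz. Qed.

Lemma sign_cancel (s1 s2 a b c d e : K) : s1 != 0 -> a != 0 -> b != 0 -> c != 0 -> e != 0 ->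
  s2 * (a / c * (d / e)) = s1 * (b^-1 / a^-1 * (s2 * d / c / (s1 * e / b))).
Proof. by move=> h1 h2 h3 h4 h5; field; rewrite h1 h2 h3 h4 h5 oner_neq0. Qed.

Lemma gluing_factor (z : K) a b c : z != 0 -> z != 1 ->
  z ^+ a * (1 / (1 - z)) ^+ b * (1 - 1 / z) ^+ c =
  (-1) ^+ c * (z ^ (a%:Z - c%:Z) * (1 - z) ^ (c%:Z - b%:Z)).
Proof.
move=> z0 z1; have z1' : 1 - z != 0 by rewrite subr_eq0 eq_sym.
have -> : 1 - 1 / z = (-1) * (1 - z) / z by field.
rewrite !exprzBn // !div1r !exprMn !exprVn.
by field; rewrite !expf_neq0.
Qed.

Lemma gluing_local z : (forall v, z v != 0 /\ z v != 1) -> forall i,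
  gluing_value z i = local_sign i * (monomials (fun v => local_coord (I v) (z v)) local_exponents i *
     monomials (fun v => 1 - local_coord (I v) (z v)) local_exponents1 i).
Proof.
move=> hz i; rewrite /gluing_value /local_sign -prodrXr /monomials -!big_split /=.
apply: eq_bigr => v _; have [z0 z1] := hz v; rewrite gluing_factor // !mxE.
have z1' : 1 - z v != 0 by rewrite subr_eq0 eq_sym.
case: (I v) => /=; rewrite /r' /r'' ?subKr //; first by congr (_ * _); rewrite mulrC.
have -> : 1 - (z v)^-1 = (-1) * (1 - z v) / z v by field.
have -> : - ((p i v)%:Z - (p'' i v)%:Z) - ((p'' i v)%:Z - (p' i v)%:Z) = (p' i v)%:Z - (p i v)%:Z by ring.
rewrite !exprzBn ?mulf_neq0 ?oppr_eq0 ?oner_neq0 ?invr_eq0 //.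
rewrite -[X in X * _ = _]/((-1) ^+ p'' i v) !exprMn !exprVn.
have n1 (k : nat) : (-1 : K) ^+ k != 0 by rewrite expf_neq0 // oppr_eq0 oner_neq0.
by apply: sign_cancel; rewrite ?n1 ?expf_neq0.
Qed.

(** Clearing denominators makes the equation a polynomial one, which can be tested on the ideal of a
    curve as well as along a series. *)
Lemma gluing_polynomial z i : (forall v, z v != 0 /\ z v != 1) ->
  gluing_value z i = 1 <->
  \prod_v (z v ^+ p i v * (z v - 1) ^+ p'' i v) = \prod_v ((1 - z v) ^+ p' i v * z v ^+ p'' i v).
Proof.
move=> hz; set D := \prod_v ((1 - z v) ^+ p' i v * z v ^+ p'' i v).
have D0 : D != 0.
  apply/prodf_neq0 => v _; have [z0 z1] := hz v.
  by rewrite mulf_neq0 // expf_neq0 // subr_eq0 eq_sym.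
have -> : \prod_v (z v ^+ p i v * (z v - 1) ^+ p'' i v) = gluing_value z i * D.
  rewrite /gluing_value /D -big_split /=; apply: eq_bigr => v _; have [z0 z1] := hz v.
  have z1' : 1 - z v != 0 by rewrite subr_eq0 eq_sym.
  have -> : 1 - 1 / z v = (z v - 1) / z v by field.
  rewrite div1r exprMn !exprVn.
  by field; rewrite !expf_neq0.
by split=> [->|/(congr1 (fun x => x / D))]; rewrite ?mul1r // mulfK // divff.
Qed.

Variables (V V' : 'M[int]_n) (U W : 'M[int]_n.+1) (h : 'I_n -> nat).
Hypothesis snf : V *m local_exponents *m U = diag_block (fun i => (h i)%:Z).
Hypotheses (V'V : V' *m V = 1%:M) (UW : U *m W = 1%:M).

Definition system_const m : K := monomials (fun i => (local_sign i)^-1) V m.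
Definition system_exponents : 'M[int]_(n, n.+1) := - (V *m local_exponents1).
(** As [W] is inverse to [U], its first rows give the units [u_m], and its last row gives the
    uniformizer, whose exponents in the [t_v] form the positive column of [U]. *)
Definition unit_coord (t : 'I_n.+1 -> K) (m : 'I_n) := monomials t W (widen_ord (leqnSn n) m).
Definition uniformizer (t : 'I_n.+1 -> K) := monomials t W ord_max.

Lemma monomialsN m k (x : 'I_k -> K) (B : 'M[int]_(m, k)) i : monomials x (- B) i = (monomials x B i)^-1.
Proof. by rewrite /monomials -prodfV; apply: eq_bigr => j _; rewrite mxE invr_expz. Qed.

Lemma local_coordE t v : (forall v, t v != 0) ->
  t v = uniformizer t ^ U v ord_max * \prod_m unit_coord t m ^ U v (widen_ord (leqnSn n) m).
Proof.
move=> t0; rewrite -[LHS](monomials1 t v) -UW -monomials_mul // /monomials big_ord_recr /= mulrC.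
by congr (_ * _).
Qed.

Lemma monomials_diag t m : (forall v, t v != 0) -> 
  monomials t (V *m local_exponents) m = unit_coord t m ^+ h m.
Proof.
move=> t0; rewrite -[local_exponents]mulmx1 -UW !mulmxA snf -monomials_mul //.
rewrite {1}/monomials (bigD1 (widen_ord (leqnSn n) m)) //= mxE eqxx mulr1n big1 ?mulr1 // => j jm.
by rewrite mxE (_ : (_ == _ :> nat) = false) ?mulr0n ?expr0z // eq_sym; apply: negbTE jm.
Qed.

(** [V] has an integral inverse, so combining the equations with exponents [V] loses nothing, and
    [snf] diagonalizes the result. *)
Lemma gluing_system (z : 'I_n.+1 -> K) : (forall v, z v != 0 /\ z v != 1) ->
  let t v := local_coord (I v) (z v) in
  (forall i, gluing_value z i = 1) <->
  (forall m, unit_coord t m ^+ h m = system_const m * \prod_v (1 - t v) ^ system_exponents m v).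
Proof.
move=> hz t; have t0 v : t v != 0 by case: (local_coord_shape (I v) (hz v).1 (hz v).2).
have t1 v : 1 - t v != 0 by case: (local_coord_shape (I v) (hz v).1 (hz v).2).
pose g i := monomials t local_exponents i * monomials (fun v => 1 - t v) local_exponents1 i.
have g0 i : g i != 0 by rewrite mulf_neq0 // monomials_neq0.
have s0 i : (local_sign i)^-1 != 0 by rewrite invr_eq0 local_sign_neq0.
have gE i : gluing_value z i = 1 <-> g i = (local_sign i)^-1.
  rewrite gluing_local // -/(g i); split=> [h1|->]; last by rewrite divff // local_sign_neq0.
  by apply: (mulfI (local_sign_neq0 i)); rewrite h1 divff // local_sign_neq0.
have gV m : monomials g V m = unit_coord t m ^+ h m / \prod_v (1 - t v) ^ system_exponents m v.
  rewrite monomialsM !monomials_mul // monomials_diag //; congr (_ * _).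
  by rewrite -[\prod_v _]/(monomials _ _ _) monomialsN invrK.
have q0 m : \prod_v (1 - t v) ^ system_exponents m v != 0 by apply: monomials_neq0.
split=> [hg m|hs i].
  rewrite -[LHS](divfK (q0 m)) -gV; congr (_ * _); apply: eq_monomials => i; exact/gE.
apply/gE; rewrite -[g i](monomials1 g) -[RHS](monomials1 (fun i => (local_sign i)^-1)) -V'V.
rewrite -!monomials_mul //.
by apply: eq_monomials => m; rewrite gV hs mulfK.
Qed.

End LocalCoordinates.

(** * The curve with a given generic point *)

Section BivariateEvaluation.
Variable F : fieldType.

Lemma eval2_morph (A B : comNzRingType) (phi : {rmorphism A -> B}) (c : F -> A) (x y : A)
    (Q : {poly {poly F}}) :
  phi (map_poly (fun q => (map_poly c q).[x]) Q).[y] =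
  (map_poly (fun q => (map_poly (phi \o c) q).[phi x]) Q).[phi y].
Proof.
rewrite -horner_map -map_poly_comp_id0 ?rmorph0 //; congr (_.[_]); apply: eq_map_poly => q /=.
by rewrite -horner_map -map_poly_comp_id0 ?rmorph0.
Qed.

(** Powers of the outer variable can be divided out because [y] is nonzero. *)
Lemma eval2_nonzero_constant (L : fieldType) (iota : {rmorphism F -> L}) (x y : L) Q :
  y != 0 -> Q != 0 -> eval2 iota x y Q = 0 ->
  exists2 Q' : {poly {poly F}}, Q'`_0 != 0 & eval2 iota x y Q' = 0.
Proof.
move=> y0; have [k] := ubnP (size Q); elim: k Q => // k IH Q sQ Q0 e.
have [Q00|] := eqVneq Q`_0 0; last by exists Q.
have /factor_theorem[Q' QE] : root Q 0 by rewrite rootE horner_coef0 Q00.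
have Q'0 : Q' != 0 by apply: contraNneq Q0 => Q'0; rewrite QE Q'0 mul0r.
apply: (IH Q') => //.
  by move: sQ; rewrite QE size_Mmonic ?monicXsubC // size_XsubC addn2.
move: e; rewrite /eval2; pose ev : {poly F} -> L := horner_eval x \o map_poly iota.
rewrite -!/(ev : _ -> _) -[fun q => _]/(ev : _ -> _) QE polyC0 subr0 rmorphM /= map_polyX hornerMX.
by move/eqP; rewrite mulf_eq0 (negbTE y0) orbF => /eqP.
Qed.

End BivariateEvaluation.

Section SeriesCurve.
Variable F : closedFieldType.
Hypothesis F_fiber : forall f : F -> nat, exists k, infinite_set [set c | f c = k].
Variables (L : fieldType) (iota : {rmorphism F -> L}) (n : nat) (z : 'I_n -> L).
Hypothesis L0 : [pchar L] =i pred0.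
Hypothesis z_shape : forall v, z v != 0 /\ z v != 1.
Hypothesis z_nonconstant : exists v, forall c, z v <> iota c.
Variables (s : seq L) (y : L).
Hypothesis z_derivation : forall v, exists c, forall E D, derivation_on E D ->
  (forall c, E (iota c) /\ D (iota c) = 0) -> (forall x, x \in s -> E x) ->
  E (z v) /\ D (z v) = c * D y.

Definition generic_zero p := mmap iota z p = 0.

Definition generic_curve : set 'rV[F]_n :=
  [set w | shape_space w /\ forall p, generic_zero p -> poly_eval p w = 0]%classic.

Lemma generic_zero_prime : prime_ideal generic_zero.
Proof.
split=> [|/eqP|p q]; last 2 first.
- by rewrite rmorph1 oner_eq0.
- by rewrite /generic_zero rmorphM => /eqP; rewrite mulf_eq0 => /orP[]/eqP; [left|right].
split=> [|p q|r p]; rewrite /generic_zero; first by rewrite raddf0.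
  by rewrite raddfD /= => -> ->; rewrite addr0.
by rewrite rmorphM /= => ->; rewrite mulr0.
Qed.

(** The Nullstellensatz is applied to [p] times all [X v * (X v - 1)]: these factors keep the zero
    inside the shape space and do not vanish at [z]. *)
Lemma generic_curve_vanishes p : vanishes_on generic_curve p <-> generic_zero p.
Proof.
split=> [hp|hp w [_]]; last exact.
apply: contrapT => np.
have [iP n1 pr] := generic_zero_prime.
pose X v : mpoly n F := mpolyX F (mnm1 v).
pose f := p * \prod_v (X v * (X v - 1)).
have nf : ~ generic_zero f.
  move=> /pr[//|]; rewrite /generic_zero rmorph_prod => /eqP; apply/negP/prodf_neq0 => v _.
  by rewrite rmorphM rmorphB rmorph1 /= mmap_mpolyX mulf_neq0 ?subr_eq0; case: (z_shape v).
have nfk k : ~ generic_zero (f ^+ k).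
  by elim: k => [|k IH]; [|rewrite exprS => /pr[]].
have [w [hw fw]] := nullstellensatz F_fiber iP nfk.
move: fw; rewrite mevalM mulf_eq0 negb_or rmorph_prod => /andP[pw /prodf_neq0 /= Xw].
case/eqP: pw; rewrite -(hp (\row_v w v)).
  by apply: meval_eq => v; rewrite mxE.
split=> [v|q /hw <-]; last by apply: meval_eq => v; rewrite mxE.
have := Xw v isT; rewrite mevalM mevalB !mevalXU meval1 mulf_eq0 negb_or subr_eq0 mxE.
by move/andP.
Qed.

Lemma generic_curve_irreducible : irreducible_closed (@affine_closed F n) generic_curve.
Proof.
have [iP n1 pr] := generic_zero_prime.
split; first exact: affine_closed_zero.
  apply: contrapT => h; apply: n1; apply/generic_curve_vanishes => w Cw.
  by case: h; exists w.
move=> A B cA cB AB.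
have [hA|hA] := pselect (forall p, vanishes_on A p -> generic_zero p).
  left=> w Cw; apply/(affine_closedP cA); split; first by case: Cw.
  by move=> p /hA hp; case: Cw => _; apply.
have [hB|hB] := pselect (forall p, vanishes_on B p -> generic_zero p).
  right=> w Cw; apply/(affine_closedP cB); split; first by case: Cw.
  by move=> p /hB hp; case: Cw => _; apply.
have ex T : ~ (forall p, vanishes_on T p -> generic_zero p) -> exists2 p, vanishes_on T p & ~ generic_zero p.
  move=> h; apply: contrapT => h'; apply: h => p hp; apply: contrapT => np; apply: h'; by exists p.
have [p hp np] := ex A hA; have [q hq nq] := ex B hB.
have /generic_curve_vanishes/pr[] // : vanishes_on generic_curve (p * q).
move=> w /AB[Aw|Bw]; rewrite /poly_eval mevalM; first by rewrite [meval _ p](hp w Aw) mul0r.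
by rewrite [meval _ q](hq w Bw) mulr0.
Qed.

Lemma generic_derivation p : exists c, forall E D, derivation_on E D ->
  (forall c, E (iota c) /\ D (iota c) = 0) -> (forall x, x \in s -> E x) ->
  E (mmap iota z p) /\ D (mmap iota z p) = c * D y.
Proof.
elim/mpoly_ring_ind: p => [c|i|p q [c hc] [d hd]|p q [c hc] [d hd]].
- by exists 0 => E D _ hE _; rewrite mmapC mul0r; exact: hE.
- have [c hc] := z_derivation i; exists c => E D h1 h2 h3.
  by rewrite mmap_mpolyX; apply: hc.
- exists (c + d) => E D h1 h2 h3; have [Ep Dp] := hc E D h1 h2 h3; have [Eq Dq] := hd E D h1 h2 h3.
  have [sE DD _] := h1; rewrite raddfD /= DD // Dp Dq mulrDl; split=> //.
  exact: subringD.
exists (c * mmap iota z q + mmap iota z p * d) => E D h1 h2 h3.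
have [Ep Dp] := hc E D h1 h2 h3; have [Eq Dq] := hd E D h1 h2 h3.
have [sE _ DM] := h1; rewrite rmorphM /= DM // Dp Dq; split; last by ring.
exact: subringM.
Qed.

(** [z v] and the value of [p] at [z] are algebraically dependent. A relation whose part free of [p]
    is nonzero becomes, where [p] vanishes, an equation for the coordinate [v] alone. *)
Lemma generic_algebraic p v : ~ generic_zero p ->
  exists2 q : {poly F}, q != 0 &
    forall Z, Z `<=` generic_curve -> vanishes_on Z p -> forall w, Z w -> q.[w 0 v] = 0.
Proof.
move=> /eqP p0; have [cp hp] := generic_derivation p; have [cv hv] := z_derivation v.
have [Q Q0 eQ] : exists2 Q, Q != 0 & eval2 iota (z v) (mmap iota z p) Q = 0.
  apply: (algebraic_dependence L0 (s := s) (y := y) (cf := cv) (ch := cp)) => E D h1 h2 h3 _ _.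
  by split; [case: (hv E D h1 h2 h3)|case: (hp E D h1 h2 h3)].
have [Q' Q'0 eQ'] := eval2_nonzero_constant p0 Q0 eQ.
pose P := (map_poly (fun q => (map_poly (@mpolyC n F) q).[mpolyX F (mnm1 v)]) Q').[p].
exists Q'`_0 => // Z ZC hZ w Zw.
have gP : generic_zero P.
  rewrite /generic_zero /P [LHS]eval2_morph -[RHS]eQ' /eval2; congr (_.[_]).
  apply: eq_map_poly => q; rewrite [X in _.[X]](mmap_mpolyX iota z v); congr (_.[_]).
  by apply: eq_map_poly => c /=; rewrite mmapC.
have [_ /(_ P gP) <-] := ZC w Zw.
rewrite /poly_eval [RHS]eval2_morph [X in _ = _.[X]](hZ w Zw) horner_coef0 coef_map_id0 /=.
  rewrite [X in _ = _.[X]]mevalXU; by rewrite map_poly_id // => c _ /=; rewrite mevalC.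
by rewrite !map_poly0 horner0.
Qed.

(** By [generic_algebraic] each coordinate takes finitely many values on [Z], and by irreducibility
    only one. *)
Lemma proper_closed_point Z : irreducible_closed (@affine_closed F n) Z -> Z `<` generic_curve ->
  exists w, Z = [set w].
Proof.
move=> irrZ [ZC nCZ]; have [cZ [w0 Zw0] _] := irrZ.
have [p hp np] : exists2 p, vanishes_on Z p & ~ generic_zero p.
  apply: contrapT => h; apply: nCZ => w Cw; apply/(affine_closedP cZ); split; first by case: Cw.
  move=> p hp; have [_ ->] // := Cw; apply: contrapT => np; apply: h; by exists p.
have [_ _ pr] := irreducible_vanishes_prime irrZ.
have hcoord v : exists c, forall w, Z w -> w 0 v = c.
  have [q q0 hq] := generic_algebraic v np.
  have [r rE] := closed_field_poly_normal q.
  have : vanishes_on Z (\prod_(c <- r) (mpolyX F (mnm1 v) - mpolyC n c)).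
    move=> w Zw; have /eqP := hq Z ZC hp w Zw.
    rewrite rE hornerZ mulf_eq0 lead_coef_eq0 (negbTE q0) horner_prod => /eqP <-.
    rewrite /poly_eval rmorph_prod; apply: eq_bigr => c _.
    by rewrite /= mevalB mevalXU mevalC hornerXsubC.
  elim: r {rE} => [|c r IH].
    move/(_ w0 Zw0); rewrite big_nil /poly_eval meval1 => /eqP; by rewrite oner_eq0.
  rewrite big_cons => /pr[h|]; last exact: IH.
  exists c => w Zw; apply/eqP; rewrite -subr_eq0; have := h w Zw.
  by rewrite /poly_eval mevalB mevalXU mevalC => ->.
exists w0; rewrite eqEsubset; split=> [w Zw|_ -> //]; apply/rowP => v.
by have [c hc] := hcoord v; rewrite !hc.
Qed.

Lemma point_irreducible (w : 'rV[F]_n) : shape_space w -> irreducible_closed (@affine_closed F n) [set w].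
Proof.
move=> sw; split; last 2 first.
- by exists w.
- by move=> A B _ _ AB; case: (AB w erefl) => h; [left|right] => _ ->.
exists [set p | poly_eval p w = 0]; rewrite eqEsubset; split=> [_ ->|w' [_ h]] //.
apply/rowP => v; apply/eqP; rewrite -subr_eq0.
have e (x : 'rV[F]_n) : poly_eval (mpolyX F (mnm1 v) - mpolyC n (w 0 v)) x = x 0 v - w 0 v.
  by rewrite /poly_eval mevalB mevalXU mevalC.
by rewrite -e h //= e subrr.
Qed.

Lemma generic_curve_irreducible_curve : irreducible_curve (@affine_closed F n) generic_curve.
Proof.
have irr := generic_curve_irreducible; split=> //; last first.
  move=> [Y [Z [irrY irrZ YZ ZC]]]; have [w Zw] := proper_closed_point irrZ ZC.
  have [_ [w' Yw'] _] := irrY; have [YZ' nZY] := YZ.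
  apply: nZY; rewrite Zw => _ ->; have := YZ' _ Yw'; rewrite Zw => <-; exact: Yw'.
have [_ [w Cw] _] := irr; exists [set w]; first by apply: point_irreducible; case: Cw.
split=> [_ -> //|h]; have [v hv] := z_nonconstant.
have : generic_zero (mpolyX F (mnm1 v) - mpolyC n (w 0 v)).
  by apply/generic_curve_vanishes => w' /h ->; rewrite /poly_eval mevalB mevalXU mevalC subrr.
rewrite /generic_zero raddfB /= mmap_mpolyX mmapC => /eqP; rewrite subr_eq0 => /eqP; exact: hv.
Qed.

End SeriesCurve.

(** * Series solutions of the gluing equations *)

Section LogarithmicDerivative.
Variables (L : fieldType) (E : L -> Prop) (D : L -> L).
Hypothesis hD : derivation_on E D.
Let sE : subring_pred E. Proof. by case: hD. Qed.

(** Invertibility inside [E]: the Leibniz rule then applies to inverses too. *)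
Definition inner_unit x := [/\ x != 0, E x & E x^-1].
Definition dlog x := D x / x.

Lemma inner_unitM x y : inner_unit x -> inner_unit y -> inner_unit (x * y).
Proof. by move=> [x0 Ex Ex'] [y0 Ey Ey']; split; rewrite ?mulf_neq0 ?invfM //; apply: subringM. Qed.
Lemma inner_unit1 : inner_unit 1.
Proof. by split; rewrite ?oner_neq0 ?invr1 //; apply: subring1. Qed.
Lemma inner_unitV x : inner_unit x -> inner_unit x^-1.
Proof. by move=> [x0 Ex Ex']; split; rewrite ?invr_eq0 ?invrK. Qed.

Lemma dlogM x y : inner_unit x -> inner_unit y -> dlog (x * y) = dlog x + dlog y.
Proof.
move=> [x0 Ex Ex'] [y0 Ey Ey']; have [_ _ DM] := hD.
by rewrite /dlog DM //; field; rewrite x0 y0.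
Qed.
Lemma dlog1 : dlog 1 = 0.
Proof. by have := dlogM inner_unit1 inner_unit1; rewrite mulr1 -[LHS]addr0 => /addrI. Qed.
Lemma dlogV x : inner_unit x -> dlog x^-1 = - dlog x.
Proof.
move=> ux; have [x0 _ _] := ux; have := dlogM ux (inner_unitV ux).
by rewrite divff // dlog1 => /eqP; rewrite eq_sym addrC addr_eq0 => /eqP.
Qed.
Lemma inner_unitXn x k : inner_unit x -> inner_unit (x ^+ k).
Proof.
by move=> ux; elim: k => [|k IH]; [exact: inner_unit1|rewrite exprS; apply: inner_unitM].
Qed.
Lemma dlogXn x k : inner_unit x -> dlog (x ^+ k) = k%:R * dlog x.
Proof.
move=> ux; elim: k => [|k IH]; first by rewrite dlog1 mul0r.
by rewrite exprS dlogM //; [rewrite IH mulrS mulrDl mul1r|apply: inner_unitXn].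
Qed.
Lemma inner_unitXz x (k : int) : inner_unit x -> inner_unit (x ^ k).
Proof.
by move=> ux; case: k => k; rewrite ?NegzE -?invr_expz; [|apply: inner_unitV]; apply: inner_unitXn.
Qed.
Lemma dlogXz x (k : int) : inner_unit x -> dlog (x ^ k) = k%:~R * dlog x.
Proof.
move=> ux; case: k => k; first exact: dlogXn.
by rewrite NegzE -invr_expz dlogV ?dlogXn; [rewrite mulrNz mulNr| |apply: inner_unitXn].
Qed.
Lemma inner_unit_prod (I : Type) (r : seq I) (G : I -> L) :
  (forall i, inner_unit (G i)) -> inner_unit (\prod_(i <- r) G i).
Proof. by move=> h; apply: big_ind => // [|x y]; [exact: inner_unit1|exact: inner_unitM]. Qed.
Lemma dlog_prod (I : Type) (r : seq I) (G : I -> L) :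
  (forall i, inner_unit (G i)) -> dlog (\prod_(i <- r) G i) = \sum_(i <- r) dlog (G i).
Proof.
move=> h; elim: r => [|i r IH]; first by rewrite !big_nil dlog1.
by rewrite !big_cons dlogM ?IH //; apply: inner_unit_prod.
Qed.
Lemma dlogK x : x != 0 -> D x = dlog x * x.
Proof. by move=> x0; rewrite /dlog divfK. Qed.
Lemma derivation_1B x : E x -> D (1 - x) = - D x.
Proof.
move=> Ex; rewrite (derivationD hD) ?(derivation1 hD) ?(derivationN hD) ?add0r //.
  exact: subring1.
exact: subringN.
Qed.
End LogarithmicDerivative.

(** * Derivations of a solution of the system *)

Section ImplicitDerivation.
Variables (L F : fieldType) (iota : {rmorphism F -> L}).
Variables (n : nat) (h : 'I_n -> nat) (e : 'I_n -> F) (a : 'I_n.+1 -> nat).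
Variables (A : 'M[int]_(n.+1, n)) (Q : 'M[int]_(n, n.+1)).
Variables (y : L) (u : 'I_n -> L) (t : 'I_n.+1 -> L).
Hypotheses (y0 : y != 0) (u0 : forall m, u m != 0).
Hypotheses (t0 : forall v, t v != 0) (t1 : forall v, 1 - t v != 0) (e0 : forall m, e m != 0).
Hypothesis tE : forall v, t v = y ^+ a v * \prod_m u m ^ A v m.
Hypothesis uE : forall m, u m ^+ h m = iota (e m) * \prod_v (1 - t v) ^ Q m v.

(** The coefficient of [dlog (u k)] in the differentiated equation [m], obtained from
    [dlog (1 - t) = - (t / (1 - t)) * dlog t]. *)
Definition log_jacobian : 'M[L]_n := \matrix_(m, k)
  ((h m)%:R *+ (m == k) + \sum_v (Q m v)%:~R * (t v / (1 - t v)) * (A v k)%:~R).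
Hypothesis jac_unit : log_jacobian \in unitmx.

Definition system_gens : seq L :=
  y :: y^-1 :: [seq u m | m <- enum 'I_n] ++ [seq (u m)^-1 | m <- enum 'I_n] ++
  [seq t v | v <- enum 'I_n.+1] ++ [seq (t v)^-1 | v <- enum 'I_n.+1] ++
  [seq (1 - t v)^-1 | v <- enum 'I_n.+1].

(* Logarithmic differentiation of the system determines the [dlog (u m)] as multiples of [dlog y]. *)
Lemma system_derivation v : exists c, forall E D, derivation_on E D ->
  (forall c, E (iota c) /\ D (iota c) = 0) -> (forall x, x \in system_gens -> E x) ->
  [/\ inner_unit E (t v), E (1 - t v) & D (t v) = c * D y].
Proof.
pose b : 'cV[L]_n := \col_m (- \sum_v (Q m v)%:~R * (t v / (1 - t v)) * (a v)%:R).
pose c := invmx log_jacobian *m b.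
pose ct v := t v * ((a v)%:R + \sum_k (A v k)%:~R * c k 0) / y.
exists (ct v) => E D hD hF hs; have sE : subring_pred E by case: hD.
have mem (T : finType) (f : T -> L) x : f x \in [seq f x | x <- enum T].
  by apply: map_f; rewrite mem_enum.
have uy : inner_unit E y by split=> //; apply: hs; rewrite !inE eqxx ?orbT.
have uu m : inner_unit E (u m).
  split=> //.
    by apply: hs; rewrite !inE !mem_cat [in X in _ || X](mem _ u) !orbT.
  by apply: hs; rewrite !inE !mem_cat [in X in _ || X](mem _ (fun m => (u m)^-1)) !orbT.
have ut v' : inner_unit E (t v').
  split=> //.
    by apply: hs; rewrite !inE !mem_cat [in X in _ || X](mem _ t) !orbT.
  by apply: hs; rewrite !inE !mem_cat [in X in _ || X](mem _ (fun v => (t v)^-1)) !orbT.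
have Et v' : E (t v') by case: (ut v').
have ut1 v' : inner_unit E (1 - t v').
  split=> //; first by case: sE => h1 hB _; apply: hB.
  by apply: hs; rewrite !inE !mem_cat [in X in _ || X](mem _ (fun v => (1 - t v)^-1)) !orbT.
pose d := dlog D y; pose x : 'cV[L]_n := \col_m dlog D (u m).
have dt v' : dlog D (t v') = (a v')%:R * d + \sum_k (A v' k)%:~R * x k 0.
  rewrite tE (dlogM hD); last 2 first.
  - exact: (inner_unitXn hD _ uy).
  - by apply: (inner_unit_prod hD) => k; apply: (inner_unitXz hD).
  rewrite (dlogXn hD) // (dlog_prod hD) => [|k]; last exact: (inner_unitXz hD).
  by congr (_ + _); apply: eq_bigr => k _; rewrite (dlogXz hD) // mxE.
have dt1 v' : dlog D (1 - t v') = - (t v' / (1 - t v')) * dlog D (t v').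
  by rewrite /dlog (derivation_1B hD) //; field; rewrite t0 t1.
have xe m : (h m)%:R * x m 0 = \sum_v (Q m v)%:~R * (- (t v / (1 - t v)) * dlog D (t v)).
  rewrite mxE -(dlogXn hD) // uE (dlogM hD); last 2 first.
  - split; first by rewrite fmorph_eq0.
      by case: (hF (e m)).
    by rewrite -fmorphV; case: (hF (e m)^-1).
  - by apply: (inner_unit_prod hD) => k; apply: (inner_unitXz hD).
  rewrite {1}/dlog (hF (e m)).2 mul0r add0r (dlog_prod hD) => [|v']; last exact: (inner_unitXz hD).
  by apply: eq_bigr => v' _; rewrite (dlogXz hD) // dt1.
have jx : log_jacobian *m x = d *: b.
  apply/colP => m; rewrite !mxE.
  transitivity ((h m)%:R * x m 0 +
      \sum_k (\sum_v (Q m v)%:~R * (t v / (1 - t v)) * (A v k)%:~R) * x k 0).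
    under eq_bigr do rewrite mxE mulrDl.
    rewrite big_split; congr (_ + _); rewrite (bigD1 m) //= eqxx big1 ?addr0 // => k km.
    by rewrite eq_sym (negbTE km) mul0r.
  rewrite xe; under [X in _ + X]eq_bigr do rewrite mulr_suml.
  rewrite exchange_big -big_split mulrN mulr_sumr -sumrN /=; apply: eq_bigr => v' _.
  rewrite dt !mulrDr; under [X in _ + X]eq_bigr do rewrite -!mulrA.
  by rewrite -!mulr_sumr; ring.
have xc k : x k 0 = c k 0 * d.
  by rewrite -[x](mulKmx jac_unit) jx -scalemxAr mxE mulrC.
split=> //; first by case: (ut1 v).
rewrite (dlogK _ (t0 v)) dt /ct; under eq_bigr do rewrite xc mulrA.
by rewrite -mulr_suml /d /dlog; field.
Qed.

End ImplicitDerivation.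

(** * Laurent series solutions of the gluing equations *)

Section SeriesSolution.
Variable F : fieldType.
Hypothesis F0 : [pchar F] =i pred0.
Variables (n : nat) (h : 'I_n -> nat) (e : 'I_n -> F) (a : 'I_n.+1 -> nat).
Variables (A : 'M[int]_(n.+1, n)) (Q : 'M[int]_(n, n.+1)) (I : 'I_n.+1 -> limit_value).
Hypotheses (h_gt0 : forall m, (0 < h m)%N) (a_gt0 : forall v, (0 < a v)%N).
Hypothesis e_neq0 : forall m, e m != 0.
Local Notation L := {fraction (fps F)}.

Definition series_const : F -> L := @FracField.tofrac (fps F) \o fpsC.
HB.instance Definition _ := GRing.RMorphism.on series_const.

Lemma series_char0 : [pchar L] =i pred0.
Proof. by move=> p; rewrite (fmorph_pchar series_const). Qed.

Lemma param_tofrac s (u : 'I_n -> fps F) v : (forall m, u m \is a GRing.unit) ->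
  (param a A s u v)%:F = s%:F ^+ a v * \prod_m (u m)%:F ^ A v m :> L.
Proof.
move=> uu; rewrite /param rmorphM rmorphXn rmorph_prod; congr (_ * _).
by apply: eq_bigr => m _; rewrite /= rmorphXz.
Qed.

Lemma system_rhs_tofrac s u m : fconst s = 0 ->
  (system_rhs e a A Q s u m)%:F =
  series_const (e m) * \prod_v (1 - (param a A s u v)%:F) ^ Q m v :> L.
Proof.
move=> s0; rewrite /system_rhs rmorphM rmorph_prod; congr (_ * _).
apply: eq_bigr => v _; rewrite /= rmorphXz ?rmorphB ?rmorph1 //.
by apply/unitfps_1B/fconst_param.
Qed.

Variable u : 'I_n -> fps F.
Hypotheses (uu : forall m, u m \is a GRing.unit) (su : system h e a A Q fX u).
Let t v := param a A fX u v.
Let t0 v : fconst (t v) = 0. Proof. exact: fconst_param. Qed.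

Definition series_coord v : L := local_coord (I v) (t v)%:F.

Lemma param_neq0 v : t v != 0.
Proof.
rewrite mulf_neq0 ?expf_neq0 ?fX_neq0 //; apply/prodf_neq0 => m _.
have := unit_exprz (A v m) (uu m); apply: contraTneq => ->; by rewrite unitr0.
Qed.

Lemma series_param v : (t v)%:F = fX%:F ^+ a v * \prod_m (u m)%:F ^ A v m :> L.
Proof. exact: param_tofrac. Qed.

Lemma series_system m :
  (u m)%:F ^+ h m = series_const (e m) * \prod_v (1 - (t v)%:F) ^ Q m v :> L.
Proof. by rewrite -rmorphXn su; apply: system_rhs_tofrac. Qed.

Lemma series_coord_shape v : series_coord v != 0 /\ series_coord v != 1.
Proof.
have t0' : (t v)%:F != 0 :> L by rewrite tofrac_eq0 param_neq0.
have t1 : (t v)%:F != 1 :> L.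
  rewrite -tofrac1 tofrac_eq; apply/eqP => /(congr1 fconst); rewrite t0 fconst1 => /eqP.
  by rewrite eq_sym oner_eq0.
have [h1 h2] := local_coord_shape (I v) t0' t1; split; first exact: h1.
by rewrite eq_sym -subr_eq0; exact: h2.
Qed.

(** [local_coord] preserves constants, and [t v] is nonzero with constant term 0. *)
Lemma series_coord_nonconstant v c : series_coord v <> series_const c.
Proof.
move=> /(congr1 (local_coord (I v))); rewrite local_coordK.
have tf (f : fps F) : (t v)%:F = f%:F -> fconst f = 0.
  by move=> /eqP; rewrite tofrac_eq => /eqP <-.
rewrite /series_const /=; case: (I v) => /=.
- rewrite -tofrac1 -tofracB => /[dup] e1 /tf; rewrite fconstB fconst1 fconstC => /eqP.
  rewrite subr_eq0 => /eqP c1; move/eqP: e1; rewrite -c1 rmorph1 subrr tofrac_eq.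
  by rewrite (negbTE (param_neq0 v)).
- move=> /[dup] e1 /tf; rewrite fconstC => c0; move/eqP: e1.
  by rewrite c0 rmorph0 tofrac_eq (negbTE (param_neq0 v)).
move=> e1; have c0 : (fpsC c)%:F != 0 :> L.
  apply/eqP => c0; move/eqP: e1; rewrite c0 invr0 tofrac_eq0.
  by rewrite (negbTE (param_neq0 v)).
have : (t v * fpsC c)%:F = (1 : fps F)%:F :> L by rewrite tofracM e1 mulVf ?tofrac1.
move=> /eqP; rewrite tofrac_eq => /eqP /(congr1 fconst); rewrite fconstM t0 mul0r fconst1.
by move/eqP; rewrite eq_sym oner_eq0.
Qed.

Let w v := t v / (1 - t v).
Let w0 v : fconst (w v) = 0. Proof. by rewrite fconstM t0 mul0r. Qed.

Let jac : 'M[fps F]_n := \matrix_(m, k)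
  ((h m)%:R *+ (m == k) + \sum_v (Q m v)%:~R * w v * (A v k)%:~R).

Let jacL : 'M[L]_n := map_mx (@FracField.tofrac (fps F)) jac.

(** When the uniformizer is set to 0 the [t v] vanish, and the matrix becomes diagonal with entries
    [h m], nonzero in characteristic 0. *)
Let jacL_unit : jacL \in unitmx.
Proof.
rewrite unitmxE /jacL det_map_mx unitfE tofrac_eq0.
have : fconst (\det jac) != 0.
  rewrite -[fconst _](det_map_mx fconst).
  have -> : map_mx fconst jac = diag_mx (\row_m (h m)%:R).
    apply/matrixP => m k; rewrite !mxE fconstD fconst_sum big1 ?addr0 => [|v _].
      by rewrite rmorphMn rmorph_nat.
    have w1 : fconst ((Q m v)%:~R * w v) = 0 by rewrite fconstM [X in _ * X]w0 mulr0.
    by rewrite fconstM w1 mul0r.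
  rewrite det_diag; apply/prodf_neq0 => m _; rewrite mxE.
  by have /pcharf0P -> := F0; rewrite -lt0n.
by apply: contraNneq => ->; rewrite rmorph0.
Qed.

Definition series_gens : seq L := system_gens fX%:F (fun m => (u m)%:F) (fun v => (t v)%:F).

Let jac_map : log_jacobian h A Q (fun v => (t v)%:F : L) = jacL.
Proof.
apply/matrixP => m k; rewrite !mxE [RHS]rmorphD rmorphMn rmorph_nat [in RHS]rmorph_sum.
congr (_ + _); apply: eq_bigr => v _; rewrite [RHS]rmorphM rmorph_int; congr (_ * _).
rewrite [RHS]rmorphM rmorph_int; congr (_ * _); rewrite [RHS]tofracM; congr (_ * _).
by rewrite [RHS]rmorphV; [rewrite rmorphB rmorph1|apply: unitfps_1B].
Qed.

Lemma series_derivation v : exists c, forall E D, derivation_on E D ->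
  (forall c, E (series_const c) /\ D (series_const c) = 0) ->
  (forall x, x \in series_gens -> E x) ->
  E (series_coord v) /\ D (series_coord v) = c * D fX%:F.
Proof.
have y0 : fX%:F != 0 :> L by rewrite tofrac_eq0 fX_neq0.
have u0 m : (u m)%:F != 0 :> L.
  by rewrite tofrac_eq0; apply: contraTneq (uu m) => ->; rewrite unitr0.
have tn v' : (t v')%:F != 0 :> L by rewrite tofrac_eq0 param_neq0.
have t1n v' : 1 - (t v')%:F != 0 :> L.
  rewrite -tofrac1 -tofracB tofrac_eq0; apply: contraTneq (unitfps_1B (t0 v')) => ->.
  by rewrite unitr0.
have ju := jacL_unit; rewrite -jac_map in ju.
have [c hc] := system_derivation y0 u0 tn t1n e_neq0 series_param series_system ju v.
exists (match I v with To1 => - c | To0 => c | ToInfinity => - c / (t v)%:F ^+ 2 end).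
move=> E D hD hF hs; have [[tv0 Et Et'] Et1 Dt] := hc E D hD hF hs.
rewrite /series_coord; move: tv0 Et Et' Et1 Dt; move: (t v)%:F => x x0 Ex Ex' Ex1 Dx.
case: (I v) => /=; split=> //; first by rewrite (derivation_1B hD) // Dx mulNr.
by rewrite (dlogK _ (invr_neq0 x0)) (dlogV hD) // /dlog Dx expr2 invfM; ring.
Qed.

End SeriesSolution.

(** * Branches of the smooth model *)

(** Substituting [s] is a morphism only under a hypothesis on [s]; this packages it where that
    hypothesis is available. *)
Lemma rmorphism_ex (R S : nzRingType) (f : R -> S) : zmod_morphism f -> monoid_morphism f ->
  exists g : {rmorphism R -> S}, g =1 f.
Proof.
move=> fz fm; pose z := GRing.isZmodMorphism.Build _ _ f fz.
pose m := GRing.isMonoidMorphism.Build _ _ f fm.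
by pose g : {rmorphism R -> S} := HB.pack f z m; exists g.
Qed.

(** * Orders of Laurent series and change of uniformizer *)

Section LaurentSeries.
Variable F : fieldType.
Local Notation L := {fraction (fps F)}.
Implicit Types (f g : fps F) (x y : L).

Lemma tofrac_inj f g : f%:F = g%:F :> L -> f = g.
Proof. by move=> /eqP; rewrite tofrac_eq => /eqP. Qed.

Lemma unitfps_neq0 f : f \is a GRing.unit -> f != 0.
Proof. by apply: contraTneq => ->; rewrite unitr0. Qed.

Lemma laurent_order x : x != 0 -> exists N M g, g \is a GRing.unit /\
  x * (fX ^+ M)%:F = (fX ^+ N * g)%:F.
Proof.
have [a [b [b0 ->]]] := fraction_ex x; have [->|a0 _] := eqVneq a 0.
  by rewrite tofrac0 mul0r eqxx.
have [N [g [ug ->]]] := fps_order a0; have [M [k [uk bE]]] := fps_order b0.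
exists N, M, (g / k); split; first by rewrite unitrM ug unitrV.
apply: (mulIf (x := k%:F)); first by rewrite tofrac_eq0 unitfps_neq0.
have bF : b%:F = (fX ^+ M)%:F * k%:F :> L by rewrite -tofracM -bE.
rewrite -[LHS]mulrA -bF divfK ?tofrac_eq0 // -tofracM; congr (_%:F).
by rewrite -mulrA divrK.
Qed.

Lemma fXn_unit_eq N M f g : f \is a GRing.unit -> g \is a GRing.unit ->
  fX ^+ N * f = fX ^+ M * g -> N = M.
Proof.
have half k l (f' g' : fps F) : f' \is a GRing.unit -> fX ^+ k * f' = fX ^+ l * g' -> (l <= k)%N.
  move=> uf e; rewrite leqNgt; apply/negP => kl.
  have fE : f' = fX * (fX ^+ (l - k).-1 * g').
    apply: (mulfI (fXn_neq0 F k)); rewrite e mulrA -exprS prednK ?subn_gt0 // mulrA -exprD.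
    by rewrite subnKC // ltnW.
  by move: uf; rewrite unitfpsE fE fconstM mul0r eqxx.
by move=> uf ug e; apply/eqP; rewrite eqn_leq (half _ _ _ _ uf e) (half _ _ _ _ ug (esym e)).
Qed.

(** [h] times the order of [x] is the order of a unit, which is 0. *)
Lemma laurent_root x h f : (0 < h)%N -> f \is a GRing.unit -> x ^+ h = f%:F ->
  exists2 g, g \is a GRing.unit & x = g%:F.
Proof.
move=> h0 uf e; have x0 : x != 0.
  apply/eqP => x0; move: e; rewrite x0 expr0n eqn0Ngt h0 => /esym/eqP.
  by rewrite tofrac_eq0 (negbTE (unitfps_neq0 uf)).
have [N [M [g [ug xE]]]] := laurent_order x0.
have : (fX ^+ (M * h) * f)%:F = (fX ^+ (N * h) * g ^+ h)%:F :> L.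
  have e2 : (x * (fX ^+ M)%:F) ^+ h = ((fX ^+ N * g) ^+ h)%:F by rewrite xE rmorphXn.
  by rewrite !exprM -[in RHS]exprMn -e2 exprMn e tofracM mulrC; congr (_ * _); exact: rmorphXn.
move=> /tofrac_inj /fXn_unit_eq H; have {H} MN : (M * h = N * h)%N by apply: H; rewrite ?unitrX.
have {}MN : M = N by apply/eqP; rewrite -(eqn_pmul2r h0) MN.
exists g => //; apply: (mulIf (x := (fX ^+ M)%:F)); first by rewrite tofrac_eq0 fXn_neq0.
by rewrite xE MN -tofracM mulrC.
Qed.

(** [a] times the order of [x] is the order of [g], which is positive. *)
Lemma laurent_positive x a f g : f \is a GRing.unit -> fconst g = 0 -> g != 0 ->
  x ^+ a * f%:F = g%:F -> exists s, [/\ fconst s = 0, s != 0 & x = s%:F].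
Proof.
move=> uf g0 gn e; have a0 : (0 < a)%N.
  case: a e => // /esym; rewrite expr0 mul1r => /tofrac_inj fg.
  by move: uf; rewrite -fg unitfpsE g0 eqxx.
have x0 : x != 0.
  apply/eqP => x0; move: e; rewrite x0 expr0n eqn0Ngt a0 mul0r => /esym/eqP.
  by rewrite tofrac_eq0 (negbTE gn).
have [N [M [k [uk xE]]]] := laurent_order x0.
have [[|N'] [g' [ug' gE]]] := fps_order gn.
  by move: g0; rewrite gE expr0 mul1r => g'0; move: ug'; rewrite unitfpsE g'0 eqxx.
have : (fX ^+ (N * a) * (k ^+ a * f))%:F = (fX ^+ (M * a + N'.+1) * g')%:F :> L.
  have e2 : (x * (fX ^+ M)%:F) ^+ a = ((fX ^+ N * k) ^+ a)%:F by rewrite xE rmorphXn.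
  have e3 : (fX ^+ M)%:F ^+ a = ((fX ^+ M) ^+ a)%:F :> L by rewrite [RHS]rmorphXn.
  rewrite mulrA exprM -exprMn tofracM -e2 exprMn mulrAC e e3 -tofracM gE exprD exprM.
  by congr (_%:F); rewrite mulrC mulrA.
move=> /tofrac_inj /fXn_unit_eq H.
have {H} MN : (N * a = M * a + N'.+1)%N by apply: H; rewrite ?unitrM ?unitrX.
have NM : (M < N)%N by rewrite -(ltn_pmul2r a0) MN -addSnnS leq_addr.
exists (fX ^+ (N - M) * k); split.
- by rewrite fconstM fconstXn expr0n subn_eq0 leqNgt NM mul0r.
- by rewrite mulf_neq0 ?fXn_neq0 ?unitfps_neq0.
apply: (mulIf (x := (fX ^+ M)%:F)); first by rewrite tofrac_eq0 fXn_neq0.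
by rewrite xE -tofracM; congr (_%:F); rewrite mulrAC -exprD subnK // ltnW.
Qed.

(** Dividing by an entry of least order gives a projective point over Laurent series power series
    coordinates, one of them 1; their constant terms are then the coordinates of its centre. *)
Lemma laurent_normalize m (x : 'I_m -> L) : (exists j, x j != 0) ->
  exists i0 (b : 'I_m -> fps F), [/\ b i0 = 1, x i0 != 0 & forall j, x j = x i0 * (b j)%:F].
Proof.
move=> [j0 xj0]; have /choice[N hN] j := fraction_ex (x j).
have /choice[D hD] := hN; pose d := \prod_j D j.
have D0 j : D j != 0 by case: (hD j).
have d0 : d != 0 by apply/prodf_neq0.
pose f j := N j * \prod_(k | k != j) D k.
have fE j : x j * d%:F = (f j)%:F.
  rewrite /d (bigD1 j) //= !tofracM (hD j).2 mulrA divfK // tofrac_eq0; exact: D0.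
have fj0 : f j0 != 0 by rewrite -tofrac_eq0 -fE mulf_neq0 // tofrac_eq0; exact: d0.
have ex : exists k, `[< exists i, ~ fdvdX k.+1 (f i) >].
  apply: contrapT => h; case/eqP: fj0; apply: fdvdX_eq0 => -[|k]; first by exists (f j0); rewrite mul1r.
  by apply: contrapT => hk; apply: h; exists k; apply/asboolP; exists j0.
have [K /asboolP[i0 hi0] Kmin] := ex_minnP ex.
have /choice[g hg] j : exists g, f j = fX ^+ K * g.
  case: K Kmin {hi0} => [|K] Kmin; first by exists (f j); rewrite mul1r.
  apply: contrapT => h; have := Kmin K; rewrite ltnn => H; apply: notF; apply: H.
  by apply/asboolP; exists j.
have ug : g i0 \is a GRing.unit.
  rewrite unitfpsE; apply/eqP => /fdvdX1[g' gE]; apply: hi0; exists g'.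
  by rewrite hg gE expr1 mulrA -exprSr.
exists i0, (fun j => g j / g i0); split; first by rewrite divrr.
  apply: contraTneq ug => x0; move: (fE i0); rewrite x0 mul0r -tofrac0 => /tofrac_inj.
  by rewrite hg => /esym/eqP; rewrite mulf_eq0 (negbTE (fXn_neq0 _ _)) => /eqP ->; rewrite unitr0.
move=> j; apply: (mulIf (x := d%:F)); first by rewrite tofrac_eq0.
by rewrite mulrAC !fE -tofracM !hg; congr (_%:F); rewrite -mulrA [g i0 * _]mulrC divrK.
Qed.

Lemma series_subst (s : fps F) : fconst s = 0 -> s != 0 ->
  exists phi : {rmorphism L -> L}, forall f, phi f%:F = (fcomp s f)%:F.
Proof.
move=> s0 sn.
have [fc fcE] := rmorphism_ex (fcomp_zmod s0) (fcomp_monoid s0).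
have inj : injective fc by move=> f g; rewrite !fcE; apply: fcomp_inj.
have [phi phiE] := rmorphism_ex (fraction_map_zmod inj) (fraction_map_monoid inj).
by exists phi => f; rewrite phiE fraction_map_tofrac // fcE.
Qed.

End LaurentSeries.

Lemma mmap_morph n (F A B : comNzRingType) (iota : {rmorphism F -> A}) (iota' : {rmorphism F -> B})
    (phi : {rmorphism A -> B}) (w : 'I_n -> A) (w' : 'I_n -> B) p :
  (forall c, phi (iota c) = iota' c) -> (forall i, phi (w i) = w' i) ->
  phi (mmap iota w p) = mmap iota' w' p.
Proof.
move=> hc hw; elim/mpoly_ring_ind: p => [c|i|p q hp hq|p q hp hq].
- by rewrite !mmapC hc.
- by rewrite !mmapX !mmap1U hw.
- by rewrite !rmorphD /= hp hq.
- by rewrite !rmorphM /= hp hq.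
Qed.

Lemma phi_mmap n (F : comNzRingType) (A : comNzRingType) (iota : {rmorphism F -> A})
    (phi : {rmorphism A -> A}) (w : 'I_n -> A) p : (forall c, phi (iota c) = iota c) ->
  mmap iota (phi \o w) p = phi (mmap iota w p).
Proof. by move=> h; symmetry; apply: mmap_morph. Qed.

Lemma mmap_cross n (F A : comNzRingType) (iota : {rmorphism F -> A}) (w : 'I_n -> A) i j p q :
  mmap iota w (mpolyX F (mnm1 i) * p - mpolyX F (mnm1 j) * q) =
  w i * mmap iota w p - w j * mmap iota w q.
Proof. by rewrite raddfB /= !rmorphM /= !mmapX !mmap1U. Qed.

Lemma mmap_series (F : fieldType) n (b : 'I_n -> fps F) p :
  (mmap (@fpsC F) b p)%:F = mmap (@series_const F) (fun i => (b i)%:F) p.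
Proof. exact: mmap_morph. Qed.

Lemma fconst_mmap (F : fieldType) n (b : 'I_n -> fps F) p :
  fconst (mmap (@fpsC F) b p) = poly_eval p (\row_i fconst (b i)).
Proof. by apply: (mmap_morph (iota' := idfun)) => [c|i] //=; rewrite mxE. Qed.

(** * Lifting a generic point to the smooth model *)

Section GenericBranch.
Variables (F : fieldType) (n : nat) (C : set 'rV[F]_n).
Hypothesis irrC : irreducible_closed (@affine_closed F n) C.
Variable M : smooth_model (projective_completion C).
Local Notation X := (@sm_curve _ _ _ M).
Local Notation m := (@sm_dim _ _ _ M).
Local Notation L := {fraction (fps F)}.
Variable z : 'I_n -> L.
Hypothesis hz : forall p, vanishes_on C p <-> mmap (@series_const F) z p = 0.

(* [b] is the branch of the smooth model parametrized by [z]; by the last clause, any branch whose affine coordinates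
   are obtained from [z] by a change of uniformizer has the same centre. *)
Lemma generic_branch : exists (b : 'I_m.+1 -> fps F) i0,
  [/\ b i0 = 1,
      forall d p, homogeneous d p -> vanishes X p <-> mmap (@fpsC F) b p = 0,
      forall x d G e h, X x -> represents x d G e h -> forall v,
        (mmap (@fpsC F) b (G (lift ord0 v)))%:F = z v * (mmap (@fpsC F) b (G ord0))%:F &
      forall x d G e h (g : 'I_m.+1 -> fps F) (psi : fps F -> fps F) (phi : {rmorphism L -> L}),
        X x -> represents x d G e h ->
        (forall d p, homogeneous d p -> vanishes X p <-> mmap (@fpsC F) g p = 0) ->
        (forall f, fconst (psi f) = fconst f) -> (forall c, psi (fpsC c) = fpsC c) ->
        (forall f, phi f%:F = (psi f)%:F) ->
        (forall v, (mmap (@fpsC F) g (G (lift ord0 v)))%:F =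
                   phi (z v) * (mmap (@fpsC F) g (G ord0))%:F) ->
        forall i j, fconst (g i) * fconst (b j) = fconst (g j) * fconst (b i)].
Proof.
have [d' [H [e' [k [a [hA [[hH hk] [hhA nhA] k_ex inv_ex inv_id]]]]]]] := inverse_exists M.
(* [beta] is the image of the generic point under the inverse map; [b] will be its normalization. *)
pose H1 j := dehom (H j); pose beta j := mmap (@series_const F) z (H1 j).
have beta0 : exists j, beta j != 0.
  have [j nj] := inverse_vanishesN k_ex inv_ex; exists j; apply/eqP => b0.
  by apply: nj; apply/hz.
have [i0 [b [b1 x0 bE]]] := laurent_normalize beta0.
have betaE d p : homogeneous d p ->
    mmap (@series_const F) beta p = beta i0 ^+ d * (mmap (@fpsC F) b p)%:F.
  by move=> hp; rewrite mmap_series -(homogeneous_mmap _ _ _ hp); apply: eq_mmap.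
have [cX [x1 Xx1] _] := model_irreducible M.
have [d1 [G1 [e1 [h1 rep1]]]] := represents_exists Xx1.
have Xb d p : homogeneous d p -> vanishes X p <-> mmap (@fpsC F) b p = 0.
  move=> hp; rewrite (rep_inverse_vanishes irrC hk hhA nhA k_ex inv_ex inv_id Xx1 rep1 hp) hz.
  rewrite mmap_comp -/beta (betaE _ _ hp); split=> [/eqP|->]; last by rewrite tofrac0 mulr0.
  by rewrite mulf_eq0 expf_eq0 (negbTE x0) andbF /= tofrac_eq0 => /eqP.
exists b, i0; split=> // [x d G e h Xx rep v|x d G e h g psi phi Xx rep gX psi0 psiC hphi gz i j].
  have [hG _ _ _] := rep.
  have /hz := rep_inverse_id irrC hk hhA nhA k_ex inv_ex inv_id Xx rep v.
  rewrite raddfB /= rmorphM /= mmap_mpolyX !mmap_comp -!/beta => /eqP; rewrite subr_eq0.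
  rewrite !(betaE _ _ (hG _)) mulrCA => /eqP /mulfI; apply.
  by rewrite expf_neq0.
have [hG _ _ _] := rep.
pose D := \max_j msize (H1 j).
have sD j' : (msize (H1 j') <= D.+1)%N by apply: leqW; apply: (leq_bigmax (F := fun j => msize (H1 j))).
pose hs j := homog_subst (G ord0) (fun v => G (lift ord0 v)) D (H1 j).
have hhs l : homogeneous (d * D) (hs l) by apply: homog_subst_homogeneous.
have hp : homogeneous (1 + d * D) (mpolyX F (mnm1 i) * hs j - mpolyX F (mnm1 j) * hs i).
  by apply: homogeneousB; apply: homogeneousM => //; apply: homogeneousX.
(* Read along [g], this identity says that [g] is proportional to the transform of [b] by [psi];
   constant terms, which [psi] preserves, then compare the centres. *)
have /(gX _ _ hp) := rep_inverse_prop irrC hk hhA nhA k_ex inv_ex inv_id Xx rep i j sD.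
rewrite mmap_cross => /subr0_eq eij.
have G0 : (mmap (@fpsC F) g (G ord0))%:F != 0 :> L.
  rewrite tofrac_eq0; apply/eqP => /(gX _ _ (hG ord0)).
  exact: (rep0_vanishesN irrC hk hhA nhA k_ex inv_ex inv_id Xx rep).
have phiC c : phi (series_const c) = series_const c by rewrite [LHS]hphi psiC.
have hsE l : (mmap (@fpsC F) g (hs l))%:F =
    (mmap (@fpsC F) g (G ord0))%:F ^+ D * phi (beta i0) * (psi (b l))%:F.
  have G0' := G0; rewrite mmap_series in G0'.
  rewrite mmap_series (homog_subst_mmap _ G0' (sD l)) -mmap_series -[RHS]mulrA; congr (_ * _).
  rewrite -hphi -(rmorphM phi) -bE -(phi_mmap _ _ phiC); apply: eq_mmap => v.
  by rewrite -!mmap_series gz [LHS]mulfK //; exact: G0.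
have {eij} : (g i * psi (b j))%:F = (g j * psi (b i))%:F :> L.
  apply: (mulfI (x := (mmap (@fpsC F) g (G ord0))%:F ^+ D * phi (beta i0))).
    apply: mulf_neq0; first exact: (expf_neq0 D G0).
    by rewrite fmorph_eq0; exact: x0.
  by rewrite !tofracM ![_ * (_%:F * _)]mulrCA -!hsE -!tofracM eij.
by move=> /tofrac_inj /(congr1 fconst); rewrite !fconstM !psi0.
Qed.

End GenericBranch.

(** * The coordinates given by the Smith normal form *)

Section MonomialCoordinates.
Variables (n : nat) (U W : 'M[int]_n.+1).
Hypothesis WU : W *m U = 1%:M.
Hypothesis U_gt0 : forall v, 0 < U v ord_max.

Definition uniformizer_exponents v := absz (U v ord_max).
Definition unit_exponents : 'M[int]_(n.+1, n) := \matrix_(v, m) U v (widen_ord (leqnSn n) m).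

Lemma uniformizer_exponents_gt0 v : (0 < uniformizer_exponents v)%N.
Proof. by rewrite absz_gt0 lt0r_neq0. Qed.

Lemma local_coord_param (K : fieldType) (t : 'I_n.+1 -> K) v : U *m W = 1%:M -> (forall v, t v != 0) ->
  t v = uniformizer W t ^+ uniformizer_exponents v * \prod_m unit_coord W t m ^ unit_exponents v m.
Proof.
move=> UW t0; rewrite {1}(local_coordE UW v t0); congr (_ * _); last first.
  by apply: eq_bigr => m _; rewrite mxE.
by rewrite /uniformizer_exponents -[in LHS](gez0_abs (ltW (U_gt0 v))).
Qed.

(** [t] is the monomial transform by [U] of the vector made of [u] followed by [y], and [W] undoes
    it. *)
Lemma param_coord (K : fieldType) (t : 'I_n.+1 -> K) (y : K) (u : 'I_n -> K) :
  y != 0 -> (forall m, u m != 0) ->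
  (forall v, t v = y ^+ uniformizer_exponents v * \prod_m u m ^ unit_exponents v m) ->
  forall m, unit_coord W t m = u m.
Proof.
move=> y0 u0 tE m; pose w j := oapp u y (unlift ord_max j).
have wm k : w (widen_ord (leqnSn n) k) = u k.
  have -> : widen_ord (leqnSn n) k = lift ord_max k by apply: val_inj; rewrite /= /bump leqNgt ltn_ord.
  by rewrite /w liftK.
have wmax : w ord_max = y by rewrite /w unlift_none.
have w0 j : w j != 0 by rewrite /w; case: (unlift _ _) => [k|] /=; [exact: u0|exact: y0].
have tw v : t v = monomials w U v.
  rewrite tE /monomials big_ord_recr /= wmax mulrC; congr (_ * _).
    by apply: eq_bigr => k _; rewrite wm mxE.
  by rewrite /uniformizer_exponents -[in RHS](gez0_abs (ltW (U_gt0 v))).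
by rewrite /unit_coord (eq_monomials _ _ tw) monomials_mul // WU monomials1 wm.
Qed.

End MonomialCoordinates.

Section GluingPolynomial.
Variables (F : fieldType) (n : nat) (p p' p'' : 'I_n -> 'I_n.+1 -> nat).

Definition gluing_poly i : mpoly n.+1 F :=
  let X v := mpolyX F (mnm1 v) in
  \prod_v (X v ^+ p i v * (X v - 1) ^+ p'' i v) - \prod_v ((1 - X v) ^+ p' i v * X v ^+ p'' i v).

Lemma gluing_polyP (K : fieldType) (iota : {rmorphism F -> K}) (z : 'I_n.+1 -> K) i :
  (forall v, z v != 0 /\ z v != 1) ->
  gluing_value p p' p'' z i = 1 <-> mmap iota z (gluing_poly i) = 0.
Proof.
move=> hz; rewrite (gluing_polynomial _ _ _ _ hz) /gluing_poly raddfB /= !rmorph_prod /=.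
rewrite [X in _ <-> X - _ = 0](eq_bigr (fun v => z v ^+ p i v * (z v - 1) ^+ p'' i v)) => [|v _]; last first.
  by rewrite rmorphM !rmorphXn rmorphB rmorph1 /= mmap_mpolyX.
rewrite [X in _ <-> _ - X = 0](eq_bigr (fun v => (1 - z v) ^+ p' i v * z v ^+ p'' i v)) => [|v _]; last first.
  by rewrite rmorphM !rmorphXn rmorphB rmorph1 /= mmap_mpolyX.
by split=> [->|/subr0_eq//]; rewrite subrr.
Qed.

Lemma system_const_morph (K : fieldType) (iota : {rmorphism F -> K}) I (V : 'M[int]_n) m :
  iota (system_const F p' p'' I V m) = system_const K p' p'' I V m.
Proof.
rewrite /system_const /monomials rmorph_prod; apply: eq_bigr => j _.
by rewrite fmorphXz fmorphV /local_sign rmorphXn rmorphN1.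
Qed.

End GluingPolynomial.

(** * Laurent monomials as quotients of forms *)

Section NumeratorDenominator.
Variables (K : fieldType) (n : nat) (W : 'I_n -> int) (x y t : 'I_n -> K).

(** The numerator of the Laurent monomial in the [x v / y v] with exponents [W]; exchanging [x] and
    [y] gives the denominator. No inverse occurs, so it makes sense for polynomials. *)
Definition split_prod (R : nzRingType) (x y : 'I_n -> R) (W : 'I_n -> int) : R :=
  \prod_v (if W v is Posz k then x v ^+ k else y v ^+ absz (W v)).

Lemma split_prodE : (forall v, y v != 0) -> (forall v, t v != 0) -> (forall v, x v = t v * y v) ->
  split_prod x y W = (\prod_v t v ^ W v) * split_prod y x W.
Proof.
move=> y0 t0 xE; rewrite /split_prod -big_split; apply: eq_bigr => v _ /=; rewrite xE.
case: (W v) => k; first by rewrite exprMn.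
by rewrite NegzE -invr_expz exprMn abszN absz_nat mulKf // expf_neq0.
Qed.

Lemma split_prod_neq0 : (forall v, x v != 0) -> (forall v, y v != 0) -> split_prod x y W != 0.
Proof.
by move=> x0 y0; apply/prodf_neq0 => v _; case: (W v) => k; rewrite expf_neq0.
Qed.

End NumeratorDenominator.

Section LocalRatio.
Variable F : fieldType.

(** For [z = g / g0], numerator and denominator of the local coordinate; both are linear in [g0] and
    [g], which keeps them homogeneous. *)
Definition local_num (R : pzRingType) (a : limit_value) (g0 g : R) : R :=
  match a with To1 => g0 - g | To0 => g | ToInfinity => g0 end.
Definition local_den (R : pzRingType) (a : limit_value) (g0 g : R) : R :=
  match a with To1 => g0 | To0 => g0 | ToInfinity => g end.

Lemma local_ratio (K : fieldType) a (z g0 g : K) : z != 0 -> g = z * g0 ->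
  local_num a g0 g = local_coord a z * local_den a g0 g.
Proof. by move=> z0 ->; case: a => //=; [rewrite mulrBl mul1r|rewrite mulKf]. Qed.

Lemma local_den_neq0 (K : fieldType) a (z g0 g : K) : z != 0 -> g0 != 0 -> g = z * g0 ->
  local_den a g0 g != 0.
Proof. by move=> z0 g00 ->; case: a => //=; rewrite mulf_neq0. Qed.

Lemma local_num_morph (R S : pzRingType) (phi : {rmorphism R -> S}) a g0 g :
  phi (local_num a g0 g) = local_num a (phi g0) (phi g).
Proof. by case: a => //=; rewrite rmorphB. Qed.
Lemma local_den_morph (R S : pzRingType) (phi : {rmorphism R -> S}) a g0 g :
  phi (local_den a g0 g) = local_den a (phi g0) (phi g).
Proof. by case: a. Qed.

Lemma split_prod_morph n (R S : nzRingType) (phi : {rmorphism R -> S}) (x y : 'I_n -> R) W :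
  phi (split_prod x y W) = split_prod (phi \o x) (phi \o y) W.
Proof.
rewrite /split_prod; elim/big_rec2: _ => [|v _ a _ <-]; first by rewrite rmorph1.
by rewrite rmorphM; case: (W v) => k; rewrite rmorphXn.
Qed.

Lemma eq_split_prod n (R : nzRingType) (x y x' y' : 'I_n -> R) W : x =1 x' -> y =1 y' ->
  split_prod x y W = split_prod x' y' W.
Proof. by move=> hx hy; apply: eq_bigr => v _; rewrite hx hy. Qed.

Lemma local_limit a (t f g : fps F) (z : {fraction (fps F)}) : fconst t = 0 ->
  z = local_coord a t%:F -> t != 0 -> f%:F = z * g%:F ->
  match a with To1 => fconst f = fconst g | To0 => fconst f = 0 | ToInfinity => fconst g = 0 end.
Proof.
move=> t0 -> tn; case: a => /=.
- rewrite -tofrac1 -tofracB -tofracM => /tofrac_inj ->.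
  by rewrite fconstM fconstB fconst1 t0 subr0 mul1r.
- by rewrite -tofracM => /tofrac_inj ->; rewrite fconstM t0 mul0r.
move=> e; have : (t * f)%:F = g%:F :> {fraction (fps F)}.
  by rewrite tofracM e mulVKf // tofrac_eq0.
by move=> /tofrac_inj <-; rewrite fconstM t0 mul0r.
Qed.

End LocalRatio.

(** * Ideal points and solutions of the initial equations *)

Lemma fconst0 (F : fieldType) : fconst (0 : fps F) = 0.
Proof. by []. Qed.

Section BranchSeries.
Variables (F : fieldType) (n : nat) (C : set 'rV[F]_n).
Hypothesis irrC : irreducible_closed (@affine_closed F n) C.
Variable M : smooth_model (projective_completion C).
Local Notation X := (@sm_curve _ _ _ M).
Local Notation L := {fraction (fps F)}.

(** [rep_subst_vanishes] turns a polynomial on [C] into a form on the model, which [b] tests; so the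
    affine coordinates along [b] are a generic point of [C]. *)
Lemma branch_series x d G k g (b : 'I_(sm_dim M).+1 -> fps F) : X x -> represents x d G k g ->
  (forall d q, homogeneous d q -> mmap (@fpsC F) b q = 0 <-> vanishes X q) ->
  let g0 := (mmap (@fpsC F) b (G ord0))%:F : L in
  g0 != 0 /\ forall q, vanishes_on C q <->
    mmap (@series_const F) (fun v => (mmap (@fpsC F) b (G (lift ord0 v)))%:F / g0) q = 0.
Proof.
move=> Xx rep Xb g0; have [hG _ _ _] := rep.
have [d' [H [e' [k' [a' [hA' [[_ hk] [hhA nhA] k_ex inv_ex inv_id]]]]]]] := inverse_exists M.
have g00 : g0 != 0.
  rewrite tofrac_eq0; apply/eqP => /(Xb _ _ (hG ord0)).
  exact: (rep0_vanishesN irrC hk hhA nhA k_ex inv_ex inv_id Xx rep).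
split=> // q; have sq : (msize q <= (msize q).+1)%N by [].
have hh : homogeneous (d * msize q) (homog_subst (G ord0) (fun v => G (lift ord0 v)) (msize q) q).
  by apply: homog_subst_homogeneous.
rewrite -(rep_subst_vanishes irrC hk hhA nhA k_ex inv_ex inv_id Xx rep sq) -(Xb _ _ hh).
have g00' := g00; rewrite /g0 mmap_series in g00'.
have e1 := homog_subst_mmap (fun v => G (lift ord0 v)) g00' sq.
have e0 : mmap (@series_const F) (fun v => (mmap (@fpsC F) b (G (lift ord0 v)))%:F / g0) q =
    mmap (@series_const F) (fun v => mmap (@series_const F) (fun i => (b i)%:F) (G (lift ord0 v)) /
      mmap (@series_const F) (fun i => (b i)%:F) (G ord0)) q.
  by apply: eq_mmap => v; rewrite /g0 !mmap_series.
rewrite e0; split=> [e2|e2].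
  by apply: (mulfI (expf_neq0 (msize q) g00')); rewrite -[LHS]e1 -[LHS]mmap_series e2 mulr0 tofrac0.
by apply: tofrac_inj; rewrite mmap_series [LHS]e1 e2 mulr0 tofrac0.
Qed.

End BranchSeries.

Lemma local_limit_series (F : fieldType) a (f g : fps F) (z : {fraction (fps F)}) :
  z != 0 -> f%:F = z * g%:F ->
  match a with
  | To1 => fconst f = fconst g /\ fconst g != 0
  | To0 => fconst f = 0 /\ fconst g != 0
  | ToInfinity => fconst f != 0 /\ fconst g = 0
  end -> exists t, fconst t = 0 /\ local_coord a z = t%:F.
Proof.
have divE (x y : fps F) (c : {fraction (fps F)}) : fconst y != 0 -> x%:F = c * y%:F -> c = (x / y)%:F.
  move=> y0 e; have uy : y \is a GRing.unit by rewrite unitfpsE.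
  apply: (mulIf (x := y%:F)); first by rewrite tofrac_eq0 unitfps_neq0.
  by rewrite -e -tofracM divrK.
have cV (x : fps F) : fconst x != 0 -> fconst x^-1 = (fconst x)^-1.
  move=> x0; apply: (mulfI x0); rewrite divff // -fconstM divrr ?fconst1 //.
move=> z0 e; case: a => -[h1 h2].
- exists (1 - f / g); split; first by rewrite fconstB fconst1 fconstM cV // h1 divff // subrr.
  by rewrite /= (divE _ _ _ h2 e) -tofrac1 -tofracB.
- exists (f / g); split; first by rewrite fconstM h1 mul0r.
  exact: (divE _ _ _ h2 e).
exists (g / f); split; first by rewrite fconstM h2 mul0r.
by apply: (divE _ _ _ h1); rewrite e mulKf.
Qed.

Lemma local_coord_morph (K L : fieldType) (phi : {rmorphism K -> L}) a z :
  phi (local_coord a z) = local_coord a (phi z).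
Proof. by case: a => //=; [rewrite rmorphB rmorph1|rewrite fmorphV]. Qed.

Section Substitution.
Variables (F : fieldType) (n : nat) (h : 'I_n -> nat) (e : 'I_n -> F) (a : 'I_n.+1 -> nat).
Variables (A : 'M[int]_(n.+1, n)) (Q : 'M[int]_(n, n.+1)).
Variables (s : fps F) (u : 'I_n -> fps F).
Hypotheses (s0 : fconst s = 0) (uu : forall m, u m \is a GRing.unit).
Hypothesis a_gt0 : forall v, (0 < a v)%N.

Lemma fcomp_param v : fcomp s (param a A fX u v) = param a A s (fcomp s \o u) v.
Proof.
have [fc fcE] := rmorphism_ex (fcomp_zmod s0) (fcomp_monoid s0).
rewrite /param -fcE rmorphM rmorphXn rmorph_prod fcE fcompX //; congr (_ * _).
by apply: eq_bigr => m _; rewrite rmorphXz // fcE.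
Qed.

Lemma fcomp_system : system h e a A Q fX u -> system h e a A Q s (fcomp s \o u).
Proof.
move=> su m; have [fc fcE] := rmorphism_ex (fcomp_zmod s0) (fcomp_monoid s0).
transitivity (fc (u m ^+ h m)); first by rewrite rmorphXn fcE.
rewrite su [LHS]rmorphM [X in _ * X = _]rmorph_prod; congr (_ * _); first by rewrite [LHS]fcE fcompC.
apply: eq_bigr => v _; rewrite rmorphXz; last by apply/unitfps_1B/fconst_param.
by rewrite rmorphB rmorph1 fcE fcomp_param.
Qed.

End Substitution.

Section IdealPoints.
Variable F : closedFieldType.
Hypothesis F0 : [pchar F] =i pred0.
Hypothesis F_fiber : forall f : F -> nat, exists k, infinite_set [set c | f c = k].
Variables (n : nat) (p p' p'' : 'I_n -> 'I_n.+1 -> nat) (I : 'I_n.+1 -> limit_value).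
Variable D : set 'rV[F]_n.+1.
Hypothesis hD : forall z : 'rV[F]_n.+1, D z <->
  shape_space z /\ forall i, gluing_value p p' p'' (fun v => z 0 v) i = 1.
Variables (V V' : 'M[int]_n) (U W : 'M[int]_n.+1) (h : 'I_n -> nat).
Hypothesis snf : V *m local_exponents p p' p'' I *m U = diag_block (fun i => (h i)%:Z).
Hypotheses (V'V : V' *m V = 1%:M) (UW : U *m W = 1%:M) (WU : W *m U = 1%:M).
Hypotheses (U_gt0 : forall v, 0 < U v ord_max) (h_gt0 : forall i, (0 < h i)%N).
Variable M : forall C : curve_in D, smooth_model (projective_completion (proj1_sig C)).

Local Notation L := {fraction (fps F)}.
Local Notation a := (uniformizer_exponents U).
Local Notation A := (unit_exponents U).
Local Notation Q := (system_exponents p p' p'' I V).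
Local Notation e := (system_const F p' p'' I V).
Local Notation coord u := (series_coord a A I u).
Local Notation at_series z := (mmap (@series_const F) z).

Let a_gt0 v : (0 < a v)%N. Proof. exact: uniformizer_exponents_gt0. Qed.

Lemma system_const_neq0 m : e m != 0.
Proof. by apply: monomials_neq0 => i; rewrite invr_eq0 local_sign_neq0. Qed.

Lemma series_coord_local (u : 'I_n -> fps F) v : local_coord (I v) (coord u v) = (param a A fX u v)%:F.
Proof. exact: local_coordK. Qed.

Lemma unit_tofrac_neq0 (u : fps F) : u \is a GRing.unit -> u%:F != 0 :> L.
Proof. by move=> uu; rewrite tofrac_eq0 unitfps_neq0. Qed.

Lemma unit_coord_series (u : 'I_n -> fps F) : (forall m, u m \is a GRing.unit) ->
  forall m, unit_coord W (fun v => local_coord (I v) (coord u v)) m = (u m)%:F.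
Proof.
move=> uu m; have X0 : fX%:F != 0 :> L by rewrite tofrac_eq0 fX_neq0.
rewrite -(param_coord WU U_gt0 (t := fun v => (param a A fX u v)%:F) X0 _ (series_param a A uu)).
  by apply: eq_monomials => v; exact: series_coord_local.
by move=> k; apply: unit_tofrac_neq0.
Qed.

Lemma series_gluing (u : 'I_n -> fps F) : (forall m, u m \is a GRing.unit) -> system h e a A Q fX u ->
  forall i, gluing_value p p' p'' (coord u) i = 1.
Proof.
move=> uu su; have cs := series_coord_shape A I a_gt0 uu.
apply/(gluing_system snf V'V UW cs) => m; rewrite unit_coord_series //.
rewrite [LHS](series_system a_gt0 su); congr (_ * _); first exact: system_const_morph.
by apply: eq_bigr => v _; rewrite series_coord_local.
Qed.

(** Both sides say that the polynomials [gluing_poly] vanish on [C]. *)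
Lemma curve_gluing (z : 'I_n.+1 -> L) (C : set 'rV[F]_n.+1) : (forall v, z v != 0 /\ z v != 1) ->
  affine_closed C -> (forall q, vanishes_on C q <-> at_series z q = 0) ->
  C `<=` D <-> forall i, gluing_value p p' p'' z i = 1.
Proof.
move=> zs cC hz; split=> [CD i|hg w Cw].
  apply/(gluing_polyP _ _ _ (@series_const F)) => //; apply/hz => w Cw.
  have /hD[sw /(_ i)] := CD w Cw.
  by move/(gluing_polyP _ _ _ idfun); apply; exact: sw.
have sw := affine_closed_shape cC Cw; apply/hD; split=> // i.
apply/(gluing_polyP _ _ _ idfun) => //.
have /hz := (gluing_polyP p p' p'' (@series_const F) i zs).1 (hg i).
by apply.
Qed.

Lemma series_curve (u : 'I_n -> fps F) : (forall m, u m \is a GRing.unit) -> system h e a A Q fX u ->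
  exists C : curve_in D, forall q, vanishes_on (proj1_sig C) q <-> at_series (coord u) q = 0.
Proof.
move=> uu su; have cs := series_coord_shape A I a_gt0 uu.
have hz q : vanishes_on (generic_curve (@series_const F) (coord u)) q <-> at_series (coord u) q = 0.
  exact: (generic_curve_vanishes F_fiber _ cs).
have irr : irreducible_curve (@affine_closed F n.+1) (generic_curve (@series_const F) (coord u)).
  have nc : exists v, forall c, coord u v <> series_const c.
    by exists ord0 => c; apply: series_coord_nonconstant.
  exact: (generic_curve_irreducible_curve F_fiber (series_char0 F0) cs nc
    (series_derivation F0 I h_gt0 a_gt0 system_const_neq0 uu su)).
have CD : generic_curve (@series_const F) (coord u) `<=` D.
  by apply/(curve_gluing cs _ hz); [case: irr => -[]|apply: series_gluing].
pose C : curve_in D := exist _ (generic_curve (@series_const F) (coord u)) (conj irr CD).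
by exists C.
Qed.

(* The ideal point [P] is the centre of the branch [b], a lift of the series [coord u] to the smooth model. *)
Definition corresponds (eta : 'I_n -> F) (P : {C : curve_in D & ppoint F (sm_dim (M C))}) :=
  let C := proj1_sig (projT1 P) in let X := @sm_curve _ _ _ (M (projT1 P)) in
  exists (u : 'I_n -> fps F) (b : 'I_(sm_dim (M (projT1 P))).+1 -> fps F) i0,
  [/\ (forall m, fconst (u m) = eta m) /\ system h e a A Q fX u,
      forall q, vanishes_on C q <-> at_series (coord u) q = 0,
      b i0 = 1 /\ (X (projT2 P) /\ hcoords (projT2 P) (\row_i fconst (b i))),
      forall d q, homogeneous d q -> vanishes X q <-> mmap (@fpsC F) b q = 0 &
      forall x d G k h, X x -> represents x d G k h -> forall v,
        (mmap (@fpsC F) b (G (lift ord0 v)))%:F = coord u v * (mmap (@fpsC F) b (G ord0))%:F].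

Lemma curve_in_irreducible (C : curve_in D) :
  irreducible_closed (@affine_closed F n.+1) (proj1_sig C).
Proof. by case: (proj2_sig C) => -[]. Qed.

Lemma unit_of_const (u : 'I_n -> fps F) eta : (forall m, eta m != 0) ->
  (forall m, fconst (u m) = eta m) -> forall m, u m \is a GRing.unit.
Proof. by move=> eta0 uc m; rewrite unitfpsE uc. Qed.

Lemma corresponds_exists (eta : 'I_n -> F) : (forall m, eta m != 0) -> (forall m, eta m ^+ h m = e m) ->
  exists P, corresponds eta P.
Proof.
move=> eta0 he; have [u [uc su]] := system_exists F0 A Q h_gt0 a_gt0 (rmorph0 fconst : fconst fX = 0) eta0 he.
have uu := unit_of_const eta0 uc.
have [C hz] := series_curve uu su.
have [b [i0 [b1 Xb Gb _]]] := generic_branch (curve_in_irreducible C) (M C) hz.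
have bn : \row_i fconst (b i) != 0.
  by apply/eqP => /rowP/(_ i0); rewrite !mxE b1 fconst1 => /eqP; rewrite oner_eq0.
have [x hx] := hcoords_point bn.
(* Every form vanishing on the model vanishes along [b], hence at its centre, and the model is
   closed. *)
have Xx : @sm_curve _ _ _ (M C) x.
  have [cX _ _] := model_irreducible (M C); apply: contrapT => nx.
  have [d [q [hq Xq nq]]] := proj_closedP cX nx; apply: nq; apply/(pzeroP hq hx).
  by rewrite -fconst_mmap ((Xb d q hq).1 Xq) fconst0.
by exists (existT _ C x), u, b, i0; split.
Qed.

Section Point.
Variables (eta : 'I_n -> F) (P : {C : curve_in D & ppoint F (sm_dim (M C))}).
Hypotheses (eta0 : forall m, eta m != 0) (cP : corresponds eta P).
Local Notation C := (proj1_sig (projT1 P)).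
Local Notation X := (@sm_curve _ _ _ (M (projT1 P))).
Local Notation x := (projT2 P).

(** Otherwise all of [G] would vanish along [b], and [G] would give the zero vector at the
    centre. *)
Lemma corresponds_rep0 d G k g (u : 'I_n -> fps F) (b : 'I_(sm_dim (M (projT1 P))).+1 -> fps F) :
  X x -> hcoords x (\row_i fconst (b i)) -> represents x d G k g ->
  (forall v, (mmap (@fpsC F) b (G (lift ord0 v)))%:F = coord u v * (mmap (@fpsC F) b (G ord0))%:F) ->
  mmap (@fpsC F) b (G ord0) != 0.
Proof.
move=> Xx hx [hG _ gx rG] Gb; apply/eqP => G0.
have [+ _] := rG x _ Xx hx (gx _ hx); case/eqP; apply/rowP => i; rewrite !mxE -fconst_mmap.
case: (unliftP ord0 i) => [v ->|->]; last by rewrite G0 fconst0.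
have := Gb v; rewrite G0 tofrac0 mulr0 -tofrac0 => /tofrac_inj ->; exact: fconst0.
Qed.

(** If the centre lay over a point of [C], the first coordinate would tend to a finite value other
    than 0 and 1, whereas along the branch it tends to [I ord0]. *)
Lemma corresponds_ideal : ideal_points M P.
Proof.
have [u [b [i0 [[uc su] hz [b1 [Xx hx]] Xb Gb]]]] := cP; have uu := unit_of_const eta0 uc.
split=> //; split; first exact: sm_maps.
move=> [z0 Cz0 hz0]; have irr := curve_in_irreducible (projT1 P); have [cC _ _] := irr.
have sz := affine_closed_shape cC Cz0.
have [d [G [k [g rep]]]] := represents_exists Xx; have [hG _ gx rG] := rep.
have [c c0 /rowP cE] := hcoords_prop hz0 (rG x _ Xx hx (gx _ hx)).
have GE i : fconst (mmap (@fpsC F) b (G i)) = c * affine_coords z0 0 i.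
  by have := cE i; rewrite mxE [RHS]mxE fconst_mmap.
have t0 : fconst (param a A fX u ord0) = 0 by apply: fconst_param.
have := local_limit t0 (erefl : coord u ord0 = _) (param_neq0 _ _ uu ord0) (Gb x d G k g Xx rep ord0).
rewrite !GE affine_coords0 affine_coordsS mulr1; have [z00 z01] := sz ord0.
case: (I ord0) => /eqP; last by rewrite (negbTE c0).
  by rewrite -subr_eq0 -{2}[c]mulr1 -mulrBr mulf_eq0 (negbTE c0) subr_eq0 (negbTE z01).
by rewrite mulf_eq0 (negbTE c0) (negbTE z00).
Qed.

(** [G ord0] and [G (lift ord0 v)] may both vanish at the point, so [curve_ratio] first replaces
    them by forms in the same ratio that do not. *)
Lemma corresponds_tends_to v : tends_to x v (I v).
Proof.
have [u [b [i0 [[uc su] hz [b1 [Xx hx]] Xb Gb]]]] := cP; have uu := unit_of_const eta0 uc.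
have irr := curve_in_irreducible (projT1 P).
have [d [G [k [g rep]]]] := represents_exists Xx; have [hG _ gx rG] := rep.
have Gv := Gb x d G k g Xx rep; have G0 := corresponds_rep0 Xx hx rep Gv.
have nG0 : ~ vanishes X (G ord0) by move/(Xb _ _ (hG ord0)) => e0; move: G0; rewrite e0 eqxx.
have nGv : ~ vanishes X (G (lift ord0 v)).
  move/(Xb _ _ (hG _)) => e0; move: (Gv v); rewrite e0 tofrac0 => /esym/eqP.
  rewrite mulf_eq0 tofrac_eq0 (negbTE G0) orbF; apply/negP.
  by case: (series_coord_shape A I a_gt0 uu v).
have b1' : (\row_i fconst (b i)) 0 i0 = 1 by rewrite mxE b1 fconst1.
have [d1 [A1 [B1 [hA hB AB nAB]]]] := curve_ratio (sm_smooth _) Xx hx b1' (hG _) (hG _) nGv nG0.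
have t0 : fconst (param a A fX u v) = 0 by apply: fconst_param.
have ABv : (mmap (@fpsC F) b A1)%:F = coord u v * (mmap (@fpsC F) b B1)%:F.
  have hAB : homogeneous (d + d1) (G (lift ord0 v) * B1 - A1 * G ord0).
    by apply: homogeneousB; [|rewrite addnC]; apply: homogeneousM.
  have /eqP := (Xb _ _ hAB).1 AB; rewrite raddfB /= !rmorphM /= subr_eq0 => /eqP e1.
  apply: (mulIf (x := (mmap (@fpsC F) b (G ord0))%:F)); first by rewrite tofrac_eq0; exact: G0.
  by rewrite mulrAC -Gv -!tofracM -e1.
have lim := local_limit t0 (erefl : coord u v = _) (param_neq0 _ _ uu v) ABv.
have [d' [H [e' [k' [a' [hA' [[_ hk] [hhA nhA] k_ex inv_ex inv_id]]]]]]] := inverse_exists (M (projT1 P)).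
exists d1, A1, B1; split=> //.
  apply: (vanishes_tends_to irr hk hhA nhA k_ex inv_ex inv_id Xx rep hA hB).
  move=> y Xy w hw; have := AB y Xy w hw; rewrite /poly_eval !mevalB !mevalM => /subr0_eq e1.
  by rewrite [meval _ B1 * _]mulrC e1 subrr.
move=> w hw; have [c c0 ->] := hcoords_prop hx hw.
rewrite !(poly_evalZ _ _ hA) !(poly_evalZ _ _ hB).
have cn : c ^+ d1 != 0 by rewrite expf_neq0.
rewrite !mulf_eq0 (negbTE cn) /=; move: lim; rewrite !fconst_mmap.
case: (I v) => lim; move: nAB; rewrite lim ?eqxx => -[] // nAB; split=> //; by rewrite mulr0.
Qed.

Lemma corresponds_ideal_at : ideal_points_at M I P.
Proof. by split; [exact: corresponds_ideal|exact: corresponds_tends_to]. Qed.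

End Point.

(** [num / den] represents [u m] along either branch. Replaced through [curve_ratio] by a quotient
    [A1 / B1] that is defined at the point, it has one value there, which is both [eta m] and
    [eta' m]. *)
Lemma corresponds_inj (eta eta' : 'I_n -> F) P : (forall m, eta m != 0) -> (forall m, eta' m != 0) ->
  corresponds eta P -> corresponds eta' P -> eta =1 eta'.
Proof.
move=> eta0 eta0' [u [b [i0 [[uc su] hz [b1 [Xx hx]] Xb Gb]]]].
move=> [u' [b' [_ [[uc' su'] hz' [_ [_ hx']] Xb' Gb']]]] m.
have uu := unit_of_const eta0 uc; have uu' := unit_of_const eta0' uc'.
have [d [G [k [g rep]]]] := represents_exists Xx; have [hG _ gx rG] := rep.
pose num := split_prod (fun v => local_num (I v) (G ord0) (G (lift ord0 v)))
  (fun v => local_den (I v) (G ord0) (G (lift ord0 v))) (fun v => W (widen_ord (leqnSn n) m) v).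
pose den := split_prod (fun v => local_den (I v) (G ord0) (G (lift ord0 v)))
  (fun v => local_num (I v) (G ord0) (G (lift ord0 v))) (fun v => W (widen_ord (leqnSn n) m) v).
(* Each index contributes equally many factors of degree [d] to numerator and denominator, which
   therefore have the same degree. *)
pose N := (\sum_v d * absz (W (widen_ord (leqnSn n) m) v))%N.
have hln v : homogeneous d (local_num (I v) (G ord0) (G (lift ord0 v))).
  by case: (I v) => //=; apply: homogeneousB.
have hld v : homogeneous d (local_den (I v) (G ord0) (G (lift ord0 v))) by case: (I v) => /=.
have hsp (x y : 'I_n.+1 -> mpoly _ F) : (forall v, homogeneous d (x v)) ->
    (forall v, homogeneous d (y v)) ->
    homogeneous N (split_prod x y (fun v => W (widen_ord (leqnSn n) m) v)).
  move=> hx0 hy0; apply: homogeneous_prod => v; case: (W _ v) => l; exact: homogeneousXn.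
have hnum : homogeneous N num by apply: hsp.
have hden : homogeneous N den by apply: hsp.
have key (w : 'I_n -> fps F) (c : 'I_n -> F) : (forall m, c m != 0) -> (forall m, fconst (w m) = c m) ->
    forall beta, hcoords (projT2 P) (\row_i fconst (beta i)) ->
    (forall v, (mmap (@fpsC F) beta (G (lift ord0 v)))%:F =
       coord w v * (mmap (@fpsC F) beta (G ord0))%:F) ->
    mmap (@fpsC F) beta num = w m * mmap (@fpsC F) beta den /\ mmap (@fpsC F) beta den != 0.
  move=> c0 wc beta hbeta Gv; have uw := unit_of_const c0 wc.
  have G0 := corresponds_rep0 Xx hbeta rep Gv.
  have sw v : coord w v != 0 by case: (series_coord_shape A I a_gt0 uw v).
  pose ev : {rmorphism _ -> L} := @FracField.tofrac (fps F) \o mmap (@fpsC F) beta.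
  have G0' : ev (G ord0) != 0 by rewrite tofrac_eq0; exact: G0.
  have tn v : local_coord (I v) (coord w v) != 0.
    by rewrite series_coord_local tofrac_eq0; exact: param_neq0.
  have nE v := local_ratio (I v) (sw v) (Gv v).
  have dn v := local_den_neq0 (I v) (sw v) G0' (Gv v).
  have sE := split_prodE (fun v => W (widen_ord (leqnSn n) m) v) dn tn nE.
  have numE : ev num = split_prod (fun v => local_num (I v) (ev (G ord0)) (ev (G (lift ord0 v))))
      (fun v => local_den (I v) (ev (G ord0)) (ev (G (lift ord0 v))))
      (fun v => W (widen_ord (leqnSn n) m) v).
    rewrite split_prod_morph; apply: eq_split_prod => v; first exact: local_num_morph.
    exact: local_den_morph.
  have denE : ev den = split_prod (fun v => local_den (I v) (ev (G ord0)) (ev (G (lift ord0 v))))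
      (fun v => local_num (I v) (ev (G ord0)) (ev (G (lift ord0 v))))
      (fun v => W (widen_ord (leqnSn n) m) v).
    rewrite split_prod_morph; apply: eq_split_prod => v; first exact: local_den_morph.
    exact: local_num_morph.
  split.
    apply: tofrac_inj; rewrite -[LHS]/(ev num) numE [LHS]sE -denE [RHS]tofracM.
    by rewrite -(unit_coord_series uw).
  rewrite -tofrac_eq0 -[X in X != 0]/(ev den) denE; apply: split_prod_neq0 => v; first exact: dn.
  by rewrite (nE v); apply: mulf_neq0; [exact: tn|exact: dn].
have [bnum bden] := key u eta eta0 uc b hx (Gb _ _ _ _ _ Xx rep).
have [bnum' bden'] := key u' eta' eta0' uc' b' hx' (Gb' _ _ _ _ _ Xx rep).
have nden : ~ vanishes (@sm_curve _ _ _ (M (projT1 P))) den.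
  by move/(Xb _ _ hden) => e0; move: bden; rewrite e0 eqxx.
have nnum : ~ vanishes (@sm_curve _ _ _ (M (projT1 P))) num.
  move/(Xb _ _ hnum) => e0; move: bnum; rewrite e0 => /esym/eqP.
  by rewrite mulf_eq0 (negbTE bden) (negbTE (unitfps_neq0 (uu m))).
have b1' : (\row_i fconst (b i)) 0 i0 = 1 by rewrite mxE b1 fconst1.
have [d1 [A1 [B1 [hA hB AB nAB]]]] := curve_ratio (sm_smooth _) Xx hx b1' hnum hden nnum nden.
have hAB : homogeneous (N + d1) (num * B1 - A1 * den).
  by apply: homogeneousB; [|rewrite addnC]; apply: homogeneousM.
have limit (w : 'I_n -> fps F) c beta : fconst (w m) = c -> mmap (@fpsC F) beta (num * B1 - A1 * den) = 0 ->
    mmap (@fpsC F) beta num = w m * mmap (@fpsC F) beta den -> mmap (@fpsC F) beta den != 0 ->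
    c * poly_eval B1 (\row_i fconst (beta i)) = poly_eval A1 (\row_i fconst (beta i)).
  move=> <-; rewrite raddfB /= !rmorphM /= => /subr0_eq e1 e2 d0.
  rewrite -!fconst_mmap -fconstM; congr fconst; apply: (mulIf d0).
  by rewrite -e1 e2 mulrAC.
have e1 := limit u _ b (uc m) ((Xb _ _ hAB).1 AB) bnum bden.
have e2 := limit u' _ b' (uc' m) ((Xb' _ _ hAB).1 AB) bnum' bden'.
have [c c0 cE] := hcoords_prop hx hx'; rewrite cE !(poly_evalZ _ _ hA) !(poly_evalZ _ _ hB) in e2.
have B0 : poly_eval B1 (\row_i fconst (b i)) != 0.
  by case: nAB => //; rewrite -e1; apply: contraNneq => ->; rewrite mulr0.
apply: (mulIf B0); rewrite e1; apply: (mulfI (expf_neq0 d1 c0)).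
by rewrite -e2 mulrCA.
Qed.


Lemma corresponds_surj P : ideal_points_at M I P -> exists eta : 'I_n -> F,
  [/\ forall m, eta m != 0, forall m, eta m ^+ h m = e m & corresponds eta P].
Proof.
case: P => C x [[/= Xx _] ht]; have irr := curve_in_irreducible C.
have [cC [w0 Cw0] _] := irr; have sw0 := affine_closed_shape cC Cw0.
have [v1 hv1] := hcoords_exists x.
have [j0 vj0] : exists i, v1 0 i != 0.
  have [v1n _] := hv1; apply: contrapT => hn; case/eqP: v1n; apply/rowP => i; rewrite mxE.
  by apply/eqP; apply: contrapT => /negP vi; apply: hn; exists i.
pose v0 := (v1 0 j0)^-1 *: v1.
have hv0 : hcoords x v0 by apply: hcoordsZ; rewrite ?invr_eq0.
have v0j0 : v0 0 j0 = 1 by rewrite mxE mulVf.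
have [b [bc Xb]] := curve_branch (sm_smooth _) Xx hv0 v0j0.
have v0E : \row_i fconst (b i) = v0 by apply/rowP => i; rewrite mxE.
have [d [G [k [g rep]]]] := represents_exists Xx; have [hG _ gx rG] := rep.
have [] := branch_series irr Xx rep Xb; set g0 := _%:F => g00.
set z := (fun v : 'I_n.+1 => _) => hz.
have Gz v : (mmap (@fpsC F) b (G (lift ord0 v)))%:F = z v * g0 by rewrite /z divfK.
have zs v : z v != 0 /\ z v != 1.
  have [s0 s1] := sw0 v; split; apply/eqP => zv.
    have /hz/(_ w0 Cw0) : at_series z (mpolyX F (mnm1 v)) = 0 by rewrite mmap_mpolyX.
    by rewrite /poly_eval mevalXU => /eqP; apply/negP.
  have /hz/(_ w0 Cw0) : at_series z (mpolyX F (mnm1 v) - 1) = 0.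
    by rewrite raddfB /= rmorph1 mmap_mpolyX zv subrr.
  by rewrite /poly_eval mevalB mevalXU meval1 => /eqP; rewrite subr_eq0; apply/negP.
have hg : forall i, gluing_value p p' p'' z i = 1.
  by apply/(curve_gluing zs cC hz); case: (proj2_sig C).
have [d' [H [e' [k' [a' [hA' [[_ hk] [hhA nhA] k_ex inv_ex inv_id]]]]]]] := inverse_exists (M C).
have /choice[t ht'] v : exists t, fconst t = 0 /\ local_coord (I v) (z v) = t%:F.
  have [d1 [A1 [B1 [[hA hB] hAB lim]]]] := ht v.
  have hAB' : homogeneous (d1 + d) (A1 * G ord0 - B1 * G (lift ord0 v)).
    by apply: homogeneousB; apply: homogeneousM.
  have AB := tends_to_vanishes irr hk hhA nhA k_ex inv_ex inv_id Xx rep hA hB hAB.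
  have eAB : (mmap (@fpsC F) b A1)%:F = z v * (mmap (@fpsC F) b B1)%:F.
    have := (Xb _ _ hAB').2 AB; rewrite raddfB /= !rmorphM /= => /subr0_eq e1.
    by apply: (mulIf g00); rewrite mulrAC -Gz -!tofracM e1 mulrC.
  apply: local_limit_series (zs v).1 eAB _.
  by rewrite !fconst_mmap v0E; exact: (lim v0 hv0).
have t0 v : fconst (t v) = 0 by case: (ht' v).
have tE v : local_coord (I v) (z v) = (t v)%:F by case: (ht' v).
have tn v : t v != 0.
  by rewrite -tofrac_eq0 -tE; case: (local_coord_shape (I v) (zs v).1 (zs v).2).
pose tz v := local_coord (I v) (z v).
have tzn v : tz v != 0 by rewrite /tz tE tofrac_eq0; exact: tn.
have sys := (gluing_system snf V'V UW zs).1 hg.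
have uQ m : fpsC (e m) * \prod_v (1 - t v) ^ Q m v \is a GRing.unit.
  rewrite unitrM; apply/andP; split; first by rewrite unitfpsE fconstC system_const_neq0.
  by apply: rpred_prod => v _; apply/unit_exprz/unitfps_1B.
(* The system expresses a power of this coordinate as a unit series, so it is itself a unit
   series. *)
have /choice[u hu] m : exists u, u \is a GRing.unit /\ unit_coord W tz m = u%:F.
  have [|u uu uE] := @laurent_root _ (unit_coord W tz m) _ _ (h_gt0 m) (uQ m); last by exists u.
  rewrite [LHS]sys [RHS]tofracM; congr (_ * _).
    exact: (esym (system_const_morph p' p'' (@series_const F) I V m)).
  rewrite rmorph_prod; apply: eq_bigr => v _.
  by rewrite [RHS]rmorphXz ?rmorphB ?rmorph1 ?tE //; exact: unitfps_1B.
have uu m : u m \is a GRing.unit by case: (hu m).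
have uE m : unit_coord W tz m = (u m)%:F by case: (hu m).
have tzE v : (t v)%:F = uniformizer W tz ^+ a v * (\prod_m u m ^ A v m)%:F.
  rewrite -tE -/(tz v) (local_coord_param U_gt0 v UW tzn) rmorph_prod; congr (_ * _).
  by apply: eq_bigr => m _; rewrite [RHS]rmorphXz ?uE.
have uA v : \prod_m u m ^ A v m \is a GRing.unit.
  by apply: rpred_prod => m _; apply: unit_exprz.
(* One local coordinate suffices: [t ord0] has positive order and is a positive power of the
   uniformizer times a unit. *)
have [s [s0 sn sE]] := laurent_positive (uA ord0) (t0 ord0) (tn ord0) (esym (tzE ord0)).
have pE v : param a A s u v = t v.
  by apply: tofrac_inj; rewrite [RHS]tzE sE -rmorphXn -tofracM.
have su : system h e a A Q s u.
  move=> m; apply: tofrac_inj; transitivity (unit_coord W tz m ^+ h m).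
    by rewrite uE [LHS]rmorphXn.
  rewrite [LHS]sys [RHS]system_rhs_tofrac //; congr (_ * _).
    exact: (esym (system_const_morph p' p'' (@series_const F) I V m)).
  by apply: eq_bigr => v _; rewrite pE tE.
pose eta m := fconst (u m).
have eta0 m : eta m != 0 by rewrite /eta -unitfpsE.
have he m : eta m ^+ h m = e m.
  by rewrite /eta -fconstXn su; apply: fconst_rhs.
exists eta; split=> //.
(* The standard solution with the same initial values; after substituting [s] for X it solves the
   same system as [u], so it equals [u] by uniqueness. *)
have [w [wc sw]] := system_exists F0 A Q h_gt0 a_gt0 (fconst0 _ : fconst fX = 0) eta0 he.
have uw := unit_of_const eta0 wc.
have wE : fcomp s \o w =1 u.
  apply: (system_unique F0 h_gt0 a_gt0 s0 eta0 _ _ (fcomp_system s0 uw a_gt0 sw) su) => // m.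
  by rewrite /= fconst_comp.
have [phi phiE] := series_subst s0 sn.
have zE v : phi (coord w v) = z v.
  have e1 : fcomp s (param a A fX w v) = t v.
    rewrite fcomp_param // -pE; congr (_ * _); apply: eq_bigr => m _; by rewrite wE.
  have e2 : local_coord (I v) (phi (coord w v)) = (t v)%:F.
    transitivity (phi (local_coord (I v) (coord w v))); first exact: (esym (local_coord_morph _ _ _)).
    by rewrite series_coord_local phiE e1.
  rewrite -[LHS](local_coordK (I v)) e2 -tE; exact: local_coordK.
have phiC c : phi (series_const c) = series_const c by rewrite [LHS]phiE fcompC.
(* The field morphism [phi] fixes constants and sends [coord w] to [z], so both satisfy the same
   polynomials. *)
have hzw q : vanishes_on (proj1_sig C) q <-> at_series (coord w) q = 0.
  rewrite hz -(eq_mmap _ (w := phi \o coord w)) // (phi_mmap _ _ phiC).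
  by split=> [/eqP|->]; rewrite ?rmorph0 // fmorph_eq0 => /eqP.
have [c [i0 [c1 Xc Gc ctr]]] := generic_branch irr (M C) hzw.
exists w, c, i0; split=> //; split=> //; split=> //=.
have Xb' d0 q : homogeneous d0 q -> vanishes (@sm_curve _ _ _ (M C)) q <-> mmap (@fpsC F) b q = 0.
  by move=> hq; rewrite (Xb _ _ hq).
have prop := ctr x d G k g b (fcomp s) phi Xx rep Xb' (fconst_comp s0) (fcompC s0) phiE _.
have cn : \row_i fconst (c i) != 0.
  by apply/eqP => /rowP/(_ i0); rewrite !mxE c1 fconst1 => /eqP; rewrite oner_eq0.
have [l l0 ->] : exists2 l, l != 0 & \row_i fconst (c i) = l *: v0.
  apply: (proportional (hv0.1) cn) => i j; rewrite ![(\row__ _) _ _]mxE -!bc.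
  by apply: prop => v; rewrite zE -Gz.
exact: hcoordsZ.
Qed.

Lemma curve_in_eq (C C' : curve_in D) : proj1_sig C = proj1_sig C' -> C = C'.
Proof. by case: C => C hC; case: C' => C' hC' /= e; subst C'; congr exist; apply: Prop_irrelevance. Qed.

(** Equal initial values give equal series, hence the same ideal and the same curve; by the last
    clause of [generic_branch], with the identity substitution, both branches have the same
    centre. *)
Lemma corresponds_unique (eta : 'I_n -> F) P P' : (forall m, eta m != 0) ->
  corresponds eta P -> corresponds eta P' -> P = P'.
Proof.
case: P => C x; case: P' => C' x' eta0 [u [b [i0 [[uc su] hz [b1 [Xx hx]] Xb Gb]]]].
move=> [u' [b' [i0' [[uc' su'] hz' [b1' [Xx' hx']] Xb' Gb']]]] /=.
have /funext uE := system_unique F0 h_gt0 a_gt0 (fconst0 _ : fconst fX = 0) eta0 uc uc' su su'.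
subst u'.
have irr := curve_in_irreducible C; have [cC _ _] := irr.
have [cC' _ _] := curve_in_irreducible C'.
have vE q : vanishes_on (proj1_sig C) q <-> vanishes_on (proj1_sig C') q.
  by rewrite hz hz'.
have CC : C = C'.
  apply: curve_in_eq; rewrite eqEsubset; split=> w Cw.
    apply/(affine_closedP cC'); split=> [|q /vE]; last exact.
    exact: affine_closed_shape Cw.
  apply/(affine_closedP cC); split=> [|q /vE]; last exact.
  exact: affine_closed_shape Cw.
subst C'; congr existT.
have [c [j0 [c1 Xc Gc ctr]]] := generic_branch irr (M C) hz.
have [d [G [k [g rep]]]] := represents_exists Xx.
have [d' [G' [k' [g' rep']]]] := represents_exists Xx'.
have cn : \row_i fconst (c i) != 0.
  by apply/eqP => /rowP/(_ j0); rewrite !mxE c1 fconst1 => /eqP; rewrite oner_eq0.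
have idphi (f : fps F) : (idfun : {rmorphism L -> L}) f%:F = (id f)%:F by [].
have centre y (beta : 'I_(sm_dim (M C)).+1 -> fps F) : hcoords y (\row_i fconst (beta i)) ->
    (forall i j, fconst (beta i) * fconst (c j) = fconst (beta j) * fconst (c i)) ->
    hcoords y (\row_i fconst (c i)).
  move=> hy hb; have [l l0 ->] : exists2 l, l != 0 & \row_i fconst (c i) = l *: \row_i fconst (beta i).
    by apply: (proportional hy.1 cn) => i j; rewrite !mxE.
  exact: hcoordsZ.
have ctr1 := ctr x d G k g b id idfun Xx rep Xb (fun=> erefl) (fun=> erefl) idphi (Gb _ _ _ _ _ Xx rep).
have ctr2 : forall i j, fconst (b' i) * fconst (c j) = fconst (b' j) * fconst (c i).
  apply: (ctr x' d' G' k' g' b' id idfun Xx' rep' Xb' (fun=> erefl) (fun=> erefl) idphi) => v.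
  exact: (Gb' _ _ _ _ _ Xx' rep' v).
exact: hcoords_inj (centre x b hx ctr1) (centre x' b' hx' ctr2).
Qed.

End IdealPoints.

(** * Counting *)

Section Roots.
Variable F : closedFieldType.
Hypothesis F0 : [pchar F] =i pred0.

Lemma nth_roots (c : F) k : c != 0 -> (0 < k)%N ->
  exists s : seq F, [/\ uniq s, size s = k & forall x, (x \in s) = (x ^+ k == c)].
Proof.
move=> c0 k0; pose q : {poly F} := 'X^k - c%:P.
have sq : size q = k.+1 by apply: size_XnsubC.
have [s qE] := closed_field_poly_normal q.
have mq : lead_coef q = 1 by apply/monicP/monicXnsubC.
rewrite mq scale1r in qE.
exists s; split=> [||x].
- rewrite -separable_prod_XsubC -qE unlock.
  have dq : deriv q = ('X^(k.-1)) *+ k by rewrite derivB derivC subr0 derivXn.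
  have kn : k%:R != 0 :> F by have /pcharf0P -> := F0; rewrite -lt0n.
  (* Bezout's identity for [q] and its derivative: [- (X^k - c) / c + (X / (c k)) k X^(k-1) = 1]. *)
  apply/Bezout_eq1_coprimepP; exists (- (c^-1)%:P, (c^-1 / k%:R) *: 'X) => /=.
  rewrite dq -scalerAl mulrnAr -exprS prednK // -scaler_nat scalerA divfK // /q mulrBr.
  by rewrite !mulNr opprK -polyCM mulVf // mul_polyC addrAC addNr add0r.
- by move/(congr1 (size \o val)): qE => /=; rewrite sq size_prod_XsubC => -[].
by rewrite -root_prod_XsubC -qE rootE hornerD hornerN hornerXn hornerC subr_eq0.
Qed.

(** A solution is coded by the position of each component in a list of roots; this finite index type
    has as many elements as the product of the [h m]. *)
Lemma root_tuples n (h : 'I_n -> nat) (c : 'I_n -> F) :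
  (forall m, c m != 0) -> (forall m, (0 < h m)%N) ->
  exists f : {dffun forall m, 'I_(h m)} -> 'I_n -> F,
    [/\ forall t m, f t m ^+ h m = c m, forall t t', f t =1 f t' -> t = t' &
        forall eta, (forall m, eta m ^+ h m = c m) -> exists t, f t =1 eta].
Proof.
move=> c0 h0; have /choice[s hs] m := nth_roots (c0 m) (h0 m).
have ss m : size (s m) = h m by case: (hs m).
exists (fun (t : {dffun forall m, 'I_(h m)}) m => nth 0 (s m) (t m)); split=> [t m|t t' e|eta he].
- by have [_ _ sE] := hs m; apply/eqP; rewrite -sE mem_nth // ss.
- apply/ffunP => m; apply/val_inj/eqP; have [us _ _] := hs m.
  by rewrite -(nth_uniq 0 _ _ us) ?ss ?ltn_ord //; apply/eqP; exact: (e m).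
have lt m : (index (eta m) (s m) < h m)%N.
  by have [_ _ sE] := hs m; rewrite -[X in (_ < X)%N]ss index_mem sE he.
exists [ffun m => Ordinal (lt m)] => m; rewrite ffunE nth_index //.
by have [_ _ ->] := hs m; rewrite he.
Qed.

End Roots.

Lemma card_range_finType (S : finType) T (f : S -> T) (A : set T) : injective f ->
  (forall s, A (f s)) -> (forall x, A x -> exists s, f s = x) -> (A #= `I_#|S|)%card.
Proof.
move=> fi fA fs; have -> : A = (f \o enum_val) @` [set: 'I_#|S|].
  rewrite eqEsubset; split=> [x /fs[s <-]|_ [i _ <-]]; last exact: fA.
  by exists (enum_rank s) => //=; rewrite enum_rankK.
apply: card_eq_trans (card_esym (card_II)).
by apply: inj_card_eq => i j _ _ /fi /enum_val_inj.
Qed.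

Lemma card_dffun_ord n (h : 'I_n -> nat) : #|{dffun forall m, 'I_(h m)}| = (\prod_m h m)%N.
Proof.
rewrite card_dep_ffun foldrE big_image; apply: eq_bigr => m _; exact: card_ord.
Qed.

Section Counting.
Variable F : closedFieldType.
Hypothesis F0 : [pchar F] =i pred0.
Hypothesis F_fiber : forall f : F -> nat, exists k, infinite_set [set c | f c = k].
Variables (n : nat) (p p' p'' : 'I_n -> 'I_n.+1 -> nat) (I : 'I_n.+1 -> limit_value).
Variable D : set 'rV[F]_n.+1.
Hypothesis hD : forall z : 'rV[F]_n.+1, D z <->
  shape_space z /\ forall i, gluing_value p p' p'' (fun v => z 0 v) i = 1.
Variable M : forall C : curve_in D, smooth_model (projective_completion (proj1_sig C)).

Theorem card_ideal_points_at (d := minor_vector (local_exponents p p' p'' I)) :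
  (forall v, 0 < d v) \/ (forall v, d v < 0) ->
  (ideal_points_at M I #= `I_(\big[gcdn/0%N]_v absz (d v)))%card.
Proof.
move=> /smith_positive_kernel[V [V' [U [W [h [snf V'V [UW WU] U0 [h0 <-]]]]]]].
have c0 := system_const_neq0 F p' p'' I V.
have [f [fE fi fs]] := root_tuples F0 c0 h0.
have f0 t m : f t m != 0.
  by apply: contraNneq (c0 m) => e; rewrite -(fE t) e expr0n eqn0Ngt h0.
have /choice[Phi hPhi] t := corresponds_exists F0 F_fiber hD snf V'V UW WU U0 h0 M (f0 t) (fE t).
rewrite -card_dffun_ord; apply: (card_range_finType (f := Phi)) => [t t' e|t|P hP].
- apply: fi; apply: (corresponds_inj WU U0 (f0 t) (f0 t') (hPhi t)); rewrite e; exact: hPhi.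
- exact: (corresponds_ideal_at U0 (f0 t) (hPhi t)).
have [eta [eta0 he cP]] := corresponds_surj F0 hD snf V'V UW U0 h0 hP.
have [t te] := fs eta he; exists t.
rewrite -(funext te) in cP; exact: (corresponds_unique F0 U0 h0 (f0 t) (hPhi t) cP).
Qed.

End Counting.

Theorem theorem4p1 (R : realType) (N : topologicalType)
    (hN : compact_3manifold R N)
    (hT : homeomorphic_sets (manifold_boundary R N) (torus R))
    (n : nat) (K : gluing n) (hK : ideal_triangulation R N K)
    (e : 'I_n * {set 'I_4} -> 'I_n) (he : edge_numbering K e)
    (c : 'I_n -> {set 'I_4}) (hc : forall nu, #|c nu| = 2%N)
    (hD : deformation_variety R[i] e c !=set0)
    (M : forall C : curve_in (deformation_variety R[i] e c),
       smooth_model (projective_completion (proj1_sig C)))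
    (I : 'I_n -> limit_value)
    (hd : (forall nu, 0 < degeneration_vector R[i] e c I nu) \/
          (forall nu, degeneration_vector R[i] e c I nu < 0)) :
  ideal_points_at M I !=set0 /\
  (ideal_points_at M I #=
    `I_(\big[gcdn/0%N]_(nu < n) `|degeneration_vector R[i] e c I nu|%N))%card.
Proof.
(* [one_vertex] provides a vertex of some tetrahedron, which excludes [n = 0]; with [n.+1]
   tetrahedra the equations are indexed by ['I_n]. *)
case: n K hK e he c hc hD M I hd => [|n] K [[[[x xlt] _] _] _] //.
move=> e _ c _ _ M I hd {hN hT K xlt}.
pose F : closedFieldType := R[i].
have F0 : [pchar F] =i pred0 := @pchar_num R[i].
have F_fiber (f : F -> nat) := uncountable_fiber f (@complex_uncountable R).
pose p i v := p0 R[i] e c (to_ord i) v.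
pose p' i v := p1 R[i] e c (to_ord i) v.
pose p'' i v := p2 R[i] e c (to_ord i) v.
have hDz (z : 'rV[F]_n.+1) : deformation_variety R[i] e c z <->
    shape_space z /\ forall i, gluing_value p p' p'' (fun v => z 0 v) i = 1 by [].
have mE : degeneration_matrix R[i] e c I = local_exponents p p' p'' I.
  by apply/matrixP => i v; rewrite !mxE.
have dE v : degeneration_vector R[i] e c I v = minor_vector (local_exponents p p' p'' I) v.
  by rewrite /degeneration_vector mE.
have hd' : (forall v, 0 < minor_vector (local_exponents p p' p'' I) v) \/
    (forall v, minor_vector (local_exponents p p' p'' I) v < 0).
  by case: hd => h; [left|right] => v; rewrite -dE.
have card := card_ideal_points_at F0 F_fiber hDz M hd'.
under eq_bigr do rewrite dE.
split; last exact: card.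
(* Existence follows from the count: the gcd is positive because an entry of the vector is
   nonzero. *)
apply/set0P/eqP => e0; move: card; rewrite e0 => /card_esym; rewrite card_eq0 => /eqP g0.
have [g g0' gE] : exists2 g, (0 < g)%N & \big[gcdn/0]_v `|minor_vector (local_exponents p p' p'' I) v|%N = g.
  have d0 : (0 < `|minor_vector (local_exponents p p' p'' I) ord0|)%N.
    by rewrite absz_gt0; case: hd' => /(_ ord0) h; [exact: lt0r_neq0|exact: ltr0_neq0].
  exists (\big[gcdn/0]_v `|minor_vector (local_exponents p p' p'' I) v|%N) => //.
  by apply: (dvdn_gt0 d0); apply: (biggcdn_inf ord0).
by have : `I_g 0%N by []; rewrite -gE g0.
Qed.
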